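(* Let $\kappa\in(0,1]$. The metric space $(\mathfrak M_\bullet(\tau),d^{\tau,\mathrm{BL}^\kappa}_{\mathfrak M_\bullet})$ is complete and separable.
   Context: A metric space is boundedly compact if every closed bounded subset is compact. A root-and-measured boundedly compact metric space is $(X,d^X,\rho_X,\mu_X)$ with $(X,d^X)$ a (non-empty) boundedly compact metric space, $\rho_X\in X$ a root and $\mu_X$ a Radon measure on $X$. Two such are equivalent if there is a root-preserving isometry from one onto the other pushing the first measure to the second. $\mathfrak M_\bullet(\tau)$ is a set of such spaces containing exactly one representative of each equivalence class. For a rooted boundedly compact space $(Z,d^Z,\rho_Z)$, $D(\rho_Z,r)=\{z:d^Z(\rho_Z,z)\le r\}$. For closed $A,B\subseteq Z$, $d^{Z,\rho_Z}_{\mathrm H}(A,B)=\int_0^\infty e^{-r}\bigl(1\wedge d^Z_{\mathrm H}(A\cap D(\rho_Z,r),B\cap D(\rho_Z,r))\bigr)dr$, where $d^Z_{\mathrm H}$ is the Hausdorff (extended) distance, $d^Z_{\mathrm H}(A,B)=\inf\{\varepsilon>0:A\subseteq B^\varepsilon,B\subseteq A^\varepsilon\}$ with $\inf\emptyset=\infty$. For finite Radon measures on $Z$, $d^Z_{\mathrm{BL}^\kappa}(\mu,\nu)=\sup\{|\int f\,d(\mu-\nu)|:\|f\|_{\mathrm{BL}^\kappa(Z)}\le1\}$, $\|f\|_{\mathrm{BL}^\kappa(Z)}=\sup_Z|f|+\sup_{x\ne y}|f(x)-f(y)|/d^Z(x,y)^\kappa$. For Radon measures on $Z$, $d^{Z,\rho_Z}_{\mathrm{BL}^\kappa}(\mu,\nu)=\int_0^\infty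 e^{-r}\bigl(1\wedge d^Z_{\mathrm{BL}^\kappa}(\mu(\cdot\cap D(\rho_Z,r)),\nu(\cdot\cap D(\rho_Z,r)))\bigr)dr$. $d^{\tau,\mathrm{BL}^\kappa}_{\mathfrak M_\bullet}(\mathcal X,\mathcal Y)=\inf_{f,g,Z}\{d^{Z,\rho_Z}_{\mathrm H}(f(X),g(Y))\vee d^{Z,\rho_Z}_{\mathrm{BL}^\kappa}(\mu_X\circ f^{-1},\mu_Y\circ g^{-1})\}$, the infimum over all rooted boundedly compact metric spaces $(Z,d^Z,\rho_Z)$ and root-preserving isometric embeddings $f:X\to Z$, $g:Y\to Z$. *)

(* Defs.v *)
From HB Require Import structures.
From mathcomp Require Import all_boot all_order all_algebra.
From mathcomp Require Import all_classical all_reals all_analysis.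

Set Implicit Arguments.
Unset Strict Implicit.
Unset Printing Implicit Defensive.

Import Order.TTheory GRing.Theory Num.Theory.
Import numFieldNormedType.Exports.

Local Open Scope classical_set_scope.
Local Open Scope ring_scope.

Definition mdisc (R : realType) (T : metricType R) (p : T) (r : R) : set T :=
  [set z | mdist p z <= r].

Definition mbounded (R : realType) (T : metricType R) (A : set T) : Prop :=
  exists (p : T) (r : R), A `<=` mdisc p r.

(* Rooted boundedly compact metric spaces; the root is the distinguished
   element [point] of the pointed structure. *)
HB.mixin Record isBoundedlyCompact (R : realType) T
    & Metric R T & Pointed T := {
  boundedly_compact : forall A : set T, closed A -> mbounded A -> compact A
}.

#[short(type="rbcmType")]
HB.structure Definition RootedBoundedlyCompact (R : realType) :=
  {T of Metric R T & Pointed T & isBoundedlyCompact R T}.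

Notation borel T := (g_sigma_algebraType (@open T)).

Section root_disc.
Variables (R : realType) (Z : rbcmType R).

Definition root_disc (r : R) : set (borel Z) := mdisc (point : Z) r.

Lemma measurable_root_disc (r : R) : measurable (root_disc r).
Proof.
rewrite -[root_disc r]setCK; apply: measurableC; apply: sub_gen_smallest.
rewrite openE => z /= /negP; rewrite -ltNge => rz.
rewrite /interior /=; apply/nbhs_ballP.
exists (mdist (point : Z) z - r); first by rewrite /= subr_gt0.
move=> y; rewrite ballEmdist /= => zy; apply/negP; rewrite -ltNge.
move: zy; rewrite ltrBrDl (metric_sym z y) => zy.
rewrite -(ltrD2r (mdist y z)); apply: lt_le_trans zy _.
exact: metric_triangle.
Qed.

End root_disc.

Arguments root_disc {R} Z r.
Arguments measurable_root_disc {R} Z r.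

Section distances.
Variable R : realType.

Local Open Scope ereal_scope.

(* The neighbourhoods A^e are taken closed; the infimum in [hausdorff_dist] is
   the same with open ones. *)
Definition mneighborhood (Z : metricType R) (A : set Z) (e : R) : set Z :=
  [set z | exists2 a, A a & (mdist z a <= e)%R].

Definition hausdorff_dist (Z : metricType R) (A B : set Z) : \bar R :=
  ereal_inf [set e%:E | e in
    [set e : R | [/\ (0 < e)%R, A `<=` mneighborhood B e
                   & B `<=` mneighborhood A e]]].

Definition exp_average (delta : R -> \bar R) : \bar R :=
  \int[@lebesgue_measure R]_(r in `[0%R, +oo[)
    ((expR (- r))%:E * mine 1 (delta r)).

Definition rooted_hausdorff_dist (Z : rbcmType R) (A B : set Z) : \bar R :=
  exp_average (fun r => hausdorff_dist (A `&` root_disc Z r)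
                                       (B `&` root_disc Z r)).

(* The element 0 is added so that the seminorm is 0, and not -oo, on a
   one-point space. *)
Definition holder_seminorm (kappa : R) (Z : metricType R) (f : Z -> R) :
    \bar R :=
  ereal_sup (0 |` [set (`|f xy.1 - f xy.2| / mdist xy.1 xy.2 `^ kappa)%:E
                  | xy in [set xy : Z * Z | xy.1 <> xy.2]]).

Definition BLnorm (kappa : R) (Z : metricType R) (f : Z -> R) : \bar R :=
  ereal_sup [set `|f z|%:E | z in [set: Z]] + holder_seminorm kappa f.

(* Meant for finite measures, for which both integrals are finite: a function
   of finite BL norm is bounded and continuous. *)
Definition BLdist (kappa : R) (Z : rbcmType R)
    (mu nu : set (borel Z) -> \bar R) : \bar R :=
  ereal_sup [set `|\int[mu]_z (f z)%:E - \int[nu]_z (f z)%:E|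
            | f in [set f : Z -> R | BLnorm kappa f <= 1]].

Definition rooted_BLdist (kappa : R) (Z : rbcmType R)
    (mu nu : set (borel Z) -> \bar R) : \bar R :=
  exp_average (fun r => BLdist kappa
    (mrestr mu (measurable_root_disc Z r))
    (mrestr nu (measurable_root_disc Z r))).

Definition radon (Z : rbcmType R) (mu : set (borel Z) -> \bar R) : Prop :=
  (forall K : set Z, compact K -> mu K < +oo) /\
  (forall A : set (borel Z), measurable A ->
    mu A = ereal_sup [set mu K | K in [set K : set Z | compact K /\ K `<=` A]]).

Record rmbcmSpace := RMBCMSpace {
  rmbcm_space :> rbcmType R ;
  rmbcm_measure : {measure set (borel rmbcm_space) -> \bar R} ;
  rmbcm_radon : radon rmbcm_measure
}.

Definition rooted_isometry (X Y : rbcmType R) (f : X -> Y) : Prop :=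
  f point = point /\ forall x y, mdist (f x) (f y) = mdist x y.

Definition rmbcm_pushforward (X : rmbcmSpace) (Z : rbcmType R) (f : X -> Z) :
    set (borel Z) -> \bar R :=
  pushforward (rmbcm_measure X) (f : borel X -> borel Z).

(* Only values on Borel sets are compared: the underlying set functions are
   arbitrary elsewhere. *)
Definition rmbcm_equiv (X Y : rmbcmSpace) : Prop :=
  exists f : X -> Y, [/\ rooted_isometry f, set_surj setT setT f
    & forall A : set (borel Y), measurable A ->
        rmbcm_pushforward f A = rmbcm_measure Y A].

Definition GHV_dist (kappa : R) (X Y : rmbcmSpace) : \bar R :=
  ereal_inf [set d | exists (Z : rbcmType R) (f : X -> Z) (g : Y -> Z),
    [/\ rooted_isometry f, rooted_isometry g
      & d = maxe (rooted_hausdorff_dist (range f) (range g))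
                 (rooted_BLdist kappa (rmbcm_pushforward f)
                                      (rmbcm_pushforward g))]].

Definition rmbcm_transversal (M : set rmbcmSpace) : Prop :=
  forall X, exists! Y, M Y /\ rmbcm_equiv X Y.

End distances.

(* Distances are kept in the extended reals because they arise as infima; the
   first clause of [metric_on] asserts that they are finite. *)
Section metric_on.
Variables (R : realType) (T : Type) (M : set T) (d : T -> T -> \bar R).

Local Open Scope ereal_scope.

Definition metric_on : Prop :=
  [/\ forall x y, M x -> M y -> 0 <= d x y < +oo,
      forall x y, M x -> M y -> (d x y = 0 <-> x = y),
      forall x y, M x -> M y -> d x y = d y x
    & forall x y z, M x -> M y -> M z -> d x z <= d x y + d y z].

Definition complete_on : Prop :=
  forall u : nat -> T, (forall n, M (u n)) ->
    (forall e : R, (0 < e)%R -> exists N : nat, forall m n : nat,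
       (N <= m)%N -> (N <= n)%N -> d (u m) (u n) < e%:E) ->
    exists2 l, M l & (d (u n) l @[n --> \oo] --> 0).

Definition separable_on : Prop :=
  exists S : set T, [/\ S `<=` M, countable S
    & forall x, M x -> forall e : R, (0 < e)%R ->
        exists2 s, S s & d x s < e%:E].

End metric_on.

(* Main.v *)
Require Import Defs.
From HB Require Import structures.
From mathcomp Require Import all_boot all_order all_algebra.
From mathcomp Require Import all_classical all_reals all_analysis.
From mathcomp Require Import measurable_realfun lra.

Set Implicit Arguments.
Unset Strict Implicit.
Unset Printing Implicit Defensive.

Import Order.TTheory GRing.Theory Num.Theory.
Import numFieldNormedType.Exports.

Local Open Scope classical_set_scope.
Local Open Scope ring_scope.

(** Both localized distances are averages over the radius [r] of a discrepancy
    between the restrictions to the disc of radius [r].  The proof replaces them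
    by a relation with a single radius: [GHV_near f g a e] says that up to
    radius [a] the images of the two spaces are within [e] of each other, and that
    the integrals of Hoelder test functions supported in the disc of radius [a]
    differ by at most [e].  Small distance implies nearness
    ([dist_in_near]), because small averages have small integrands at a common
    radius.  Conversely, for a given space [X] there is an [n] such that nearness
    at radius [n] with tolerance [1 / (n + 1)] implies small distance
    ([near_dist_in]): for fixed [r] the discrepancy can only be caused by what
    happens close to the sphere of radius [r], hence it is small unless [r] is one of
    the countably many radii at which the discs of [X] or their masses
    jump, and dominated convergence applies.

    The axioms of a metric.  The triangle inequality follows by amalgamating two
    ambient spaces along the middle space ([rbcm_glue], [rbcm_amalgam]).  If the
    distance of [X] and [Y] is 0, then [X] and [Y] are near at all scales in a
    sequence of ambient spaces; identifying [x] with [y] when their images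
    become arbitrarily close along an ultrafilter gives an isometry, and tents
    around compact sets show that it preserves the measures ([near_equiv]).

    Completeness.  A Cauchy sequence has a subsequence in which consecutive spaces
    are near with tolerances [2^-n] at radius [n].  Glueing them one after the other and
    completing gives one boundedly compact space that contains the whole
    subsequence ([ambient_chain]); nearness passes to this space since Hoelder
    functions extend ([near_transfer]).  In it the images of the spaces converge along an
    ultrafilter to a closed set, and the measures converge vaguely to a measure
    ([vague_limit]) that is carried by this set ([limit_space]).

    Separability.  Finitely many integers record, up to a small error, the mutual
    distances of the points of a finite net of a disc and the masses of the
    cells around them.  Two spaces with the same record can be glued along their
    nets and are near ([code_near]); so it suffices to choose one space for
    each record that occurs, and there are countably many records. *)

(** * Limits along ultrafilters *)

Lemma filter_all (T : Type) (F : set_system T) (B : set T) : Filter F -> (forall t, B t) -> F B.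
Proof. by move=> FF allB; apply: filterS (fun t _ => allB t) filterT. Qed.

Lemma filter_fin (T : Type) (F : set_system T) (n : nat) (A : nat -> set T) : Filter F ->
  (forall i, (i < n)%N -> F (A i)) -> F [set t | forall i, (i < n)%N -> A i t].
Proof.
move=> FF; elim: n => [|n IH] FA; first by apply: filter_all => t i.
have IHn : F [set t | forall i, (i < n)%N -> A i t].
  by apply: IH => i ilt; apply: FA; rewrite ltnS ltnW.
apply: filterS2 IHn (FA n (ltnSn n)) => t At Ant i; rewrite ltnS leq_eqVlt.
by move=> /orP[/eqP ->|/At].
Qed.

Lemma nat_ge_near (R : realType) (c : R) : \forall n \near \oo, c <= n%:R.
Proof.
exists (Num.truncn c).+1 => // n /= cn.
by rewrite (le_trans (ltW (truncnS_gt c)))// ler_nat.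
Qed.

Lemma natSinv_small (R : realType) (e : R) : 0 < e -> \forall n \near \oo, n.+1%:R^-1 <= e.
Proof.
move=> e0; have := near_infty_natSinv_lt (PosNum e0).
by apply: filterS => n /ltW.
Qed.

Lemma nat_ultrafilter : exists U : set_system nat, UltraFilter U /\ \oo `<=` U.
Proof. exact: ultraFilterLemma. Qed.

Lemma ultra_fmap (T U : Type) (f : T -> U) (F : set_system T) :
  UltraFilter F -> UltraFilter (f @ F).
Proof.
move=> FU; split; first exact: fmap_proper_filter.
move=> G GP FG; apply/seteqP; split => // A GA.
have [//|FnA] := in_ultra_setVsetC (f @^-1` A) FU.
have : G (A `&` ~` A) by apply: filterI => //; apply: FG.
by rewrite setICr => /filter_not_empty.
Qed.

Lemma ultra_or (T : Type) (F : set_system T) (A B : set T) :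
  UltraFilter F -> F (A `|` B) -> F A \/ F B.
Proof.
move=> FU FAB; have [|FnA] := in_ultra_setVsetC A FU; first by left.
by right; apply: filterS2 FAB FnA => x [].
Qed.

Lemma ultra_fin (T : Type) (F : set_system T) (n : nat) (A : nat -> set T) :
  UltraFilter F -> F [set t | exists2 i, (i < n)%N & A i t] ->
  exists2 i, (i < n)%N & F (A i).
Proof.
move=> FU; elim: n => [|n IH] FA.
  exfalso; apply: (@filter_not_empty _ F).
  by apply: filterS FA => t [].
have [/IH[i ilt FAi]|FAn] : F [set t | exists2 i, (i < n)%N & A i t] \/ F (A n).
- apply: ultra_or; apply: filterS FA => t [i]; rewrite ltnS leq_eqVlt.
  by move=> /orP[/eqP ->|ilt] Ait; [right|left; exists i].
- by exists i => //; rewrite ltnS ltnW.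
- by exists n.
Qed.

Lemma ultra_ex2 (T : Type) (F : set_system T) (A B : set T) :
  UltraFilter F -> F A -> F B -> exists t, A t /\ B t.
Proof. by move=> FU FA FB; exact: (filter_ex (filterI FA FB)). Qed.

Lemma ultra_ex3 (T : Type) (F : set_system T) (A B C : set T) :
  UltraFilter F -> F A -> F B -> F C -> exists t, [/\ A t, B t & C t].
Proof.
move=> FU FA FB FC; have [t [[]]] := filter_ex (filterI (filterI FA FB) FC).
by exists t.
Qed.

Lemma ultra_real (R : realType) (T : Type) (F : set_system T) (x : T -> R) (M : R) :
  UltraFilter F -> F [set t | `|x t| <= M] ->
  exists l, forall e : R, 0 < e -> F [set t | `|x t - l| <= e].
Proof.
move=> FU FM; have := @segment_compact R (- M) M; rewrite compact_ultra.
move=> /(_ _ (ultra_fmap x FU)) [|l [_ xl]].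
  suff : F (x @^-1` `[- M, M]) by [].
  by apply: filterS FM => t; rewrite /= ler_norml in_itv.
exists l => e e0.
have /xl : nbhs l [set y | `|y - l| <= e].
  apply/nbhs_ballP; exists e => //= y; rewrite -ball_normE /= distrC; exact: ltW.
by [].
Qed.

(** Limits along a fixed ultrafilter take the place of the extraction of
    subsequences: every bounded sequence has one. *)
Definition ulim (R : realType) (T : Type) (F : set_system T) (x : T -> R) : R :=
  xget 0 [set l | forall e : R, 0 < e -> F [set t | `|x t - l| <= e]].

Section ulim.
Variables (R : realType) (T : Type) (F : set_system T) (FU : UltraFilter F).
Implicit Types (x y : T -> R).

Definition ubounded x := exists M, F [set t | `|x t| <= M].

Lemma ulimP x : ubounded x -> forall e : R, 0 < e -> F [set t | `|x t - ulim F x| <= e].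
Proof.
move=> [M xM]; rewrite /ulim; case: xgetP => // /(_ _) nl.
by have [l xl] := ultra_real FU xM; have := nl l.
Qed.

Lemma ulim_le x y : ubounded x -> ubounded y -> F [set t | x t <= y t] ->
  ulim F x <= ulim F y.
Proof.
move=> bx yb xy; apply/ler_addgt0Pl => e e0.
have e2 : 0 < e / 2 by rewrite divr_gt0.
have [t [/= xt yt xyt]] := ultra_ex3 FU (ulimP bx e2) (ulimP yb e2) xy.
by move: xt yt xyt; rewrite /= !ler_norml => /andP[? ?] /andP[? ?] ?; lra.
Qed.

Lemma ulimD x y : ubounded x -> ubounded y ->
  ulim F (fun t => x t + y t) = ulim F x + ulim F y.
Proof.
move=> bx yb; apply/eqP; rewrite -subr_eq0 -normr_le0; apply/ler_addgt0Pl => e e0.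
have xyb : ubounded (fun t => x t + y t).
  move: bx yb => [M xM] [N yN]; exists (M + N); apply: filterS2 xM yN => t /= ? ?.
  by rewrite (le_trans (ler_normD _ _))// lerD.
have e2 : 0 < e / 3 by rewrite divr_gt0.
have [t [/= xt yt xyt]] := ultra_ex3 FU (ulimP bx e2) (ulimP yb e2) (ulimP xyb e2).
rewrite addr0; move: xt yt xyt.
by rewrite /= !ler_norml => /andP[? ?] /andP[? ?] /andP[? ?]; apply/andP; split; lra.
Qed.

Lemma ulim_cst x c : F [set t | x t = c] -> ulim F x = c.
Proof.
move=> xc; have bx : ubounded x.
  by exists `|c|; apply: filterS xc => t /= ->.
apply/eqP; rewrite -subr_eq0 -normr_le0; apply/ler_addgt0Pl => e e0.
have [t [/= + xt]] := ultra_ex2 FU (ulimP bx e0) xc.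
by rewrite xt distrC addr0.
Qed.

End ulim.

(** * Boundedly compact spaces from distance functions *)

(** Total boundedness of [A], at the single scale [e]. *)
Definition has_net (R : realType) (T : Type) (d : T -> T -> R) (A : set T) (e : R) :=
  exists n (x : nat -> T), forall t, A t -> exists2 i, (i < n)%N & d (x i) t <= e.

Section has_net.
Variables (R : realType) (T : Type) (d : T -> T -> R).

Lemma has_net_sub (A B : set T) e f : A `<=` B -> e <= f -> has_net d B e -> has_net d A f.
Proof.
move=> AB ef [n [x xP]]; exists n, x => t /AB/xP[i ilt dle]; exists i => //.
exact: le_trans ef.
Qed.

Lemma has_netU (A B : set T) e : has_net d A e -> has_net d B e -> has_net d (A `|` B) e.
Proof.
move=> [n [x xP]] [m [y yP]]; exists (n + m)%N, (fun i => if (i < n)%N then x i else y (i - n)%N).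
move=> t [/xP|/yP] [i ilt dle].
- by exists i; rewrite ?ilt// ltn_addr.
- by exists (n + i)%N; rewrite ?ltn_add2l// ltnNge leq_addr /= addKn.
Qed.

Lemma has_net0 e : T -> has_net d set0 e.
Proof. by move=> t0; exists 0%N, (fun=> t0). Qed.

Lemma has_net_bigcup n (A : nat -> set T) e : T ->
  (forall i, (i < n)%N -> has_net d (A i) e) ->
  has_net d [set t | exists2 i, (i < n)%N & A i t] e.
Proof.
move=> t0; elim: n => [|n IH] An.
  by apply: (@has_net_sub _ set0) (has_net0 _ t0) => // t [].
have IHn : has_net d [set t | exists2 i, (i < n)%N & A i t] e.
  by apply: IH => i ilt; apply: An; rewrite ltnS ltnW.
apply: has_net_sub (lexx e) (has_netU IHn (An n (ltnSn n))) => t [i].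
by rewrite ltnS leq_eqVlt => /orP[/eqP ->|ilt] Ait; [right|left; exists i].
Qed.

End has_net.

Section rbcm_of_distance.
Variable R : realType.

(** Bounded compactness is stated as the convergence of ultrafilters that
    contain a disc: such limits are easy to construct. *)
Record ultra_metric_data := UltraMetricData {
  umd_sort : Type ;
  umd_dist : umd_sort -> umd_sort -> R ;
  umd_root : umd_sort ;
  umd_xx : forall x, umd_dist x x = 0 ;
  umd_eq0 : forall x y, umd_dist x y = 0 -> x = y ;
  umd_sym : forall x y, umd_dist x y = umd_dist y x ;
  umd_tri : forall y x z, umd_dist x z <= umd_dist x y + umd_dist y z ;
  umd_cvg : forall F r, UltraFilter F -> F [set t | umd_dist umd_root t <= r] ->
     exists x, forall e : R, 0 < e -> F [set t | umd_dist x t <= e] }.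

Variable D : ultra_metric_data.

Definition umd_space := umd_sort D.

HB.instance Definition _ := gen_eqMixin umd_space.
HB.instance Definition _ := gen_choiceMixin umd_space.
HB.instance Definition _ := @isMetric.Build R umd_space _
  (@umd_xx D) (@umd_eq0 D) (@umd_sym D) (@umd_tri D).
HB.instance Definition _ := isPointed.Build umd_space (umd_root D).

Let bc (A : set umd_space) : closed A -> mbounded A -> compact A.
Proof.
move=> cA [p [r Ar]]; rewrite compact_ultra => F FU FA.
have [|x xP] := @umd_cvg D F (mdist (point : umd_space) p + r) FU.
  apply: filterS FA => t /Ar /= pt.
  by rewrite (le_trans (metric_triangle (point : umd_space) p t))// lerD2l.
have Fx : F --> (x : umd_space).
  move=> B /nbhs_ballP[e /= e0 eB]; have e2 : 0 < e / 2 by rewrite divr_gt0.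
  apply: filterS (xP _ e2) => t /= xt; apply: eB; rewrite ballEmdist /=.
  by rewrite (le_lt_trans xt)// ltr_pdivrMr// ltr_pMr// ltr1n.
exists x; split=> //; apply: cA; rewrite closureEcvg.
by exists F; [exact: ultra_proper|split=> // B AB; exact: filterS FA].
Qed.

HB.instance Definition _ := @isBoundedlyCompact.Build R umd_space bc.

End rbcm_of_distance.

Section rbcm_exist.
Variables (R : realType) (T : Type) (d : T -> T -> R) (t0 : T).
Hypotheses (dxx : forall x, d x x = 0) (dsym : forall x y, d x y = d y x)
  (dtri : forall y x z, d x z <= d x y + d y z).

Lemma rbcm_of_ultra_complete : (forall x y, d x y = 0 -> x = y) ->
  (forall F r, UltraFilter F -> F [set t | d t0 t <= r] ->
     exists x, forall e : R, 0 < e -> F [set t | d x t <= e]) ->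
  exists (Z : rbcmType R) (i : T -> Z) (j : Z -> T),
    [/\ i t0 = point, forall s t, mdist (i s) (i t) = d s t & cancel j i].
Proof.
move=> deq0 dcvg.
pose D := UltraMetricData dxx deq0 dsym dtri dcvg.
by exists (umd_space D : rbcmType R), id, id.
Qed.

End rbcm_exist.

Section rbcm_completion.
Variables (R : realType) (T : Type) (d : T -> T -> R) (t0 : T).
Hypotheses (dxx : forall x, d x x = 0) (dsym : forall x y, d x y = d y x)
  (dtri : forall y x z, d x z <= d x y + d y z).
Hypothesis dnet : forall r e : R, 0 < e -> has_net d [set t | d t0 t <= r] e.

Let compl := {phi : T -> R | forall e : R, 0 < e -> exists x, forall y, `|phi y - d x y| <= e}.

Let cdist (phi psi : compl) := sup [set `|sval phi y - sval psi y| | y in [set: T]].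

Let cdist_sup (phi psi : compl) : has_sup [set `|sval phi y - sval psi y| | y in [set: T]].
Proof.
split; first by exists (`|sval phi t0 - sval psi t0|), t0.
have [x xP] := proj2_sig phi _ ltr01; have [x' xP'] := proj2_sig psi _ ltr01.
exists (1 + 1 + d x x') => _ [y _ <-].
have := xP y; have := xP' y; have := dtri x' x y; have := dtri x x' y.
rewrite [d x' x]dsym !ler_norml => ? ? /andP[? ?] /andP[? ?].
by apply/andP; split; lra.
Qed.

Let le_cdist (phi psi : compl) y : `|sval phi y - sval psi y| <= cdist phi psi.
Proof. by apply: (sup_upper_bound (cdist_sup phi psi)); exists y. Qed.

Let cdist_le (phi psi : compl) c : (forall y : T, `|sval phi y - sval psi y| <= c) -> cdist phi psi <= c.
Proof.
move=> le_c; apply: ge_sup; first by have [] := cdist_sup phi psi.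
by move=> _ [y _ <-].
Qed.

Let iota_subproof t e : 0 < e -> exists x, forall y, `|d t y - d x y| <= e.
Proof. by move=> e0; exists t => y; rewrite subrr normr0 ltW. Qed.

Let iota t : compl := exist _ (d t) (iota_subproof t).

Let cdist_iota (phi : compl) t e : (forall y, `|sval phi y - d t y| <= e) -> cdist (iota t) phi <= e.
Proof. by move=> le_e; apply: cdist_le => y /=; rewrite distrC. Qed.

(** Points of the completion are represented by their distance functions, which
    makes both the separation and the completeness immediate. *)
Lemma rbcm_completion : exists (Z : rbcmType R) (i : T -> Z),
    [/\ i t0 = point, forall s t, mdist (i s) (i t) = d s t
      & forall z e, 0 < e -> exists t, mdist (i t) z <= e].
Proof.
have cxx phi : cdist phi phi = 0.
  apply/eqP; rewrite eq_le; apply/andP; split.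
    by apply: cdist_le => y; rewrite subrr normr0.
  by apply: le_trans (le_cdist phi phi t0).
have csym phi psi : cdist phi psi = cdist psi phi.
  by apply/eqP; rewrite eq_le; apply/andP; split; apply: cdist_le => y;
    rewrite distrC le_cdist.
have ctri psi phi chi : cdist phi chi <= cdist phi psi + cdist psi chi.
  by apply: cdist_le => y; rewrite (le_trans (ler_distD (sval psi y) _ _))// lerD ?le_cdist.
have ceq0 phi psi : cdist phi psi = 0 -> phi = psi.
  move=> c0; have : sval phi = sval psi.
    apply/funext => y; apply/eqP.
    by rewrite -subr_eq0 -normr_le0 (le_trans (le_cdist _ _ _))// c0.
  by case: phi psi {c0} => [f fP] [g gP] /= fg; exact: eq_exist.
have ciota s t : cdist (iota s) (iota t) = d s t.
  apply/eqP; rewrite eq_le; apply/andP; split.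
    apply: cdist_le => y /=; have := dtri t s y; have := dtri s t y.
    by rewrite [d t s]dsym ler_norml => ? ?; apply/andP; split; lra.
  by have := le_cdist (iota s) (iota t) t; rewrite /= dxx subr0; apply: le_trans; rewrite ler_norm.
have [F r FU Fr|Z [i [j [i0 id_ ij]]]] := rbcm_of_ultra_complete cxx csym ctri (t0 := iota t0) ceq0.
  have small e : 0 < e -> exists x, F [set phi | cdist (iota x) phi <= e].
    move=> e0; have e2 : 0 < e / 2 by rewrite divr_gt0.
    have [n [x xP]] := dnet (r + e / 2) e2.
    suff : F [set phi | exists2 i, (i < n)%N & cdist (iota (x i)) phi <= e].
      by move=> /(ultra_fin FU)[i _ Fi]; exists (x i).
    apply: filterS Fr => phi /= rphi; have [t tP] := proj2_sig phi _ e2.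
    have tphi := cdist_iota tP.
    have [|i ilt xit] := xP t.
      rewrite /= -ciota; apply: le_trans (ctri phi _ _) _; rewrite (csym phi).
      by rewrite lerD.
    exists i => //; apply: le_trans (ctri (iota t) _ _) _; rewrite ciota.
    by rewrite (splitr e) lerD.
  have sval_bd y : ubounded F (fun phi : compl => sval phi y).
    have [x Fx] := small _ ltr01; exists (1 + `|d x y|).
    apply: filterS Fx => phi /= xphi.
    have := le_cdist (iota x) phi y => /= h.
    have := le_trans h xphi; rewrite distrC => h'.
    by rewrite -(subrK (d x y) (sval phi y)) (le_trans (ler_normD _ _))// lerD.
  pose psi y := ulim F (fun phi : compl => sval phi y).
  have psi_close x e : 0 < e -> F [set phi | cdist (iota x) phi <= e] ->
      forall y, `|psi y - d x y| <= e.
    move=> e0 Fx y; apply/ler_addgt0Pl => e' e'0.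
    have [phi [/= xphi yphi]] := ultra_ex2 FU Fx (ulimP FU (sval_bd y) e'0).
    have := le_trans (le_cdist (iota x) phi y) xphi; rewrite -/(psi y) in yphi *.
    move: yphi; rewrite /= !ler_norml => /andP[? ?] /andP[? ?].
    by apply/andP; split; lra.
  have psiP e : 0 < e -> exists x, forall y, `|psi y - d x y| <= e.
    by move=> e0; have [x Fx] := small _ e0; exists x; exact: psi_close.
  exists (exist _ psi psiP) => e e0; have e2 : 0 < e / 2 by rewrite divr_gt0.
  have [x Fx] := small _ e2; apply: filterS (Fx) => phi /= xphi.
  apply: le_trans (ctri (iota x) _ _) _; rewrite (splitr e) lerD// csym.
  by apply: cdist_iota; exact: psi_close.
exists Z, (i \o iota); split => //= [s t|z e e0]; first by rewrite id_ ciota.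
have [t tP] := proj2_sig (j z) _ e0; exists t.
by rewrite -[z]ij id_ cdist_iota.
Qed.

End rbcm_completion.

Section rbcm_theory.
Variables (R : realType) (Z : rbcmType R).

Lemma closed_mdisc (p : Z) r : closed (mdisc p r).
Proof.
rewrite -[mdisc p r]setCK; apply: open_closedC.
rewrite openE => z /= /negP; rewrite -ltNge => rz.
rewrite /interior /=; apply/nbhs_ballP.
exists (mdist p z - r); first by rewrite /= subr_gt0.
move=> y; rewrite ballEmdist /= => zy; apply/negP; rewrite -ltNge.
by have := metric_triangle p y z; rewrite (metric_sym y z); lra.
Qed.

Lemma compact_mdisc (p : Z) r : compact (mdisc p r).
Proof. by apply: boundedly_compact; [exact: closed_mdisc|exists p, r]. Qed.

Lemma rbcm_ultra_cvg (F : set_system Z) r : UltraFilter F ->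
  F (mdisc point r) -> exists z, forall e : R, 0 < e -> F [set t | mdist z t <= e].
Proof.
move=> FU Fr; have := @compact_mdisc point r; rewrite compact_ultra.
move=> /(_ _ FU Fr)[z [_ Fz]]; exists z => e e0; apply: Fz.
by apply/nbhs_ballP; exists e => //= y; rewrite ballEmdist /=; exact: ltW.
Qed.

(** Discs are compact, hence totally bounded. *)
Lemma rbcm_net r e : 0 < e -> has_net mdist [set z : Z | mdist point z <= r] e.
Proof.
move=> e0; apply: contrapT => nonet.
(* otherwise the complements of the finite unions of balls generate a proper
   filter on the disc, and the limit of an ultrafilter that contains it lies in
   one of these balls *)
pose B := fun (x : Z) => [set z : Z | mdist x z <= e].
have nn (n : nat) (x : nat -> Z) :
    exists z, mdist point z <= r /\ forall i, (i < n)%N -> ~ B (x i) z.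
  apply: contrapT => no; apply: nonet; exists n, x => t rt.
  apply: contrapT => not; apply: no; exists t; split => // i ilt Bt.
  by apply: not; exists i.
pose Fb := [set P : nat * (nat -> Z) | True].
pose S (P : nat * (nat -> Z)) := [set z : Z | mdist point z <= r /\
  forall i, (i < P.1)%N -> ~ B (P.2 i) z].
have FF : ProperFilter (filter_from Fb S).
  apply: filter_from_proper; last first.
    by move=> [n x] _; have [z zP] := nn n x; exists z.
  apply: filter_from_filter; first by exists (0%N, fun=> point).
  move=> [n x] [m y] _ _.
  exists ((n + m)%N, fun i => if (i < n)%N then x i else y (i - n)%N) => //.
  move=> z [rz zP]; split; split => //= i ilt.
    by have := zP i; rewrite /= ltn_addr// ilt => /(_ isT).
  by have := zP (n + i)%N; rewrite /= ltn_add2l ilt ltnNge leq_addr/= addKn => /(_ isT).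
have [G [GU FG]] := ultraFilterLemma FF.
have [|z Gz] := @rbcm_ultra_cvg G r GU.
  by apply: FG; exists (0%N, fun=> point) => // z [].
have Gn : G (S (1%N, fun=> z)) by apply: FG; exists (1%N, fun=> z).
have [t [/= zt [_ /(_ 0%N isT)]]] := ultra_ex2 GU (Gz _ e0) Gn.
by apply.
Qed.

End rbcm_theory.

Lemma rbcm_closed_subspace (R : realType) (Z : rbcmType R) (A : set Z) :
  closed A -> A point ->
  exists (X : rbcmType R) (j : X -> Z), rooted_isometry j /\ range j = A.
Proof.
move=> cA A0; pose T := {z | A z}; pose d (s t : T) := mdist (sval s) (sval t).
have [||||F r FU Fr|X [i [j [i0 id_ ij]]]] :=
  @rbcm_of_ultra_complete R T d (exist _ point A0).
- by move=> x; exact: mdistxx.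
- by move=> x y; exact: metric_sym.
- by move=> y x z; exact: metric_triangle.
- by move=> [x Ax] [y Ay] /mdist_positivity /= xy; exact: eq_exist.
- have [||z Fz] := @rbcm_ultra_cvg R Z (@sval _ _ @ F) r; [exact: ultra_fmap|by []|].
  have Az : A z.
    apply: cA => V /nbhs_ballP[e /= e0 zV].
    have e2 : 0 < e / 2 by rewrite divr_gt0.
    have [t zt] : exists t : T, mdist z (sval t) <= e / 2.
      by apply: (@filter_ex _ F); exact: Fz.
    exists (sval t); split; first exact: svalP.
    apply: zV; rewrite ballEmdist /= (le_lt_trans zt)//.
    by rewrite ltr_pdivrMr// ltr_pMr// ltr1n.
  by exists (exist _ z Az) => e e0; have := Fz _ e0.
exists X, (fun x => sval (j x)); split.
  have mj x y : mdist (sval (j x)) (sval (j y)) = mdist x y by rewrite -{2}(ij x) -{2}(ij y) id_.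
  split=> //; apply: mdist_positivity.
  by rewrite -[X in mdist _ X]/(sval (exist A point A0)) -/(d _ _) -id_ ij i0 mdistxx.
apply/seteqP; split => [_ [x _ <-]|z Az]; first exact: svalP.
exists (i (exist _ z Az)) => //; apply: mdist_positivity.
by rewrite -[X in mdist _ X]/(sval (exist A z Az)) -/(d _ _) -id_ ij mdistxx.
Qed.

(** Gluing of [X] and [Y] along a family of pairs [(x k, y k)], the members of
    the [k]-th pair being put at distance at most [delta k]: the mixed
    distances are [inf_k (d x' (x k) + delta k + d (y k) y')].  The tolerances
    [delta] measure the failure of [x k |-> y k] to be isometric; the pair of
    roots has tolerance 0, so that the roots are identified. *)
Lemma rbcm_glue (R : realType) (X Y : rbcmType R) (I : Type) (x : I -> X) (y : I -> Y)
    (delta : I -> R) (k0 : I) :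
  (forall k, 0 <= delta k) -> x k0 = point -> y k0 = point -> delta k0 = 0 ->
  (forall k l, `|mdist (x k) (x l) - mdist (y k) (y l)| <= delta k + delta l) ->
  exists (Z : rbcmType R) (f : X -> Z) (g : Y -> Z),
    [/\ rooted_isometry f, rooted_isometry g & forall k, mdist (f (x k)) (g (y k)) <= delta k].
Proof.
move=> delta0 xk0 yk0 dk0 xy.
pose mix (u : X) (v : Y) k := mdist u (x k) + delta k + mdist (y k) v.
pose D u v := inf [set mix u v k | k in [set: I]].
have mix0 u v k : 0 <= mix u v k by rewrite /mix !addr_ge0 ?mdist_ge0.
have hinf u v : has_inf [set mix u v k | k in [set: I]].
  by split; [exists (mix u v k0), k0|exists 0 => _ [k _ <-]].
have Dle u v k : D u v <= mix u v k.
  by apply: ge_inf; [have [] := hinf u v|exists k].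
have le_D u v c : (forall k, c <= mix u v k) -> c <= D u v.
  by move=> cP; apply: lb_le_inf; [have [] := hinf u v|move=> _ [k _ <-]].
have D0 u v : 0 <= D u v by apply: le_D.
have le_DD u v u' v' c : (forall k l, c <= mix u v k + mix u' v' l) -> c <= D u v + D u' v'.
  move=> cP; rewrite -lerBlDr; apply: (le_D) => k; rewrite lerBlDr addrC -lerBlDr.
  by apply: le_D => l; rewrite lerBlDr addrC.
have DX u u' v : D u v <= mdist u u' + D u' v.
  rewrite -lerBlDl; apply: le_D => k; rewrite lerBlDl; apply: le_trans (Dle _ _ k) _.
  by rewrite /mix !addrA !lerD// metric_triangle.
have DY u v v' : D u v <= D u v' + mdist v' v.
  rewrite -lerBlDr; apply: le_D => k; rewrite lerBlDr; apply: le_trans (Dle _ _ k) _.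
  by rewrite /mix -!addrA !lerD// metric_triangle.
have DDX u u' v : mdist u u' <= D u v + D u' v.
  apply: le_DD => k l; have := xy k l; rewrite /mix ler_norml => /andP[h1 h2].
  have := metric_triangle u (x k) u'; have := metric_triangle (x k) (x l) u'.
  have := metric_triangle (y k) v (y l).
  rewrite (metric_sym u' (x l)) (metric_sym v (y l)); lra.
have DDY u v v' : mdist v v' <= D u v + D u v'.
  apply: le_DD => k l; have := xy k l; rewrite /mix ler_norml => /andP[h1 h2].
  have := metric_triangle v (y k) v'; have := metric_triangle (y k) (y l) v'.
  have := metric_triangle (x k) u (x l).
  rewrite (metric_sym v (y k)) (metric_sym (x k) u); lra.
pose d (s t : X + Y) := match s, t with
  | inl u, inl u' => mdist u u' | inl u, inr v => D u v
  | inr v, inl u => D u v | inr v, inr v' => mdist v v' end.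
have dxx s : d s s = 0 by case: s => s /=; exact: mdistxx.
have dsym s t : d s t = d t s by case: s t => [s|s] [t|t] //=; exact: metric_sym.
have dtri t s r : d s r <= d s t + d t r.
  case: s t r => [s|s] [t|t] [r|r] /=; rewrite ?metric_triangle ?DX ?DY ?DDX ?DDY//.
  - by rewrite addrC (metric_sym t r) DX.
  - by rewrite addrC (metric_sym s t) DY.
have D00 : D point point = 0.
  apply/eqP; rewrite eq_le D0 andbT (le_trans (Dle _ _ k0))//.
  by rewrite /mix xk0 yk0 dk0 !mdistxx !addr0.
have netX r e : 0 < e -> has_net d [set inl u | u in [set u : X | mdist point u <= r]] e.
  move=> e0; have [n [w wP]] := @rbcm_net R X r e e0; exists n, (inl \o w).
  by move=> _ [u ru <-]; have [i] := wP _ ru; exists i.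
have netY r e : 0 < e -> has_net d [set inr u | u in [set u : Y | mdist point u <= r]] e.
  move=> e0; have [n [w wP]] := @rbcm_net R Y r e e0; exists n, (inr \o w).
  by move=> _ [u ru <-]; have [i] := wP _ ru; exists i.
have [|Z [i [i0 id_ _]]] := @rbcm_completion R (X + Y)%type d (inl point) dxx dsym dtri.
  move=> r e e0; apply: (has_net_sub _ (lexx e) (has_netU (netX r e e0) (netY r e e0))).
  move=> [u|v] /= h; [left; exists u|right; exists v] => //=.
  by apply: le_trans h; have := DDY point point v; rewrite D00 add0r.
exists Z, (i \o inl), (i \o inr); split.
- by split=> [|u u']; rewrite /= ?i0 ?id_.
- split=> [|u u']; rewrite /= ?id_//; apply: mdist_positivity.
  by rewrite -i0 id_ /= D00.
- move=> k; rewrite /= id_ /= (le_trans (Dle _ _ k))//.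
  by rewrite /mix !mdistxx add0r addr0.
Qed.

(** Gluing along [Y] with all tolerances equal to 0. *)
Lemma rbcm_amalgam (R : realType) (Y Z1 Z2 : rbcmType R) (j1 : Y -> Z1) (j2 : Y -> Z2) :
  rooted_isometry j1 -> rooted_isometry j2 ->
  exists (Z : rbcmType R) (f : Z1 -> Z) (g : Z2 -> Z),
    [/\ rooted_isometry f, rooted_isometry g & forall y, f (j1 y) = g (j2 y)].
Proof.
move=> [j10 j1d] [j20 j2d].
have [||k l|Z [f [g [fi gi fg]]]] := @rbcm_glue R Z1 Z2 Y j1 j2 (fun=> 0) point _ j10 j20 _.
- by [].
- by [].
- by rewrite j1d j2d subrr normr0 addr0.
exists Z, f, g; split => // y; apply: mdist_positivity; apply/eqP.
by rewrite eq_le fg mdist_ge0.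
Qed.

(** * Exponential averages over the radius *)

Section exp_average.
Variable R : realType.
Implicit Types (m : R -> R) (delta : R -> \bar R) (a r s e : R).

Local Notation leb := (@lebesgue_measure R).
Local Notation pos := (`[0%R, +oo[%classic : set R).

Definition right_cont m := forall r e, 0 <= r -> 0 < e ->
  exists2 h, 0 < h & forall s, r <= s -> s <= r + h -> `|m s - m r| <= e.

(** A right-continuous function is the limit of the step functions that take
    on [[k/n, (k+1)/n)] the value at the right end point. *)
Lemma right_cont_measurable m : right_cont m -> measurable_fun pos m.
Proof.
move=> mc.
pose h n r : R := (Num.truncn (r * n.+1%:R)).+1%:R / n.+1%:R.
have n0 n : 0 < n.+1%:R :> R by rewrite ltr0n.
apply: (@measurable_fun_cvg _ _ _ pos (fun n => m \o h n)).
  move=> n _ Y mY.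
  rewrite (_ : _ `&` _ = \bigcup_(k in [set k | Y (m (k.+1%:R / n.+1%:R))])
      [set` `[k%:R / n.+1%:R, k.+1%:R / n.+1%:R[%R]).
    by apply: bigcup_measurable => k _; exact: measurable_itv.
  apply/seteqP; split => r.
    rewrite /= in_itv /= andbT => -[r0 Yr].
    exists (Num.truncn (r * n.+1%:R)) => //=.
    by rewrite in_itv /= ler_pdivrMr// ltr_pdivlMr// truncn_itv// mulr_ge0// ltW.
  move=> [k /= Yk]; rewrite in_itv /= ler_pdivrMr// ltr_pdivlMr// => kr.
  have r0 : 0 <= r.
    by rewrite -(pmulr_lge0 _ (n0 n)); move: kr => /andP[+ _]; apply: le_trans.
  by rewrite in_itv /= andbT r0; split => //; rewrite /h (truncn_def kr).
move=> r; rewrite /= in_itv /= andbT => r0; apply/cvgrPdist_le => e e0.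
have [d d0 dP] := mc r e r0 e0.
have := near_infty_natSinv_lt (PosNum d0); apply: filterS => n /= nd.
have rn : 0 <= r * n.+1%:R by rewrite mulr_ge0// ltW.
have /andP[lo hi] := truncn_itv rn.
rewrite distrC; apply: dP; first by rewrite /h ler_pdivlMr// ltW.
rewrite /h ler_pdivrMr// mulrDl -natr1 lerD//.
by move: nd => /= /ltW; rewrite -[X in X <= _]mul1r ler_pdivrMr.
Qed.

Definition capped delta r : R := fine (mine 1%E (delta r)).

Section capped.
Variable delta : R -> \bar R.
Hypothesis delta0 : forall r, (0 <= delta r)%E.

Lemma cappedE r : (capped delta r)%:E = mine 1%E (delta r).
Proof.
rewrite fineK// ge0_fin_numE; last by rewrite le_min lee01 delta0.
by rewrite gt_min ltry.
Qed.

Lemma capped_ge0 r : 0 <= capped delta r.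
Proof. by rewrite -lee_fin cappedE le_min lee01 delta0. Qed.

Lemma capped_le1 r : capped delta r <= 1.
Proof. by rewrite -lee_fin cappedE ge_min lexx. Qed.

Lemma capped_le r e : (delta r <= e%:E)%E -> capped delta r <= e.
Proof. by move=> de; rewrite -lee_fin cappedE ge_min de orbT. Qed.

Lemma capped_lt r e : e <= 1 -> capped delta r < e -> (delta r < e%:E)%E.
Proof.
move=> e1; rewrite -lte_fin cappedE gt_min => /orP[|//].
by rewrite lte_fin ltNge e1.
Qed.

Lemma capped_close r s e : 0 <= e -> (delta r <= delta s + e%:E)%E -> capped delta r <= capped delta s + e.
Proof.
move=> e0 rs; rewrite -lee_fin EFinD !cappedE ge_min.
have [ds|ds] := leP (delta s) 1%E; first by rewrite rs orbT.
by rewrite leeDl// lee_fin.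
Qed.

Lemma exp_averageE : exp_average delta = (\int[leb]_(r in pos) (expR (- r) * capped delta r)%:E)%E.
Proof. by apply: eq_integral => r _; rewrite EFinM cappedE. Qed.

Lemma exp_average_ge0 : (0 <= exp_average delta)%E.
Proof.
rewrite exp_averageE; apply: integral_ge0 => r _.
by rewrite lee_fin mulr_ge0 ?expR_ge0 ?capped_ge0.
Qed.

End capped.

Lemma measurable_expN (D : set R) : measurable_fun D (fun r : R => expR (- r)).
Proof.
apply: measurable_funTS; apply: continuous_measurable_fun => r.
by apply: continuous_comp; [exact: opp_continuous|exact: continuous_expR].
Qed.

Lemma measurable_exp_trunc delta : measurable_fun pos (capped delta) ->
  measurable_fun pos (fun r => (expR (- r) * capped delta r)%:E).
Proof. by move=> md; apply/measurable_EFinP/measurable_funM => //; exact: measurable_expN. Qed.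

Lemma integral_expN : (\int[leb]_(r in pos) (expR (- r))%:E = 1)%E.
Proof.
rewrite -(@integral_exponential_pdf R 1 ltr01) integral_mkcond.
apply: eq_integral => r _; rewrite /exponential_pdf /patch.
by case: ifP => // _; rewrite mul1r mulN1r.
Qed.

Lemma integrable_expN : leb.-integrable pos (fun r => (expR (- r))%:E).
Proof.
apply/integrableP; split; first by apply/measurable_EFinP; exact: measurable_expN.
under eq_integral do rewrite /= ger0_norm ?expR_ge0//.
by rewrite integral_expN ltry.
Qed.

Lemma exp_average_le1 delta : (forall r, (0 <= delta r)%E) ->
  measurable_fun pos (capped delta) -> (exp_average delta <= 1)%E.
Proof.
move=> d0 md; rewrite exp_averageE// -integral_expN; apply: ge0_le_integral => //.
- by move=> r _; rewrite lee_fin mulr_ge0 ?expR_ge0 ?capped_ge0.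
- exact: measurable_exp_trunc.
- by apply/measurable_EFinP; exact: measurable_expN.
- by move=> r _; rewrite lee_fin ler_piMr ?expR_ge0 ?capped_le1.
Qed.

Lemma exp_average_le_add d1 d2 d3 :
  (forall r, (0 <= d1 r)%E) -> (forall r, (0 <= d2 r)%E) -> (forall r, (0 <= d3 r)%E) ->
  measurable_fun pos (capped d1) -> measurable_fun pos (capped d2) ->
  measurable_fun pos (capped d3) ->
  (forall r, (d1 r <= d2 r + d3 r)%E) ->
  (exp_average d1 <= exp_average d2 + exp_average d3)%E.
Proof.
move=> d10 d20 d30 m1 m2 m3 d123; rewrite !exp_averageE// -ge0_integralD//=; last 4 first.
- by move=> r _; rewrite lee_fin mulr_ge0 ?expR_ge0 ?capped_ge0.
- exact: measurable_exp_trunc.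
- by move=> r _; rewrite lee_fin mulr_ge0 ?expR_ge0 ?capped_ge0.
- exact: measurable_exp_trunc.
apply: ge0_le_integral => //.
- by move=> r _; rewrite lee_fin mulr_ge0 ?expR_ge0 ?capped_ge0.
- exact: measurable_exp_trunc.
- by apply: emeasurable_funD; exact: measurable_exp_trunc.
move=> r _; rewrite -EFinD -mulrDr lee_fin ler_wpM2l ?expR_ge0//.
rewrite -lee_fin EFinD !cappedE// ge_min.
have [h2|h2] := leP (d2 r) 1%E; last by rewrite leeDl// le_min lee01 d30.
have [h3|h3] := leP (d3 r) 1%E; last by rewrite leeDr//.
by rewrite d123 orbT.
Qed.

(** Otherwise the sum of the integrands is at least [e] on the whole interval
    [[a, a + 1]], where the weight is at least [expR (- (a + 1))]. *)
Lemma exp_average_small_radius d1 d2 a e : 0 <= a -> 0 < e <= 1 ->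
  (forall r, (0 <= d1 r)%E) -> (forall r, (0 <= d2 r)%E) ->
  measurable_fun pos (capped d1) -> measurable_fun pos (capped d2) ->
  (exp_average d1 < (e * expR (- (a + 1)) / 2)%:E)%E ->
  (exp_average d2 < (e * expR (- (a + 1)) / 2)%:E)%E ->
  exists r, [/\ a <= r <= a + 1, (d1 r < e%:E)%E & (d2 r < e%:E)%E].
Proof.
move=> a0 /andP[e0 e1] d10 d20 m1 m2 s1 s2; apply: contrapT => no.
have big r : a <= r <= a + 1 -> e <= capped d1 r + capped d2 r.
  move=> ar; rewrite leNgt; apply/negP => small; apply: no; exists r; split => //.
    by apply: capped_lt => //; apply: le_lt_trans small; rewrite lerDl capped_ge0.
  by apply: capped_lt => //; apply: le_lt_trans small; rewrite lerDr capped_ge0.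
have : (exp_average d1 + exp_average d2 < (e * expR (- (a + 1)))%:E)%E.
  by rewrite (splitr (e * _)) EFinD lteD.
apply/negP; rewrite -leNgt !exp_averageE// -ge0_integralD//=; last 4 first.
- by move=> r _; rewrite lee_fin mulr_ge0 ?expR_ge0 ?capped_ge0.
- exact: measurable_exp_trunc.
- by move=> r _; rewrite lee_fin mulr_ge0 ?expR_ge0 ?capped_ge0.
- exact: measurable_exp_trunc.
have sub : `[a, a + 1]%classic `<=` pos.
  by move=> r; rewrite /= !in_itv /= andbT => /andP[+ _]; exact: le_trans.
have msum : measurable_fun pos (fun r => ((expR (- r) * capped d1 r)%:E + (expR (- r) * capped d2 r)%:E)%E).
  by apply: emeasurable_funD; exact: measurable_exp_trunc.
have sum0 r : pos r -> (0 <= (expR (- r) * capped d1 r)%:E + (expR (- r) * capped d2 r)%:E)%E.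
  by move=> _; rewrite adde_ge0// lee_fin mulr_ge0 ?expR_ge0 ?capped_ge0.
have := ge0_subset_integral leb (measurable_itv `[a, a + 1]) (measurable_itv _) msum sum0 sub.
apply: le_trans.
have -> : ((e * expR (- (a + 1)))%:E = \int[leb]_(r in `[a, (a + 1)%R]) (e * expR (- (a + 1)))%:E)%E.
  rewrite integral_cst//= lebesgue_measure_itv /= lte_fin ltrDl ltr01.
  by rewrite -EFinD addrAC subrr add0r mule1.
apply: ge0_le_integral => //.
- by move=> r _; rewrite lee_fin mulr_ge0 ?expR_ge0// ltW.
- exact: measurable_funS msum.
move=> r; rewrite /= in_itv /= => ar; rewrite -EFinD -mulrDr lee_fin mulrC.
by rewrite ler_pM ?expR_ge0 ?(ltW e0)// ?ler_expR ?lerN2 ?big//; case/andP: ar.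
Qed.

(** Dominated convergence; countable sets of radii are negligible. *)
Lemma exp_average_cvg0 (delta : nat -> R -> \bar R) (B : set R) : countable B ->
  (forall n r, (0 <= delta n r)%E) -> (forall n, measurable_fun pos (capped (delta n))) ->
  (forall r, 0 <= r -> ~ B r -> forall e, 0 < e ->
     \forall n \near \oo, (delta n r <= e%:E)%E) ->
  forall e, 0 < e -> \forall n \near \oo, (exp_average (delta n) < e%:E)%E.
Proof.
move=> cB d0 md dcvg e e0.
have [||||||_ _] := @dominated_convergence _ _ R leb pos _
  (fun n r => (expR (- r) * capped (delta n) r)%:E) (cst 0%E) (fun r => (expR (- r))%:E).
- exact: measurable_itv.
- by move=> n; exact: measurable_exp_trunc.
- exact: measurable_cst.
- exists B; split => //.
  + exact: countable_measurable.
  + exact: countable_lebesgue_measure0.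
  move=> r /= nr; apply: contrapT => nB; apply: nr; rewrite in_itv /= andbT => r0.
  apply/(@fine_cvgP _ _ _ _ _ 0); split; first exact: nearW.
  apply/cvgrPdist_le => e' e'0.
  have := dcvg r r0 nB _ e'0; apply: filterS => n /= /(capped_le (d0 n)) de.
  rewrite sub0r normrN ger0_norm ?mulr_ge0 ?expR_ge0 ?capped_ge0//.
  apply: le_trans de; rewrite ler_piMl ?capped_ge0// -expR0 ler_expR.
  by rewrite oppr_le0.
- exact: integrable_expN.
- apply/aeW => r n _; rewrite /= lee_fin ger0_norm ?mulr_ge0 ?expR_ge0 ?capped_ge0//.
  by rewrite ler_piMr ?expR_ge0 ?capped_le1.
rewrite integral0 => cvg0.
have : nbhs (0 : \bar R)%E [set x | (x < e%:E)%E].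
  by apply: open_nbhs_nbhs; split; [exact: open_ereal_lt_ereal|rewrite /= lte_fin].
move=> /cvg0 small; near=> n; rewrite exp_averageE//; near: n; exact: small.
Unshelve. all: by end_near.
Qed.

End exp_average.

(** * The localized Hausdorff distance *)

Lemma le_ereal_inf_add (R : realType) (x : \bar R) (A B : set (\bar R)) :
  (forall a, A a -> 0 <= a)%E -> (forall b, B b -> 0 <= b)%E ->
  (forall a b, A a -> B b -> x <= a + b)%E ->
  (x <= ereal_inf A + ereal_inf B)%E.
Proof.
move=> A0 B0 xAB.
have iA : (0 <= ereal_inf A)%E by apply: le_ereal_inf_tmp.
have iB : (0 <= ereal_inf B)%E by apply: le_ereal_inf_tmp.
have [Afin|] := boolP (ereal_inf A \is a fin_num); last first.
  rewrite ge0_fin_numE// -leNgt leye_eq => /eqP ->.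
  by rewrite addye ?leey// gt_eqF// (lt_le_trans _ iB)// ltNyr.
have [Bfin|] := boolP (ereal_inf B \is a fin_num); last first.
  rewrite ge0_fin_numE// -leNgt leye_eq => /eqP ->.
  by rewrite addey ?leey// gt_eqF// (lt_le_trans _ iA)// ltNyr.
apply/lee_addgt0Pr => e e0; have e2 : 0 < e / 2 by rewrite divr_gt0.
have [a Aa aA] := lb_ereal_inf_adherent e2 Afin.
have [b Bb bB] := lb_ereal_inf_adherent e2 Bfin.
apply: le_trans (xAB _ _ Aa Bb) _; apply: le_trans (leeD (ltW aA) (ltW bB)) _.
by rewrite addeACA -EFinD -splitr.
Qed.

Section hausdorff.
Variables (R : realType) (Z : metricType R).
Implicit Types (A B C : set Z) (e : R).

Lemma hausdorff_ge0 A B : (0 <= hausdorff_dist A B)%E.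
Proof. by apply: le_ereal_inf_tmp => _ [e [e0 _ _] <-]; rewrite lee_fin ltW. Qed.

Lemma hausdorff_sym A B : hausdorff_dist A B = hausdorff_dist B A.
Proof.
rewrite /hausdorff_dist; congr ereal_inf.
by apply/seteqP; split => _ [e [? ? ?] <-]; exists e.
Qed.

Lemma hausdorff_le A B e : 0 < e -> A `<=` mneighborhood B e ->
  B `<=` mneighborhood A e -> (hausdorff_dist A B <= e%:E)%E.
Proof. by move=> e0 AB BA; apply: ereal_inf_lbound; exists e. Qed.

Lemma hausdorff_lt A B e : (hausdorff_dist A B < e%:E)%E ->
  A `<=` mneighborhood B e /\ B `<=` mneighborhood A e.
Proof.
move=> /ereal_inf_lt[_ [d [d0 AB BA] <-]]; rewrite lte_fin => de.
split => z; [move=> /AB|move=> /BA]; move=> [w ? zw]; exists w => //;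
  exact: le_trans zw (ltW de).
Qed.

Lemma hausdorffxx A : hausdorff_dist A A = 0%E.
Proof.
apply/eqP; rewrite eq_le hausdorff_ge0 andbT; apply/lee_addgt0Pr => e e0.
rewrite add0e; apply: hausdorff_le => // z Az; exists z => //;
  by rewrite mdistxx ltW.
Qed.

Lemma hausdorff_triangle A B C :
  (hausdorff_dist A C <= hausdorff_dist A B + hausdorff_dist B C)%E.
Proof.
apply: le_ereal_inf_add => [_ [e [e0 _ _] <-]|_ [e [e0 _ _] <-]|].
- by rewrite lee_fin ltW.
- by rewrite lee_fin ltW.
move=> _ _ [d [d0 AB BA] <-] [e [e0 BC CB] <-]; rewrite -EFinD.
apply: hausdorff_le; first exact: addr_gt0.
  move=> a /AB[b /BC[c Cc bc] ab]; exists c => //.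
  by apply: le_trans (metric_triangle a b c) _; rewrite lerD.
move=> c /CB[b /BA[a Aa ba] cb]; exists a => //.
by apply: le_trans (metric_triangle c b a) _; rewrite addrC lerD.
Qed.

End hausdorff.

Section discs.
Variables (R : realType) (X : rbcmType R).
Implicit Types (x : X) (r e h : R).

(** By compactness: a limit of points of discs of radii decreasing to [r] lies in
    the disc of radius [r]. *)
Lemma disc_right_cont r e : 0 < e -> exists2 h, 0 < h &
  forall x, mdist point x <= r + h -> exists2 x', mdist point x' <= r & mdist x x' <= e.
Proof.
move=> e0; have [U [UU ooU]] := nat_ultrafilter.
apply: contrapT => no.
have bad (n : nat) : exists x, mdist point x <= r + n.+1%:R^-1 /\
    forall x', mdist point x' <= r -> ~ mdist x x' <= e.
  apply: contrapT => nobad; apply: no; exists n.+1%:R^-1; first by rewrite invr_gt0.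
  move=> x rx; apply: contrapT => nox; apply: nobad; exists x; split => // x' rx' xx'.
  by apply: nox; exists x'.
have [u uP] := choice bad.
have [||z Uz] := @rbcm_ultra_cvg R X (u @ U) (r + 1); first exact: ultra_fmap.
  suff : U [set n | mdist point (u n) <= r + 1] by [].
  apply: filter_all => n /=.
  have [+ _] := uP n; move=> /le_trans; apply.
  by rewrite lerD2l invf_le1// ler1n.
have Uz' e' : 0 < e' -> U [set n | mdist z (u n) <= e'] by move=> /Uz.
have rz : mdist point z <= r.
  apply/ler_addgt0Pl => d d0; have d2 : 0 < d / 2 by rewrite divr_gt0.
  have [n [/= zn /= nd]] := ultra_ex2 UU (Uz' _ d2) (ooU _ (natSinv_small d2)).
  have [rn _] := uP n.
  have := metric_triangle point (u n) z; rewrite (metric_sym (u n)); move: zn nd rn.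
  by move: (n.+1%:R^-1) => i; lra.
have [n /= zn] := filter_ex (Uz' _ e0).
by have [_ /(_ _ rz)] := uP n; apply; rewrite metric_sym.
Qed.

Lemma avoid_finite (n : nat) (m : nat -> R) r : (forall i, (i < n)%N -> m i != r) ->
  exists2 h, 0 < h & forall i, (i < n)%N -> m i <= r + h -> m i < r - h.
Proof.
elim: n => [|n IH] mr; first by exists 1.
have [|h h0 hP] := IH; first by move=> i ilt; apply: mr; rewrite ltnS ltnW.
have d0 : 0 < `|m n - r| / 2 by rewrite divr_gt0// normr_gt0 subr_eq0 mr.
exists (Num.min h (`|m n - r| / 2)); first by rewrite lt_min h0.
move=> i; rewrite ltnS leq_eqVlt => /orP[/eqP -> mn|ilt mi].
  have h1 : Num.min h (`|m n - r| / 2) <= `|m n - r| / 2 by rewrite ge_min lexx orbT.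
  by move: (Num.min _ _) d0 h1 mn => k; case: (lerP (m n) r) => mnr; lra.
have h1 : Num.min h (`|m n - r| / 2) <= h by rewrite ge_min lexx.
by have := hP i ilt; lra.
Qed.

(** When balls of radius [e] centred at [x 0, ..., x (n - 1)] cover a disc, the
    discontinuities of size more than [2 e] occur among the distances of these balls from
    the root. *)
Lemma disc_left_cont : exists2 B : set R, countable B & forall r e, 0 <= r -> ~ B r -> 0 < e ->
  exists2 h, 0 < h & forall x, mdist point x <= r + h ->
    exists2 x', mdist point x' <= r - h & mdist x x' <= e.
Proof.
have net (kN : nat * nat) : exists nx : nat * (nat -> X), forall x,
    mdist point x <= kN.2%:R -> exists2 i, (i < nx.1)%N & mdist (nx.2 i) x <= kN.1.+1%:R^-1.
  have [|n [x xP]] := @rbcm_net R X kN.2%:R kN.1.+1%:R^-1; first by rewrite invr_gt0.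
  by exists (n, x).
have [nx nxP] := choice net.
pose H kN i := [set mdist point x | x in [set x | mdist ((nx kN).2 i) x <= kN.1.+1%:R^-1]].
pose m kNi := inf (H kNi.1 kNi.2).
exists (range m).
  exact: sub_countable (card_image_le _ _) (countableP _).
move=> r e r0 Br e0.
have e2 : 0 < e / 2 by rewrite divr_gt0.
have /filter_ex[k /= ke] := natSinv_small e2.
pose N := (Num.truncn (r + 1)).+1; have rN : r + 1 < N%:R by exact: truncnS_gt.
have [i _|h h0 hP] := @avoid_finite (nx (k, N)).1 (fun i => m ((k, N), i)) r.
  by apply/eqP => mr; apply: Br; exists ((k, N), i).
exists (Num.min h 1); first by rewrite lt_min h0 ltr01.
have h1 : Num.min h 1 <= h by rewrite ge_min lexx.
have h2 : Num.min h 1 <= 1 by rewrite ge_min lexx orbT.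
move=> x xr; have [|i ilt ix] := nxP (k, N) x; first by move: rN; rewrite /=; lra.
have hlb : has_inf (H (k, N) i).
  split; first by exists (mdist point x), x.
  by exists 0 => _ [y _ <-]; exact: mdist_ge0.
have mx : m ((k, N), i) <= mdist point x by apply: ge_inf; [have [] := hlb|exists x].
have [|_ [y /= iy <-] yr] := @inf_adherent _ (H (k, N) i) (r - h - m ((k, N), i)) _ hlb.
  by rewrite subr_gt0 hP//; lra.
exists y.
  by move: yr; rewrite /m /= addrC subrK => /ltW/le_trans; apply; rewrite lerD2l lerN2.
have := metric_triangle x ((nx (k, N)).2 i) y; rewrite (metric_sym x (_.2 i)).
by move: ix iy ke => /=; move: (k.+1%:R^-1) => d; lra.
Qed.

End discs.

Section rooted_hausdorff.
Variables (R : realType) (X Z : rbcmType R) (f : X -> Z).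
Hypothesis fi : rooted_isometry f.

Lemma rooted_isometry_height (x : X) : mdist point (f x) = mdist point x.
Proof. by have [f0 fd] := fi; rewrite -f0 fd. Qed.

Lemma hausdorff_range_disc r s e : 0 < e -> r <= s ->
  (forall x : X, mdist point x <= s -> exists2 x', mdist point x' <= r & mdist x x' <= e) ->
  (hausdorff_dist (range f `&` root_disc Z s) (range f `&` root_disc Z r) <= e%:E)%E.
Proof.
move=> e0 rs sr; have [f0 fd] := fi; apply: hausdorff_le => // z [[x _ <-]].
  rewrite /root_disc /mdisc /= rooted_isometry_height => /sr[x' rx' xx'].
  by exists (f x'); [split; [exists x'|rewrite /= rooted_isometry_height]|rewrite fd].
rewrite /root_disc /mdisc /= rooted_isometry_height => rx; exists (f x); last by rewrite mdistxx ltW.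
by split; [exists x|rewrite /= rooted_isometry_height (le_trans rx)].
Qed.

End rooted_hausdorff.

Section rooted_hausdorff_measurable.
Variables (R : realType) (X Y Z : rbcmType R) (f : X -> Z) (g : Y -> Z).
Hypotheses (fi : rooted_isometry f) (gi : rooted_isometry g).

Let delta r := hausdorff_dist (range f `&` root_disc Z r) (range g `&` root_disc Z r).

(** The discs vary right-continuously with their radius, hence so does their
    Hausdorff distance. *)
Lemma measurable_hausdorff_discs : measurable_fun (`[0%R, +oo[%classic : set R) (capped delta).
Proof.
have d0 r : (0 <= delta r)%E by exact: hausdorff_ge0.
apply: right_cont_measurable => r e r0 e0; have e2 : 0 < e / 2 by rewrite divr_gt0.
have [h h0 hP] := @disc_right_cont R X r _ e2.
have [k k0 kP] := @disc_right_cont R Y r _ e2.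
exists (Num.min h k) => [|s rs]; rewrite ?lt_min ?h0// -lerBlDl le_min => /andP[sh sk].
have fs : (hausdorff_dist (range f `&` root_disc Z s) (range f `&` root_disc Z r) <= (e / 2)%:E)%E.
  by apply: hausdorff_range_disc => // x xs; apply: hP; apply: le_trans xs _; rewrite -lerBlDl.
have gs : (hausdorff_dist (range g `&` root_disc Z s) (range g `&` root_disc Z r) <= (e / 2)%:E)%E.
  by apply: hausdorff_range_disc => // x xs; apply: kP; apply: le_trans xs _; rewrite -lerBlDl.
have quad (A B A' B' : set Z) : (hausdorff_dist A A' <= (e / 2)%:E)%E ->
    (hausdorff_dist B B' <= (e / 2)%:E)%E ->
    (hausdorff_dist A B <= hausdorff_dist A' B' + e%:E)%E.
  move=> AA' BB'; apply: le_trans (hausdorff_triangle _ A' _) _.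
  apply: le_trans (leeD AA' (hausdorff_triangle _ B' _)) _.
  by rewrite addeCA [in leRHS](splitr e) EFinD hausdorff_sym leeD// leeD// hausdorff_sym.
have sr := @capped_close R delta d0 s r e (ltW e0) (quad _ _ _ _ fs gs).
rewrite hausdorff_sym in fs; rewrite hausdorff_sym in gs.
have rs' := @capped_close R delta d0 r s e (ltW e0) (quad _ _ _ _ fs gs).
by rewrite ler_norml; apply/andP; split; [rewrite lerBrDl lerBlDr|rewrite lerBlDl].
Qed.

End rooted_hausdorff_measurable.

(** * Integration over discs *)

Section borel.
Variables (R : realType) (Z : rbcmType R).

Lemma borel_open (A : set Z) : open A -> measurable (A : set (borel Z)).
Proof. exact: sub_gen_smallest. Qed.

Lemma borel_closed (A : set Z) : closed A -> measurable (A : set (borel Z)).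
Proof.
by move=> cA; rewrite -[A]setCK; apply: measurableC; apply: borel_open; exact: closed_openC.
Qed.

Lemma borel_continuous (f : Z -> R) : continuous f ->
  measurable_fun [set: borel Z] (f : borel Z -> R).
Proof.
move=> fc; apply: (measurability (@RGenOInfty.G R)).
  exact: RGenOInfty.measurableE.
move=> _ [_ [x ->] <-]; rewrite setTI.
apply: borel_open; apply: open_comp => [z _|]; [exact: fc|].
rewrite (_ : [set` _] = [set y | x < y]); first exact: open_gt.
by apply/seteqP; split => y; rewrite /= in_itv /= andbT.
Qed.

Lemma mdist_continuous (p : Z) : continuous (mdist p).
Proof.
move=> z; apply/cvgrPdist_le => e e0; apply/nbhs_ballP; exists e => //= y.
rewrite ballEmdist /= => zy; have := metric_triangle p y z; have := metric_triangle p z y.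
by rewrite (metric_sym y z) ler_norml => ? ?; apply/andP; split; lra.
Qed.

End borel.

Lemma isometry_measurable (R : realType) (X Z : rbcmType R) (f : X -> Z) :
  rooted_isometry f -> measurable_fun [set: borel X] (f : borel X -> borel Z).
Proof.
move=> [_ fd]; apply: (@measurability _ _ (borel X) (borel Z) setT f (@open Z)) => //.
move=> _ [A oA <-]; rewrite setTI; apply: borel_open; apply: open_comp => // x _ B.
move=> /nbhs_ballP[e /= e0 eB]; apply/nbhs_ballP; exists e => //= y.
by rewrite ballEmdist /= => xy; apply: eB; rewrite ballEmdist /= fd.
Qed.

Definition locally_finite (R : realType) (Z : rbcmType R) (mu : set (borel Z) -> \bar R) :=
  forall r, (mu (root_disc Z r) < +oo)%E.

Definition disc_mass (R : realType) (Z : rbcmType R) (mu : set (borel Z) -> \bar R) (r : R) : R :=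
  fine (mu (root_disc Z r)).

Definition disc_int (R : realType) (Z : rbcmType R) (mu : set (borel Z) -> \bar R) (r : R) (f : Z -> R) : R :=
  fine (\int[mu]_(z in root_disc Z r) (f z)%:E)%E.

Definition bounded_borel (R : realType) (Z : rbcmType R) (f : Z -> R) :=
  measurable_fun [set: borel Z] (f : borel Z -> R) /\ exists M, forall z, `|f z| <= M.

Section disc_int.
Variables (R : realType) (Z : rbcmType R) (mu : {measure set (borel Z) -> \bar R}).
Hypothesis mufin : locally_finite mu.
Implicit Types (f g : Z -> R) (r s : R).

Lemma disc_intE r f : disc_int mu r f = Rintegral mu (root_disc Z r) f.
Proof. by []. Qed.

Lemma disc_massE r : (disc_mass mu r)%:E = mu (root_disc Z r).
Proof. by rewrite fineK// ge0_fin_numE. Qed.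

Lemma disc_mass_ge0 r : 0 <= disc_mass mu r.
Proof. exact: fine_ge0. Qed.

Lemma root_disc_sub r s : r <= s -> root_disc Z r `<=` root_disc Z s.
Proof. by move=> rs z /le_trans; apply. Qed.

Lemma disc_mass_le r s : r <= s -> disc_mass mu r <= disc_mass mu s.
Proof.
move=> rs; rewrite -lee_fin !disc_massE le_measure// ?inE; [exact: measurable_root_disc..|].
exact: root_disc_sub.
Qed.

Lemma disc_integrable r f : bounded_borel f -> mu.-integrable (root_disc Z r) (EFin \o f).
Proof.
move=> [mf [M fM]]; apply: measurable_bounded_integrable => //.
- exact: measurable_root_disc.
- exact: measurable_funTS.
- exists M; split; first exact: num_real.
  by move=> x Mx z _; apply: le_trans (fM z) (ltW Mx).
Qed.

Lemma integral_mrestr_disc r f : bounded_borel f ->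
  (\int[mrestr mu (measurable_root_disc Z r)]_z (f z)%:E = (disc_int mu r f)%:E)%E.
Proof.
move=> bf; have mD := measurable_root_disc Z r; have [mf _] := bf.
have fi := disc_integrable r bf.
rewrite /disc_int /Rintegral fineK; last exact: integrable_fin_num.
have -> : (\int[mu]_(z in root_disc Z r) (f z)%:E = \int[mrestr mu mD]_(z in root_disc Z r) (f z)%:E)%E.
  by apply: eq_measure_integral => A mA AD; rewrite /= /mrestr setIidl.
have mrD : measurable_fun [set: borel Z] (EFin \o f) by apply/measurable_EFinP.
rewrite [LHS](negligible_integral (N := ~` root_disc Z r)) ?setTD ?setCK//.
- exact: measurableC.
- apply/(negligible_integrable (N := ~` root_disc Z r)) => //.
  + exact: measurableC.
  + by rewrite /= /mrestr setICl measure0.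
  rewrite setTD setCK; apply/integrableP; split; first exact: measurable_funTS.
  have /integrableP[_] := fi; congr (_ < _)%E.
  by apply: eq_measure_integral => A mA AD; rewrite /= /mrestr setIidl.
- by rewrite /= /mrestr setICl measure0.
Qed.

Lemma disc_intB r f g : bounded_borel f -> bounded_borel g ->
  disc_int mu r (fun z => f z - g z) = disc_int mu r f - disc_int mu r g.
Proof. by move=> bf bg; apply: RintegralB; [exact: measurable_root_disc|exact: disc_integrable..]. Qed.

Lemma disc_intZ r c f : bounded_borel f -> disc_int mu r (fun z => c * f z) = c * disc_int mu r f.
Proof. by move=> bf; apply: RintegralZl; [exact: measurable_root_disc|exact: disc_integrable]. Qed.

Lemma le_disc_int r f g : bounded_borel f -> bounded_borel g ->
  (forall z, mdist point z <= r -> f z <= g z) -> disc_int mu r f <= disc_int mu r g.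
Proof. by move=> bf bg fg; apply: le_Rintegral; [exact: measurable_root_disc|exact: disc_integrable..|]. Qed.

Lemma bounded_borel_cst c : bounded_borel (fun _ : Z => c).
Proof. by split; [exact: measurable_cst|exists `|c|]. Qed.

Lemma disc_int_cst r c : disc_int mu r (fun=> c) = c * disc_mass mu r.
Proof. by rewrite disc_intE Rintegral_cst//; exact: measurable_root_disc. Qed.

Lemma bounded_borelN f : bounded_borel f -> bounded_borel (fun z => - f z).
Proof.
move=> [mf [M fM]]; split; first exact: measurableT_comp.
by exists M => z; rewrite normrN.
Qed.

Lemma bounded_borelD f g : bounded_borel f -> bounded_borel g -> bounded_borel (fun z => f z + g z).
Proof.
move=> [mf [M fM]] [mg [N gN]]; split; first exact: measurable_funD.
by exists (M + N) => z; rewrite (le_trans (ler_normD _ _))// lerD.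
Qed.

Lemma bounded_borelM f g : bounded_borel f -> bounded_borel g -> bounded_borel (fun z => f z * g z).
Proof.
move=> [mf [M fM]] [mg [N gN]]; split; first exact: measurable_funM.
by exists (M * N) => z; rewrite normrM ler_pM.
Qed.

Lemma disc_int_bound r f c : bounded_borel f ->
  (forall z, mdist point z <= r -> `|f z| <= c) -> `|disc_int mu r f| <= c * disc_mass mu r.
Proof.
move=> bf fc; have bc := bounded_borel_cst; rewrite ler_norml -mulNr -!disc_int_cst.
by apply/andP; split; apply: le_disc_int => // z /fc; rewrite ler_norml => /andP[].
Qed.

Lemma disc_int_split r s f : r <= s -> bounded_borel f ->
  disc_int mu s f = disc_int mu r f + Rintegral mu (root_disc Z s `\` root_disc Z r) f.
Proof.
move=> rs bf; rewrite !disc_intE -Rintegral_setU //.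
- by rewrite setDUK//; exact: root_disc_sub.
- exact: measurable_root_disc.
- by apply: measurableD; exact: measurable_root_disc.
- by rewrite setDUK; [exact: disc_integrable|exact: root_disc_sub].
- by rewrite disj_set2E setDE setIC -setIA setICl setI0.
Qed.

Lemma disc_int_support r s f : r <= s -> bounded_borel f ->
  (forall z, r < mdist point z -> f z = 0) -> disc_int mu s f = disc_int mu r f.
Proof.
move=> rs bf f0; rewrite (disc_int_split rs bf) [X in _ + X](_ : _ = 0) ?addr0//.
rewrite -(Rintegral_set0 mu f) /Rintegral integral0_eq ?integral_set0// => z [_ /negP].
by rewrite -ltNge => /f0 ->.
Qed.

Lemma disc_int_annulus r s f : r <= s -> bounded_borel f ->
  (forall z, `|f z| <= 1) ->
  `|disc_int mu s f - disc_int mu r f| <= disc_mass mu s - disc_mass mu r.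
Proof.
move=> rs bf f1; pose D := root_disc Z s `\` root_disc Z r.
have mD : measurable D by apply: measurableD; exact: measurable_root_disc.
have iD g : bounded_borel g -> mu.-integrable D (EFin \o g).
  move=> bg; apply: integrableS (disc_integrable s bg) => //; first exact: measurable_root_disc.
  exact: subDsetl.
rewrite (disc_int_split rs bf) addrC addKr.
have -> : disc_mass mu s - disc_mass mu r = Rintegral mu D (fun=> 1).
  have := disc_int_split rs (bounded_borel_cst 1); rewrite !disc_int_cst !mul1r => ->.
  by rewrite addrC addKr.
have b1 := bounded_borel_cst 1.
rewrite ler_norml; apply/andP; split; last first.
  apply: le_Rintegral => //; [exact: iD..|] => z _.
  by have := f1 z; rewrite ler_norml => /andP[].
rewrite -mulN1r -RintegralZl//; last exact: iD.
apply: le_Rintegral => //; [|exact: iD|].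
  by apply: (iD (fun=> -1 * 1)); exact: bounded_borel_cst.
by move=> z _; have := f1 z; rewrite mulr1 ler_norml => /andP[].
Qed.

(** Continuity of the measure from above. *)
Lemma disc_mass_right_cont r e : 0 < e -> exists2 h, 0 < h & disc_mass mu (r + h) <= disc_mass mu r + e.
Proof.
move=> e0; pose F (n : nat) := root_disc Z (r + n.+1%:R^-1).
have capF : \bigcap_n F n = root_disc Z r.
  apply/seteqP; split => z.
    move=> Fz; apply/ler_addgt0Pr => d d0.
    have /filter_ex[n /= nd] := natSinv_small d0.
    by apply: le_trans (Fz n I) _; rewrite lerD2l.
  by move=> rz n _; apply: root_disc_sub rz; rewrite lerDl invr_ge0.
have : mu \o F @ \oo --> mu (root_disc Z r).
  rewrite -capF; apply: nonincreasing_cvg_mu; first exact: mufin.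
  - by move=> n; exact: measurable_root_disc.
  - by rewrite capF; exact: measurable_root_disc.
  - move=> m n mn; apply/subsetPset; apply: root_disc_sub; rewrite lerD2l.
    by rewrite lef_pV2 ?posrE// ler_nat.
rewrite -disc_massE => /fine_cvgP[_ /cvgrPdist_le H].
have [n /= nP] := filter_ex (H _ e0).
exists n.+1%:R^-1; first by rewrite invr_gt0.
move: nP; rewrite distrC => /(le_trans (ler_norm _)); rewrite lerBlDl.
by [].
Qed.

(** The jumps of a monotone function are countably many. *)
Lemma disc_mass_left_cont : exists2 B : set R, countable B & forall r e, ~ B r -> 0 < e ->
  exists2 h, 0 < h & disc_mass mu (r + h) - disc_mass mu (r - h) <= e.
Proof.
pose F := disc_mass mu.
have ndF : {homo F : x y / x <= y} := disc_mass_le.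
pose BN (N : nat) := [set x | x \in (`](- N%:R), (N%:R)[) /\ discontinuity F x].
exists (\bigcup_N BN N).
  apply: bigcup_countable => // N _; apply: discontinuity_countable.
  by move=> x y _ _; exact: ndF.
move=> r e Br e0.
have cr : cvg (F x @[x --> r^'+]).
  apply: nondecreasing_at_right_is_cvgr.
    by near=> x; move=> y z _ _; exact: ndF.
  by near=> x; exists 0 => _ [y _ <-]; exact: disc_mass_ge0.
have cl : cvg (F x @[x --> r^'-]).
  apply: nondecreasing_at_left_is_cvgr.
    by near=> x; move=> y z _ _; exact: ndF.
  near=> x; exists (F r) => _ [y + <-]; rewrite /= in_itv /= => /andP[_ yr].
  exact/ndF/ltW.
have lr : lim (F x @[x --> r^'-]) = lim (F x @[x --> r^'+]).
  apply/eqP; apply: contrapT => /negP ne; apply: Br.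
  exists (Num.truncn `|r|).+1 => //; split; last by split.
  by rewrite in_itv /= -ltr_norml truncnS_gt.
have e2 : 0 < e / 2 by rewrite divr_gt0.
have /cvgrPdist_le /(_ _ e2) [a /= a0 aP] := cr.
have /cvgrPdist_le /(_ _ e2) [b /= b0 bP] := cl.
pose h := Num.min a b / 2; have m0 : 0 < Num.min a b by rewrite lt_min a0.
have h0 : 0 < h by rewrite divr_gt0.
have hm : h < Num.min a b by rewrite ltr_pdivrMr// ltr_pMr// ltr1n.
exists h => //.
have : `|lim (F x @[x --> r^'+]) - F (r + h)| <= e / 2.
  apply: aP; rewrite /= ?ltrDl// opprD addrA subrr add0r normrN gtr0_norm//.
  by rewrite (lt_le_trans hm)// ge_min lexx.
have : `|lim (F x @[x --> r^'-]) - F (r - h)| <= e / 2.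
  apply: bP; rewrite /= ?ltrBlDr ?ltrDl// opprB addrCA subrr addr0 gtr0_norm//.
  by rewrite (lt_le_trans hm)// ge_min lexx orbT.
by rewrite lr !ler_norml => /andP[? ?] /andP[? ?]; rewrite -/F; lra.
Unshelve. all: by end_near.
Qed.

End disc_int.

(** * The bounded-Lipschitz distance on discs *)

Section test_functions.
Variables (R : realType) (kappa : R) (hk : 0 < kappa <= 1).

Definition holder (Z : rbcmType R) (C : R) (f : Z -> R) :=
  forall x y, `|f x - f y| <= C * mdist x y `^ kappa.

(** The condition that the norm, a sum of two terms, is at most 1 is replaced by
    separate bounds on the two terms; [f / 2] then has norm at most 1. *)
Definition test (Z : rbcmType R) (f : Z -> R) := (forall z, `|f z| <= 1) /\ holder 1 f.

Lemma holder_continuous (Z : rbcmType R) (C : R) (f : Z -> R) : 0 <= C -> holder C f -> continuous f.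
Proof.
move=> C0 fC z; apply/cvgrPdist_le => e e0; apply/nbhs_ballP.
have /andP[k0 _] := hk; have C1 : 0 < C + 1 by rewrite ltr_wpDl.
have eC : 0 < e / (C + 1) by rewrite divr_gt0.
exists ((e / (C + 1)) `^ kappa^-1) => [|y]; first exact: powR_gt0.
rewrite ballEmdist /= => zy; apply: le_trans (fC z y) _.
have : mdist z y `^ kappa <= e / (C + 1).
  have -> : e / (C + 1) = ((e / (C + 1)) `^ kappa^-1) `^ kappa.
    by rewrite -powRrM mulVf ?gt_eqF// powRr1// ltW.
  by rewrite ge0_ler_powR ?nnegrE ?mdist_ge0 ?powR_ge0 ?(ltW k0) ?(ltW zy).
rewrite ler_pdivlMr// => h; apply: le_trans h; rewrite mulrC ler_wpM2l ?powR_ge0//.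
by rewrite lerDl.
Qed.

Lemma holder_bounded_borel (Z : rbcmType R) (C M : R) (f : Z -> R) : 0 <= C -> holder C f ->
  (forall z, `|f z| <= M) -> bounded_borel f.
Proof.
by move=> C0 fC fM; split; [apply: borel_continuous; exact: holder_continuous fC|exists M].
Qed.

Lemma test_bounded_borel (Z : rbcmType R) (f : Z -> R) : test f -> bounded_borel f.
Proof. by move=> [f1 fh]; exact: holder_bounded_borel fh f1. Qed.

Lemma test0 (Z : rbcmType R) : test (fun _ : Z => 0).
Proof. by split => [z|x y]; rewrite ?subr0 normr0// mul1r powR_ge0. Qed.

Lemma BLnorm_le1_test (Z : rbcmType R) (f : Z -> R) : (BLnorm kappa f <= 1)%E -> test f.
Proof.
rewrite /BLnorm; set S := ereal_sup _; set H := holder_seminorm _ _ => SH.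
have S0 : (0 <= S)%E.
  by apply: le_ereal_sup_tmp; exists `|f point|%:E; [exists point|rewrite lee_fin].
have H0 : (0 <= H)%E by apply: ereal_sup_ubound; left.
split => [z|x y].
  rewrite -lee_fin; apply: le_trans SH; apply: le_trans (leeDl _ H0).
  by apply: ereal_sup_ubound; exists z.
have [->|xy] := eqVneq x y; first by rewrite subrr normr0 mul1r powR_ge0.
have d0 : 0 < mdist x y `^ kappa by rewrite powR_gt0// mdist_gt0.
rewrite -ler_pdivrMr// -lee_fin; apply: le_trans SH; apply: le_trans (leeDr _ S0).
by apply: ereal_sup_ubound; right; exists (x, y) => //=; apply/eqP.
Qed.

Lemma BLnorm_le (Z : rbcmType R) (f : Z -> R) a b : 0 <= b -> (forall z, `|f z| <= a) -> holder b f ->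
  (BLnorm kappa f <= (a + b)%:E)%E.
Proof.
move=> b0 fa fb; rewrite EFinD; apply: leeD.
  by apply: ge_ereal_sup => _ [z _ <-]; rewrite lee_fin.
apply: ge_ereal_sup => _ [->|[[x y] /= /eqP xy <-]]; first by rewrite lee_fin.
by rewrite lee_fin ler_pdivrMr ?fb// powR_gt0// mdist_gt0.
Qed.

Lemma test_half_BLnorm (Z : rbcmType R) (f : Z -> R) : test f -> (BLnorm kappa (fun z => (2^-1 * f z)%R) <= 1)%E.
Proof.
move=> [f1 fh]; rewrite (_ : 1%E = (2^-1 + 2^-1 : R)%:E); last by congr EFin; lra.
apply: BLnorm_le => // [z|x y].
  by rewrite normrM ger0_norm// ler_piMr.
by rewrite -mulrBr normrM ger0_norm// ler_wpM2l// -[leRHS]mul1r.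
Qed.

(** A bounded Lipschitz function is Hoelder continuous: for [d <= 1] because then
    [d <= d `^ kappa], and for larger [d] by boundedness. *)
Lemma lipschitz_holder (L d : R) : 1 <= L -> 0 <= d -> Num.min 1 (L * d) <= L * d `^ kappa.
Proof.
move=> L1 d0; have /andP[k0 k1] := hk.
have L0 : 0 <= L by apply: le_trans L1.
have [d1|d1] := leP d 1.
  rewrite ge_min; apply/orP; right; rewrite ler_wpM2l//.
  have [->|dn0] := eqVneq d 0; first exact: powR_ge0.
  by apply: ger1_powR => //; rewrite d1 lt_neqAle eq_sym dn0 d0.
rewrite ge_min; apply/orP; left; apply: le_trans L1 _; rewrite ler_peMr//.
by rewrite -(powRr0 d); apply: ler_powR; exact: ltW.
Qed.

Definition clamp (t : R) := Num.max 0 (Num.min 1 t).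

Lemma clamp_itv t : 0 <= clamp t <= 1.
Proof. by rewrite /clamp le_max lexx /= ge_max ler01 ge_min lexx. Qed.

Lemma clamp_norm t : `|clamp t| <= 1.
Proof. by have /andP[? ?] := clamp_itv t; rewrite ger0_norm. Qed.

Lemma clamp1 t : 1 <= t -> clamp t = 1.
Proof. by move=> t1; rewrite /clamp (min_idPl t1) (max_idPr ler01). Qed.

Lemma clamp0 t : t <= 0 -> clamp t = 0.
Proof. by move=> t0; rewrite /clamp; apply/max_idPl; rewrite ge_min t0 orbT. Qed.

Lemma clamp_id t : 0 <= t -> t <= 1 -> clamp t = t.
Proof. by move=> t0 t1; rewrite /clamp (min_idPr t1) (max_idPr t0). Qed.

Lemma clamp_lip s t : `|clamp s - clamp t| <= Num.min 1 `|s - t|.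
Proof.
wlog st : s t / t <= s => [hw|].
  by have [/hw//|/ltW/hw h] := leP t s; rewrite distrC (distrC s).
rewrite le_min; apply/andP; split.
  have /andP[? ?] := clamp_itv s; have /andP[? ?] := clamp_itv t.
  by rewrite ler_norml; apply/andP; split; lra.
rewrite (ger0_norm (_ : 0 <= s - t)) ?subr_ge0// ler_norml.
have [t0|t0] := leP t 0;
  [rewrite (clamp0 t0)|have [t1|t1] := leP 1 t;
    [rewrite (clamp1 t1)|rewrite (clamp_id (ltW t0) (ltW t1))]];
  (have [s0|s0] := leP s 0;
  [rewrite (clamp0 s0)|have [s1|s1] := leP 1 s;
    [rewrite (clamp1 s1)|rewrite (clamp_id (ltW s0) (ltW s1))]]);
  apply/andP; split; lra.
Qed.

Lemma clamp_holder (Z : rbcmType R) (L : R) (u : Z -> R) : 1 <= L ->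
  (forall x y, `|u x - u y| <= L * mdist x y) -> holder L (fun z => clamp (u z)).
Proof.
move=> L1 uL x y; apply: le_trans (clamp_lip _ _) _.
apply: le_trans (lipschitz_holder L1 (mdist_ge0 _ _)).
by rewrite le_min ge_min lexx /= ge_min uL orbT.
Qed.

Lemma holderM (Z : rbcmType R) (C L : R) (f g : Z -> R) :
  (forall z, `|f z| <= 1) -> (forall z, `|g z| <= 1) -> holder C f -> holder L g ->
  holder (C + L) (fun z => f z * g z).
Proof.
move=> f1 g1 fC gL x y.
rewrite (_ : f x * g x - f y * g y = (f x - f y) * g x + f y * (g x - g y)); last first.
  by rewrite mulrBl mulrBr addrA subrK.
apply: le_trans (ler_normD _ _) _; rewrite !normrM mulrDl lerD//.
  by apply: le_trans (fC x y); rewrite ler_piMr.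
by apply: le_trans (gL x y); rewrite ler_piMl.
Qed.

Lemma holder_test (Z : rbcmType R) (C : R) (f : Z -> R) : 1 <= C ->
  (forall z, `|f z| <= 1) -> holder C f -> test (fun z => C^-1 * f z).
Proof.
move=> C1 f1 fC; have C0 : 0 < C by apply: lt_le_trans C1.
split => [z|x y].
  rewrite normrM ger0_norm ?invr_ge0 ?(ltW C0)// mulr_ile1 ?invr_ge0 ?(ltW C0)//.
  by rewrite invf_le1.
by rewrite -mulrBr normrM ger0_norm ?invr_ge0 ?(ltW C0)// mul1r mulrC ler_pdivrMr// mulrC.
Qed.

End test_functions.

Section BLdist_disc.
Variables (R : realType) (kappa : R) (hk : 0 < kappa <= 1) (Z : rbcmType R).
Implicit Types (mu nu la : {measure set (borel Z) -> \bar R}) (f : Z -> R) (r : R).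

Definition BLdisc mu nu r := BLdist kappa (mrestr mu (measurable_root_disc Z r))
  (mrestr nu (measurable_root_disc Z r)).

Lemma BLdisc_ge0 mu nu r : (0 <= BLdisc mu nu r)%E.
Proof.
apply: le_ereal_sup_tmp; exists (`|(0 : \bar R)|)%E; last by rewrite abse_ge0.
exists (fun=> 0).
  have : (BLnorm kappa (fun _ : Z => 0%R) <= (0 + 0)%:E)%E.
    by apply: BLnorm_le => // [z|x y]; rewrite ?subr0 normr0// mul0r.
  by move/le_trans; apply; rewrite lee_fin addr0.
by rewrite !integral0 oppe0 adde0.
Qed.

Section locally_finite.
Variables mu nu : {measure set (borel Z) -> \bar R}.
Hypotheses (muf : locally_finite mu) (nuf : locally_finite nu).

Lemma BLdisc_sym r : BLdisc mu nu r = BLdisc nu mu r.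
Proof.
rewrite /BLdisc /BLdist; congr ereal_sup; apply/seteqP; split=> _ [f f1 <-];
  exists f => //; have bf := test_bounded_borel hk (BLnorm_le1_test f1);
  by rewrite !integral_mrestr_disc// -!EFinB !abse_EFin distrC.
Qed.

Lemma BLdisc_le r e :
  (forall f, test kappa f -> `|disc_int mu r f - disc_int nu r f| <= e) ->
  (BLdisc mu nu r <= e%:E)%E.
Proof.
move=> fe; apply: ge_ereal_sup => _ [f /(BLnorm_le1_test) tf <-].
have bf := test_bounded_borel hk tf.
by rewrite !integral_mrestr_disc// -EFinB abse_EFin lee_fin fe.
Qed.

Lemma BLdisc_test_le r f : (BLnorm kappa f <= 1)%E ->
  (`|disc_int mu r f - disc_int nu r f|%:E <= BLdisc mu nu r)%E.
Proof.
move=> f1; have bf := test_bounded_borel hk (BLnorm_le1_test f1).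
by apply: ereal_sup_ubound; exists f => //; rewrite !integral_mrestr_disc.
Qed.

Lemma BLdisc_test r f e : test kappa f -> (BLdisc mu nu r < e%:E)%E ->
  `|disc_int mu r f - disc_int nu r f| <= 2 * e.
Proof.
move=> tf de; have bf := test_bounded_borel hk tf.
have := BLdisc_test_le r (test_half_BLnorm tf); rewrite !disc_intZ// -mulrBr normrM.
move=> /le_lt_trans/(_ de); rewrite lte_fin ger0_norm// => /ltW.
by rewrite mulrC ler_pdivrMr// mulrC.
Qed.

End locally_finite.

Lemma BLdisc_triangle mu nu la r : locally_finite mu -> locally_finite nu -> locally_finite la ->
  (BLdisc mu la r <= BLdisc mu nu r + BLdisc nu la r)%E.
Proof.
move=> muf nuf laf; apply: ge_ereal_sup => _ [f f1 <-].
have bf := test_bounded_borel hk (BLnorm_le1_test f1).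
rewrite !integral_mrestr_disc// -EFinB abse_EFin.
have h1 := BLdisc_test_le muf nuf r f1; have h2 := BLdisc_test_le nuf laf r f1.
apply: le_trans (leeD h1 h2); rewrite -EFinD lee_fin.
exact: ler_distD.
Qed.

(** The mass of an annulus between [r] and [r + h] tends to 0 with [h], hence the
    distance of the restrictions is right-continuous. *)
Lemma measurable_BLdisc mu nu : locally_finite mu -> locally_finite nu ->
  measurable_fun (`[0%R, +oo[%classic : set R) (capped (BLdisc mu nu)).
Proof.
move=> muf nuf; apply: right_cont_measurable => r e r0 e0; have e2 : 0 < e / 2 by rewrite divr_gt0.
have [h h0 hP] := disc_mass_right_cont muf r e2.
have [k k0 kP] := disc_mass_right_cont nuf r e2.
exists (Num.min h k) => [|s rs]; rewrite ?lt_min ?h0// -lerBlDl le_min => /andP[sh sk].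
have Ms : disc_mass mu s - disc_mass mu r <= e / 2.
  by rewrite lerBlDl (le_trans _ hP)// disc_mass_le// -lerBlDl.
have Ns : disc_mass nu s - disc_mass nu r <= e / 2.
  by rewrite lerBlDl (le_trans _ kP)// disc_mass_le// -lerBlDl.
have close f : test kappa f ->
    `|(disc_int mu s f - disc_int nu s f) - (disc_int mu r f - disc_int nu r f)| <= e.
  move=> tf; have bf := test_bounded_borel hk tf; have [f1 _] := tf.
  have := disc_int_annulus muf rs bf f1; have := disc_int_annulus nuf rs bf f1.
  by rewrite !ler_norml => /andP[? ?] /andP[? ?]; apply/andP; split; lra.
have d0 := BLdisc_ge0 mu nu.
have le12 (r1 r2 : R) : (forall f, test kappa f ->
    `|(disc_int mu r1 f - disc_int nu r1 f) - (disc_int mu r2 f - disc_int nu r2 f)| <= e) ->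
    (BLdisc mu nu r1 <= BLdisc mu nu r2 + e%:E)%E.
  move=> cl; apply: ge_ereal_sup => _ [f f1 <-].
  have tf := BLnorm_le1_test f1; have bf := test_bounded_borel hk tf.
  rewrite !integral_mrestr_disc// -EFinB abse_EFin.
  apply: le_trans (leeD (BLdisc_test_le muf nuf r2 f1) (lexx _)); rewrite -EFinD lee_fin.
  have := cl f tf; move: (disc_int mu r1 f - _) (disc_int mu r2 f - _) => u v uv.
  by rewrite -(subrK v u) (le_trans (ler_normD _ _))// addrC lerD.
have sr := @capped_close R _ d0 s r e (ltW e0) (le12 _ _ close).
have rs' := @capped_close R _ d0 r s e (ltW e0).
rewrite ler_norml; apply/andP; split; [rewrite lerBrDl lerBlDr|by rewrite lerBlDl].
by apply/rs'/le12 => f tf; rewrite distrC close.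
Qed.

(** A test function is multiplied by a cutoff at radius [r - h], which makes it
    admissible in the hypothesis, up to the factor [1 + h^-1].  The error is at most the
    mass of an annulus inside the sphere of radius [r]; applied to the cutoffs
    themselves, the hypothesis bounds this mass for [nu] by that for [mu]. *)
Lemma BLdisc_le_annulus mu nu r r' h e : locally_finite mu -> locally_finite nu ->
  0 < h <= 1 -> r + h <= r' ->
  (forall f, test kappa f -> (forall z, r' < mdist point z -> f z = 0) ->
    `|disc_int mu r' f - disc_int nu r' f| <= e) ->
  (BLdisc mu nu r <= (2 * (disc_mass mu (r + h) - disc_mass mu (r - h - h)) + 4 * (1 + h^-1) * e)%:E)%E.
Proof.
move=> muf nuf /andP[h0 h1] rhr' fe.
have L1 : 1 <= h^-1 by rewrite invf_ge1.
pose chi a z : R := clamp ((a + h - mdist (point : Z) z) / h).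
have chi_holder a : holder kappa h^-1 (chi a).
  apply: clamp_holder => // x y; rewrite -mulrBl normrM [`|h^-1|]ger0_norm ?invr_ge0 ?(ltW h0)//.
  rewrite mulrC ler_wpM2l ?invr_ge0 ?(ltW h0)//.
  have := metric_triangle point x y; have := metric_triangle point y x.
  by rewrite (metric_sym y x) ler_norml => ? ?; apply/andP; split; lra.
have chi_norm a z : `|chi a z| <= 1 by exact: clamp_norm.
have chi1 a z : mdist point z <= a -> chi a z = 1.
  by move=> za; apply: clamp1; rewrite ler_pdivlMr// mul1r; lra.
have chi0 a z : a + h < mdist point z -> chi a z = 0.
  move=> za; apply: clamp0; rewrite pmulr_lle0 ?invr_gt0//; lra.
have bchi a : bounded_borel (chi a).
  by apply: (holder_bounded_borel hk _ (chi_holder a) (chi_norm a)); rewrite invr_ge0 ltW.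
pose C := 1 + h^-1; have C1 : 1 <= C by rewrite lerDl invr_ge0 ltW.
have C0 : 0 < C by apply: lt_le_trans C1.
(* divided by C, the product is a test function that vanishes off a disc *)
have cut f a : test kappa f -> a + h <= r' ->
    `|disc_int mu (a + h) (fun z => f z * chi a z) - disc_int nu (a + h) (fun z => f z * chi a z)| <= C * e.
  move=> tf ar; have [f1 fh] := tf; pose g z := f z * chi a z.
  have bg : bounded_borel g by apply: bounded_borelM => //; exact: (test_bounded_borel hk tf).
  have g1 z : `|g z| <= 1 by rewrite normrM mulr_ile1.
  have gh : holder kappa C g by exact: holderM.
  have g0 z : a + h < mdist point z -> g z = 0 by move=> /chi0; rewrite /g => ->; rewrite mulr0.
  rewrite -(disc_int_support muf ar bg g0) -(disc_int_support nuf ar bg g0).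
  have := fe _ (holder_test C1 g1 gh); rewrite !disc_intZ//.
  rewrite -mulrBr normrM ger0_norm ?invr_ge0 ?(ltW C0)// mulrC ler_pdivrMr// [e * C]mulrC; apply.
  by move=> z rz; rewrite g0 ?mulr0// (le_lt_trans ar).
have t1 : test kappa (fun _ : Z => 1).
  by split => [z|x y]; rewrite ?normr1// subrr normr0 mul1r powR_ge0.
have cut1 a : a + h <= r' ->
    `|disc_int mu (a + h) (chi a) - disc_int nu (a + h) (chi a)| <= C * e.
  by move=> /(cut _ a t1); congr (`|_ - _| <= _); congr disc_int; apply/funext => z; rewrite mul1r.
have chi_le (la : {measure set (borel Z) -> \bar R}) a : locally_finite la ->
    disc_mass la a <= disc_int la (a + h) (chi a) <= disc_mass la (a + h).
  move=> laf; have aah : a <= a + h by rewrite lerDl ltW.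
  have b1 := bounded_borel_cst Z 1; apply/andP; split.
    rewrite (disc_int_split laf aah (bchi a)) -[leLHS]addr0 lerD//.
      rewrite -[leLHS]mul1r -disc_int_cst; apply: le_disc_int => // z /chi1 ->.
      by [].
    by apply: Rintegral_ge0 => z _; have /andP[] := clamp_itv ((a + h - mdist (point : Z) z) / h).
  rewrite -[leRHS]mul1r -disc_int_cst; apply: le_disc_int => // z _.
  by have /andP[] := clamp_itv ((a + h - mdist (point : Z) z) / h).
have ann_nu : disc_mass nu r - disc_mass nu (r - h) <=
    disc_mass mu (r + h) - disc_mass mu (r - h - h) + 2 * (C * e).
  have /andP[A1 _] := chi_le nu r nuf; have /andP[_ A2] := chi_le mu r muf.
  have := chi_le nu (r - h - h) nuf; have := chi_le mu (r - h - h) muf.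
  rewrite !subrK => /andP[A3 _] /andP[_ A4].
  have := cut1 (r - h - h); rewrite subrK ler_norml => /(_ ltac:(lra))/andP[A5 A6].
  by have := cut1 r rhr'; rewrite ler_norml => /andP[A7 A8]; lra.
have ann_mu : disc_mass mu r - disc_mass mu (r - h) <= disc_mass mu (r + h) - disc_mass mu (r - h - h).
  by apply: lerB; apply: disc_mass_le => //; lra.
have rest (la : {measure set (borel Z) -> \bar R}) f : locally_finite la -> test kappa f ->
    `|disc_int la r f - disc_int la r (fun z => f z * chi (r - h) z)| <=
    disc_mass la r - disc_mass la (r - h).
  move=> laf tf; have bf := test_bounded_borel hk tf; have [f1 _] := tf.
  have bfc : bounded_borel (fun z => f z * chi (r - h) z) by exact: bounded_borelM.
  rewrite -disc_intB//; set g := fun z => _.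
  have bg : bounded_borel g by apply: bounded_borelD => //; exact: bounded_borelN.
  have rr : r - h <= r by lra.
  have g0 : disc_int la (r - h) g = 0.
    rewrite -[RHS](mul0r (disc_mass la (r - h))) -disc_int_cst.
    apply: eq_Rintegral => z; rewrite inE => rz; rewrite /g chi1 ?mulr1 ?subrr//.
  have g1 z : `|g z| <= 1.
    have /andP[c0 c1] := clamp_itv ((r - h + h - mdist (point : Z) z) / h).
    rewrite /g -[f z in X in X - _]mulr1 -mulrBr normrM mulr_ile1// ger0_norm ?subr_ge0//.
    by rewrite lerBlDr lerDl.
  by have := disc_int_annulus laf rr bg g1; rewrite g0 subr0.
apply: BLdisc_le => // f tf.
have := rest mu f muf tf; have := rest nu f nuf tf.
have := cut f (r - h) tf; rewrite subrK => /(_ ltac:(lra)).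
rewrite -/C; move: ann_mu ann_nu.
by rewrite !ler_norml => ? ? /andP[? ?] /andP[? ?] /andP[? ?]; apply/andP; split; lra.
Qed.

End BLdist_disc.

(** * Nearness of measured spaces *)

Section isom_measure.
Variables (R : realType) (X Z : rbcmType R) (mu : {measure set (borel X) -> \bar R}) (f : X -> Z).
Hypothesis fi : rooted_isometry f.

Definition isom_measure : {measure set (borel Z) -> \bar R}.
Proof.
unshelve refine (pushforward mu (f : borel X -> borel Z) : {measure set (borel Z) -> \bar R}).
exact: isometry_measurable.
Defined.

Lemma isom_preimage_disc r : f @^-1` root_disc Z r = root_disc X r.
Proof.
by apply/seteqP; split => x; rewrite /root_disc /mdisc /= (rooted_isometry_height fi).
Qed.

Lemma isom_disc_mass r : disc_mass isom_measure r = disc_mass mu r.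
Proof. by rewrite /disc_mass -isom_preimage_disc. Qed.

Lemma isom_locally_finite : locally_finite mu -> locally_finite isom_measure.
Proof. by move=> muf r; rewrite /= /pushforward isom_preimage_disc. Qed.

Lemma bounded_borel_comp (phi : Z -> R) : bounded_borel phi -> bounded_borel (phi \o f).
Proof.
move=> [mphi [M phiM]]; split; last by exists M => x; exact: phiM.
exact: (measurableT_comp mphi (isometry_measurable fi)).
Qed.

Lemma isom_disc_int r (phi : Z -> R) : locally_finite mu -> bounded_borel phi ->
  disc_int isom_measure r phi = disc_int mu r (phi \o f).
Proof.
move=> muf bphi; rewrite /disc_int -isom_preimage_disc; congr fine.
apply: (@integral_pushforward _ _ (borel X) (borel Z) R f (isometry_measurable fi) mu).
- by apply/measurable_EFinP; have [] := bphi.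
- by rewrite isom_preimage_disc; apply: disc_integrable => //; exact: bounded_borel_comp.
- exact: measurable_root_disc.
Qed.

End isom_measure.

Section near.
Variables (R : realType) (kappa : R) (hk : 0 < kappa <= 1).
Implicit Types (X Y : rmbcmSpace R) (Z : rbcmType R).

(** Discs are compact. *)
Lemma rmbcm_locally_finite X : locally_finite (rmbcm_measure X).
Proof. by move=> r; have [h _] := rmbcm_radon X; apply: h; exact: compact_mdisc. Qed.

(** The test functions vanish off the disc of radius [a]: nearness then passes to
    smaller radii, whereas the distance of the restrictions of the measures to
    a disc is sensitive to masses close to its boundary. *)
Definition GHV_near (X Y : rmbcmSpace R) (Z : rbcmType R) (f : X -> Z) (g : Y -> Z) (a e : R) :=
  [/\ forall x : X, mdist point x <= a -> exists y, mdist (f x) (g y) <= e,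
      forall y : Y, mdist point y <= a -> exists x, mdist (f x) (g y) <= e
    & forall phi, test kappa phi -> (forall z, a < mdist point z -> phi z = 0) ->
        `|disc_int (rmbcm_measure X) a (phi \o f) - disc_int (rmbcm_measure Y) a (phi \o g)| <= e].

Lemma near_le X Y Z (f : X -> Z) (g : Y -> Z) a e e' : GHV_near f g a e -> e <= e' -> GHV_near f g a e'.
Proof.
move=> [h1 h2 h3] ee'; split=> [x /h1[y xy]|y /h2[x xy]|phi tphi phi0].
- by exists y; exact: le_trans ee'.
- by exists x; exact: le_trans ee'.
- exact: le_trans (h3 _ tphi phi0) ee'.
Qed.

Section distance_in.
Variables (X Y : rmbcmSpace R) (Z : rbcmType R) (f : X -> Z) (g : Y -> Z).
Hypotheses (fi : rooted_isometry f) (gi : rooted_isometry g).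

Definition Hdisc r := hausdorff_dist (range f `&` root_disc Z r) (range g `&` root_disc Z r).

Definition Bdisc r := BLdisc kappa (isom_measure (rmbcm_measure X) fi) (isom_measure (rmbcm_measure Y) gi) r.

Lemma Hdisc_ge0 r : (0 <= Hdisc r)%E. Proof. exact: hausdorff_ge0. Qed.

Lemma Bdisc_ge0 r : (0 <= Bdisc r)%E. Proof. exact: BLdisc_ge0. Qed.

Lemma measurable_Hdisc : measurable_fun (`[0%R, +oo[%classic : set R) (capped Hdisc).
Proof. exact: measurable_hausdorff_discs. Qed.

Lemma measurable_Bdisc : measurable_fun (`[0%R, +oo[%classic : set R) (capped Bdisc).
Proof. by apply: measurable_BLdisc => //; apply: isom_locally_finite; exact: rmbcm_locally_finite. Qed.

Definition dist_in := maxe (rooted_hausdorff_dist (range f) (range g))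
  (rooted_BLdist kappa (rmbcm_pushforward f) (rmbcm_pushforward g)).

Lemma dist_inE : dist_in = maxe (exp_average Hdisc) (exp_average Bdisc).
Proof. by []. Qed.

Lemma dist_in_ge0 : (0 <= dist_in)%E.
Proof. by rewrite dist_inE le_max exp_average_ge0//; exact: Hdisc_ge0. Qed.

Lemma dist_in_le1 : (dist_in <= 1)%E.
Proof.
rewrite dist_inE ge_max; apply/andP; split; apply: exp_average_le1.
- exact: Hdisc_ge0.
- exact: measurable_Hdisc.
- exact: Bdisc_ge0.
- exact: measurable_Bdisc.
Qed.

Lemma GHV_dist_le : (GHV_dist kappa X Y <= dist_in)%E.
Proof. by apply: ereal_inf_lbound; exists Z, f, g. Qed.

(** Closeness implies nearness: two small averages have a common radius where
    both integrands are small. *)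
Lemma dist_in_near a e : 0 <= a -> 0 < e <= 1 ->
  (dist_in < (e * expR (- (a + 1)) / 2)%:E)%E -> GHV_near f g a (2 * e).
Proof.
move=> a0 e01; rewrite dist_inE gt_max => /andP[sH sB]; have /andP[e0 e1] := e01.
have [r [/andP[ar _] Hr Br]] := exp_average_small_radius a0 e01 Hdisc_ge0 Bdisc_ge0
  measurable_Hdisc measurable_Bdisc sH sB.
have [fg gf] := hausdorff_lt Hr; have ee : e <= 2 * e by lra.
split=> [x xa|y ya|phi tphi phi0].
- have [|z [[y _ <-] _] xy] := fg (f x); last by exists y; exact: le_trans ee.
  by split; [exists x|rewrite /root_disc /mdisc /= (rooted_isometry_height fi) (le_trans xa)].
- have [|z [[x _ <-] _] xy] := gf (g y).
    by split; [exists y|rewrite /root_disc /mdisc /= (rooted_isometry_height gi) (le_trans ya)].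
  by exists x; rewrite metric_sym; exact: le_trans ee.
have bphi := test_bounded_borel hk tphi.
have lX := @rmbcm_locally_finite X; have lY := @rmbcm_locally_finite Y.
have lXf := isom_locally_finite fi lX; have lYg := isom_locally_finite gi lY.
rewrite -(isom_disc_int fi a lX bphi) -(isom_disc_int gi a lY bphi).
rewrite -(disc_int_support lXf ar bphi phi0) -(disc_int_support lYg ar bphi phi0).
exact: (BLdisc_test hk lXf lYg tphi Br).
Qed.

End distance_in.

Lemma GHV_ge0 X Y : (0 <= GHV_dist kappa X Y)%E.
Proof. by apply: le_ereal_inf_tmp => _ [Z [f [g [fi gi ->]]]]; exact: dist_in_ge0. Qed.

Lemma GHV_le1 X Y : (GHV_dist kappa X Y <= 1)%E.
Proof.
have [k l|Z [f [g [fi gi _]]]] := @rbcm_glue R X Y unit (fun=> point) (fun=> point) (fun=> 0) tt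
    (fun=> lexx 0) erefl erefl erefl.
  by rewrite !mdistxx subrr normr0 addr0.
by apply: le_trans (GHV_dist_le fi gi) (dist_in_le1 fi gi).
Qed.

Lemma GHV_lt X Y e : (GHV_dist kappa X Y < e)%E -> exists (Z : rbcmType R) (f : X -> Z) (g : Y -> Z),
  [/\ rooted_isometry f, rooted_isometry g & (dist_in f g < e)%E].
Proof. by move=> /ereal_inf_lt[_ [Z [f [g [fi gi ->]]]] de]; exists Z, f, g. Qed.

Lemma dist_in_sym X Y Z (f : X -> Z) (g : Y -> Z) :
  rooted_isometry f -> rooted_isometry g -> dist_in f g = dist_in g f.
Proof.
move=> fi gi; have H : Hdisc f g = Hdisc g f by apply/funext => r; exact: hausdorff_sym.
have B : Bdisc fi gi = Bdisc gi fi.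
  apply/funext => r; apply: BLdisc_sym => //; apply: isom_locally_finite;
    exact: rmbcm_locally_finite.
by rewrite (dist_inE fi gi) (dist_inE gi fi) H B.
Qed.

Lemma GHV_sym X Y : GHV_dist kappa X Y = GHV_dist kappa Y X.
Proof.
apply/eqP; rewrite eq_le; apply/andP; split;
  apply: le_ereal_inf_tmp => _ [Z [f [g [fi gi ->]]]];
  rewrite -/(dist_in f g) dist_in_sym//; exact: GHV_dist_le.
Qed.

Lemma rooted_isometry_comp (X1 X2 X3 : rbcmType R) (f : X1 -> X2) (g : X2 -> X3) :
  rooted_isometry f -> rooted_isometry g -> rooted_isometry (g \o f).
Proof. by move=> [f0 fd] [g0 gd]; split=> [|x y] /=; rewrite ?f0// gd fd. Qed.

(** The ambient space may be enlarged; this allows the comparison of three spaces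
    in an amalgam. *)
Lemma Hdisc_comp (X Y : rmbcmSpace R) (Z W : rbcmType R) (f : X -> Z) (g : Y -> Z) (h : Z -> W) r :
  rooted_isometry h -> (Hdisc (h \o f) (h \o g) r <= Hdisc f g r)%E.
Proof.
move=> hi; have [_ hd] := hi; apply: le_ereal_inf_tmp => _ [e [e0 fg gf] <-].
apply: ereal_inf_lbound; exists e => //.
suff nb (A B : rmbcmSpace R) (u : A -> Z) (v : B -> Z) :
    range u `&` root_disc Z r `<=` mneighborhood (range v `&` root_disc Z r) e ->
    range (h \o u) `&` root_disc W r `<=` mneighborhood (range (h \o v) `&` root_disc W r) e.
  by split => //; exact: nb.
move=> uv _ [[x _ <-]] /=; rewrite /root_disc /mdisc /= (rooted_isometry_height hi) => ux.
have [|_ [[y _ <-] vy] uvxy] := uv (u x); first by split => //; exists x.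
exists (h (v y)); last by rewrite hd.
by split; [exists y|rewrite /= (rooted_isometry_height hi)].
Qed.

Lemma test_comp (Z W : rbcmType R) (h : Z -> W) (phi : W -> R) : rooted_isometry h ->
  test kappa phi -> test kappa (phi \o h).
Proof. by move=> [_ hd] [p1 ph]; split=> [z|x y] /=; rewrite ?p1// -hd ph. Qed.

Lemma Bdisc_comp (X Y : rmbcmSpace R) (Z W : rbcmType R) (f : X -> Z) (g : Y -> Z) (h : Z -> W)
    (fi : rooted_isometry f) (gi : rooted_isometry g) (hi : rooted_isometry h) r :
  (Bdisc (rooted_isometry_comp fi hi) (rooted_isometry_comp gi hi) r <= Bdisc fi gi r)%E.
Proof.
have lX := @rmbcm_locally_finite X; have lY := @rmbcm_locally_finite Y.
apply: ge_ereal_sup => _ [phi phi1 <-]; have tphi := BLnorm_le1_test phi1.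
have bphi := test_bounded_borel hk tphi.
have bphih := test_bounded_borel hk (test_comp hi tphi).
have lfi := isom_locally_finite (rooted_isometry_comp fi hi) lX.
have lgi := isom_locally_finite (rooted_isometry_comp gi hi) lY.
have EX : disc_int (isom_measure (rmbcm_measure X) (rooted_isometry_comp fi hi)) r phi =
    disc_int (isom_measure (rmbcm_measure X) fi) r (phi \o h).
  by rewrite (isom_disc_int (rooted_isometry_comp fi hi) r lX bphi) (isom_disc_int fi r lX bphih).
have EY : disc_int (isom_measure (rmbcm_measure Y) (rooted_isometry_comp gi hi)) r phi =
    disc_int (isom_measure (rmbcm_measure Y) gi) r (phi \o h).
  by rewrite (isom_disc_int (rooted_isometry_comp gi hi) r lY bphi) (isom_disc_int gi r lY bphih).
rewrite (integral_mrestr_disc lfi r bphi) (integral_mrestr_disc lgi r bphi) -EFinB abse_EFin EX EY.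
have phih1 : (BLnorm kappa (phi \o h) <= 1)%E.
  apply: le_trans phi1; have [_ hd] := hi; apply: leeD.
    by apply: ge_ereal_sup => _ [z _ <-]; apply: ereal_sup_ubound; exists (h z).
  apply: ge_ereal_sup => _ [->|[[x y] /= xy <-]]; apply: ereal_sup_ubound; first by left.
  right; exists (h x, h y) => /=; last by rewrite hd.
  move=> hxy; apply: xy; apply: mdist_positivity.
  by rewrite -hd hxy mdistxx.
exact: (BLdisc_test_le hk (isom_locally_finite fi lX) (isom_locally_finite gi lY) r phih1).
Qed.

Lemma GHV_triangle X Y W :
  (GHV_dist kappa X W <= GHV_dist kappa X Y + GHV_dist kappa Y W)%E.
Proof.
apply: le_ereal_inf_add.
- by move=> _ [Z [f [g [fi gi ->]]]]; exact: dist_in_ge0.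
- by move=> _ [Z [f [g [fi gi ->]]]]; exact: dist_in_ge0.
move=> _ _ [Z1 [f1 [g1 [f1i g1i ->]]]] [Z2 [f2 [g2 [f2i g2i ->]]]].
rewrite -/(dist_in f1 g1) -/(dist_in f2 g2).
have [Z [h1 [h2 [h1i h2i h12]]]] := rbcm_amalgam g1i f2i.
have fi := rooted_isometry_comp f1i h1i; have gi := rooted_isometry_comp g2i h2i.
apply: le_trans (GHV_dist_le fi gi) _.
have yi := rooted_isometry_comp g1i h1i; have yi' := rooted_isometry_comp f2i h2i.
have E : h1 \o g1 = h2 \o f2 by apply/funext.
rewrite (dist_inE fi gi) (dist_inE f1i g1i) (dist_inE f2i g2i).
have HH : (exp_average (Hdisc (h1 \o f1) (h2 \o g2)) <=
    exp_average (Hdisc f1 g1) + exp_average (Hdisc f2 g2))%E.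
  apply: exp_average_le_add; try exact: Hdisc_ge0; try exact: measurable_Hdisc.
  move=> r; apply: le_trans (hausdorff_triangle _ (range (h1 \o g1) `&` root_disc Z r) _) _.
  apply: leeD; first exact: Hdisc_comp.
  by rewrite E; exact: Hdisc_comp.
have BB : (exp_average (Bdisc fi gi) <= exp_average (Bdisc f1i g1i) + exp_average (Bdisc f2i g2i))%E.
  have lf := fun A => @rmbcm_locally_finite A.
  apply: exp_average_le_add; try exact: Bdisc_ge0; try exact: measurable_Bdisc.
  move=> r; apply: le_trans (BLdisc_triangle hk r (isom_locally_finite fi (lf X)) (isom_locally_finite yi (lf Y))
      (isom_locally_finite gi (lf W))) _.
  apply: leeD; first exact: Bdisc_comp.
  have := Bdisc_comp f2i g2i h2i r; apply: le_trans.
  by move: (h1 \o g1) E yi => u -> yi.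
rewrite ge_max; apply/andP; split.
  by apply: le_trans HH _; apply: leeD; rewrite le_max lexx.
by apply: le_trans BB _; apply: leeD; rewrite le_max lexx orbT.
Qed.

(** Nearness implies closeness, with a modulus that depends on one of the two
    spaces only.  It is enough to argue along a sequence of spaces: then the
    Hausdorff and the bounded-Lipschitz distances of the discs of radius [r]
    tend to 0 unless [r] is one of the countably many radii at which the discs
    of [X], or their masses, jump. *)
Lemma near_dist_in X e : 0 < e -> exists2 n : nat, True &
  forall (Y : rmbcmSpace R) (Z : rbcmType R) (f : X -> Z) (g : Y -> Z),
    rooted_isometry f -> rooted_isometry g -> GHV_near f g n%:R n.+1%:R^-1 -> (dist_in f g < e%:E)%E.
Proof.
move=> e0; apply: contrapT => no.
pose P := {Y : rmbcmSpace R & {Z : rbcmType R & ((X -> Z) * (Y -> Z))%type}}.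
pose Yp (p : P) := projT1 p; pose Zp (p : P) := projT1 (projT2 p).
pose fp (p : P) : X -> Zp p := (projT2 (projT2 p)).1.
pose gp (p : P) : Yp p -> Zp p := (projT2 (projT2 p)).2.
have /choice[p pP] : forall n : nat, exists p : P, [/\ rooted_isometry (fp p), rooted_isometry (gp p),
    GHV_near (fp p) (gp p) n%:R n.+1%:R^-1 & ~ (dist_in (fp p) (gp p) < e%:E)%E].
  move=> n; apply: contrapT => nop; apply: no; exists n => // Y Z f g fi gi nfg.
  apply: contrapT => nd; apply: nop.
  by exists (existT _ Y (existT _ Z (f, g))).
have fi n : rooted_isometry (fp (p n)) by have [] := pP n.
have gi n : rooted_isometry (gp (p n)) by have [] := pP n.
have np n : GHV_near (fp (p n)) (gp (p n)) n%:R n.+1%:R^-1 by have [] := pP n.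
have lX := @rmbcm_locally_finite X.
have [B1 cB1 B1P] := disc_left_cont X.
have [B2 cB2 B2P] := disc_mass_left_cont lX.
have ev_ge (c : R) := nat_ge_near c.
have HH : \forall n \near \oo, (exp_average (Hdisc (fp (p n)) (gp (p n))) < e%:E)%E.
  apply: (exp_average_cvg0 cB1) => //.
  - by move=> n r; exact: Hdisc_ge0.
  - by move=> n; exact: measurable_Hdisc.
  move=> r r0 B1r eta eta0; have eta2 : 0 < eta / 2 by rewrite divr_gt0.
  have [h h0 hP] := B1P r _ r0 B1r eta2.
  near=> n.
  have nh : n.+1%:R^-1 <= h by near: n; exact: natSinv_small.
  have neta : n.+1%:R^-1 <= eta / 2 by near: n; exact: natSinv_small.
  have nr : r + h <= n%:R by near: n; exact: ev_ge.
  have [fg gf _] := np n; have [f0 fd] := fi n; have [g0 gd] := gi n.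
  move: nh neta nr fg gf; move: (n.+1%:R^-1) (n%:R) => d N nh neta nr fg gf.
  apply: hausdorff_le => // z [[w _ <-]]; rewrite /root_disc /mdisc /= rooted_isometry_height//.
    move=> wr; have [|w' w'r ww'] := hP w; first by lra.
    have [|y wy] := fg w'; first by lra.
    exists (gp (p n) y).
      split; first by exists y.
      rewrite /= ; have := metric_triangle point (fp (p n) w') (gp (p n) y).
      by rewrite (rooted_isometry_height (fi n)); lra.
    have := metric_triangle (fp (p n) w) (fp (p n) w') (gp (p n) y); rewrite fd; lra.
  move=> wr; have [|x xw] := gf w; first by lra.
  have [|x' x'r xx'] := hP x.
    have := metric_triangle point (gp (p n) w) (fp (p n) x).
    by rewrite (rooted_isometry_height (fi n)) (rooted_isometry_height (gi n)) (metric_sym (gp _ _)); lra.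
  exists (fp (p n) x').
    by split; [exists x'|rewrite /= (rooted_isometry_height (fi n)); lra].
  have := metric_triangle (gp (p n) w) (fp (p n) x) (fp (p n) x').
  rewrite fd (metric_sym (gp (p n) w) (fp (p n) x)); lra.
have BB : \forall n \near \oo, (exp_average (Bdisc (fi n) (gi n)) < e%:E)%E.
  apply: (exp_average_cvg0 cB2) => //.
  - by move=> n r; exact: Bdisc_ge0.
  - by move=> n; exact: measurable_Bdisc.
  move=> r r0 B2r eta eta0; have eta4 : 0 < eta / 4 by rewrite divr_gt0.
  have [h' h'0 hP] := B2P r _ B2r eta4.
  pose h := Num.min (h' / 2) 1.
  have h0 : 0 < h by rewrite lt_min divr_gt0 /=.
  have hh' : h <= h' / 2 by rewrite ge_min lexx.
  have h1 : h <= 1 by rewrite ge_min lexx orbT.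
  have c0 : 0 < eta / 2 / (4 * (1 + h^-1)).
    by rewrite !divr_gt0// mulr_gt0// ltr_wpDr ?invr_ge0 ?ltW.
  near=> n.
  have nc : n.+1%:R^-1 <= eta / 2 / (4 * (1 + h^-1)) by near: n; exact: natSinv_small.
  have nr : r + h <= n%:R by near: n; exact: ev_ge.
  have h01 : 0 < h <= 1 by rewrite h0.
  have lY := @rmbcm_locally_finite (Yp (p n)).
  apply: le_trans (BLdisc_le_annulus hk (isom_locally_finite (fi n) lX)
    (isom_locally_finite (gi n) lY) h01 nr (e := n.+1%:R^-1) _) _.
    move=> phi tphi phi0; have [_ _ /(_ phi tphi phi0)] := np n.
    have bphi := test_bounded_borel hk tphi.
    by rewrite (isom_disc_int (fi n) _ lX bphi) (isom_disc_int (gi n) _ lY bphi).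
  rewrite lee_fin !(isom_disc_mass (rmbcm_measure X) (fi n)).
  have m1 : disc_mass (rmbcm_measure X) (r + h) <= disc_mass (rmbcm_measure X) (r + h').
    by apply: disc_mass_le => //; lra.
  have m2 : disc_mass (rmbcm_measure X) (r - h') <= disc_mass (rmbcm_measure X) (r - h - h).
    by apply: disc_mass_le => //; lra.
  have : 4 * (1 + h^-1) * n.+1%:R^-1 <= eta / 2.
    by rewrite mulrC -ler_pdivlMr// mulr_gt0// ltr_wpDr ?invr_ge0 ?ltW.
  by move: (4 * (1 + h^-1) * n.+1%:R^-1) => t ?; lra.
have [n [Hn Bn]] := filter_ex (filterI HH BB).
have [_ _ _] := pP n; apply.
by rewrite (dist_inE (fi n) (gi n)) gt_max Hn.
Unshelve. all: by end_near.
Qed.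

End near.

(** * Transfer of nearness between ambient spaces *)

Lemma powR_subadditive (R : realType) (kappa a b : R) : 0 < kappa <= 1 -> 0 <= a -> 0 <= b ->
  (a + b) `^ kappa <= a `^ kappa + b `^ kappa.
Proof.
move=> /andP[k0 k1] a0 b0.
have [ab0|ab0] := eqVneq (a + b) 0.
  by rewrite ab0 powR0 ?gt_eqF// addr_ge0// powR_ge0.
have s0 : 0 < a + b by rewrite lt_neqAle eq_sym ab0 addr_ge0.
have part t : 0 <= t -> t <= a + b -> t / (a + b) * (a + b) `^ kappa <= t `^ kappa.
  move=> t0 ts; have [->|tn0] := eqVneq t 0; first by rewrite mul0r mul0r powR_ge0.
  have tp : 0 < t by rewrite lt_neqAle eq_sym tn0.
  have -> : t `^ kappa = (t / (a + b)) `^ kappa * (a + b) `^ kappa.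
    by rewrite -powRM ?divrK ?unitfE// ?divr_ge0// ltW.
  rewrite ler_wpM2r ?powR_ge0//; apply: ger1_powR => //.
  by rewrite divr_gt0//= ler_pdivrMr// mul1r.
have := lerD (part a a0 _) (part b b0 _); rewrite lerDl lerDr -mulrDl -mulrDl divff//.
by rewrite mul1r; apply.
Qed.

Section mcshane.
Variables (R : realType) (kappa : R) (hk : 0 < kappa <= 1) (Z : rbcmType R) (S : Type) (i : S -> Z) (s0 : S).

Let powR_mono (x y : R) : 0 <= x -> x <= y -> x `^ kappa <= y `^ kappa.
Proof.
move=> x0 xy; have /andP[k0 _] := hk.
by rewrite ge0_ler_powR ?nnegrE ?(ltW k0)//; exact: le_trans xy.
Qed.

(** McShane's formula [sup_s (u s - d (z, i s) ^ kappa)], cut off at 0.  Since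
    [u <= 1], a point at distance more than 1 from the support of [u] gets the value 0. *)
Lemma holder_extension_ge0 (u : S -> R) (a : R) :
  (forall s, 0 <= u s <= 1) -> (forall s t, `|u s - u t| <= mdist (i s) (i t) `^ kappa) ->
  (forall s, a < mdist point (i s) -> u s = 0) ->
  exists F : Z -> R, [/\ forall z, 0 <= F z <= 1, holder kappa 1 F,
    forall z, a + 1 < mdist point z -> F z = 0 & forall s, F (i s) = u s].
Proof.
move=> u01 uh u0; have /andP[k0 k1] := hk.
pose v z s := Num.max 0 (u s - mdist z (i s) `^ kappa).
have v1 z s : v z s <= 1.
  rewrite /v ge_max ler01 /= lerBlDr; have /andP[_ us1] := u01 s.
  by rewrite (le_trans us1)// lerDl powR_ge0.
have v0 z s : 0 <= v z s by rewrite /v le_max lexx.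
pose F z := sup [set v z s | s in [set: S]].
have hs z : has_sup [set v z s | s in [set: S]].
  by split; [exists (v z s0), s0|exists 1 => _ [s _ <-]].
have vF z s : v z s <= F z by apply: sup_upper_bound; [exact: hs|exists s].
have Fle z c : (forall s, v z s <= c) -> F z <= c.
  by move=> vc; apply: ge_sup; [have [] := hs z|move=> _ [s _ <-]].
have F0 z : 0 <= F z by apply: le_trans (vF z s0).
exists F; split.
- by move=> z; rewrite F0 Fle.
- suff half x y : F x <= F y + mdist x y `^ kappa.
    move=> x y; rewrite mul1r ler_norml lerBrDl lerBlDl addrC lerBlDl addrC.
    by rewrite half addrC {1}metric_sym half.
  apply: Fle => s; rewrite {1}/v ge_max addr_ge0 ?powR_ge0//= lerBlDr.
  have := vF y s; rewrite {1}/v ge_max => /andP[_]; rewrite lerBlDr => /le_trans; apply.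
  rewrite -addrA lerD2l; apply: le_trans (powR_subadditive hk (mdist_ge0 _ _) (mdist_ge0 _ _)).
  apply: powR_mono; first exact: mdist_ge0.
  by rewrite (metric_sym x y) metric_triangle.
- move=> z za; apply/eqP; rewrite eq_le F0 andbT; apply: Fle => s.
  rewrite /v ge_max lexx /= subr_le0.
  have [/u0 ->|sa] := ltP a (mdist point (i s)); first exact: powR_ge0.
  have /andP[_ us1] := u01 s; apply: le_trans us1 _.
  have p1 : (1 : R) `^ kappa = 1 by rewrite powR1.
  rewrite -[leLHS]p1; apply: powR_mono => //.
  by have := metric_triangle point (i s) z; rewrite (metric_sym (i s)); lra.
- move=> s; apply/eqP; rewrite eq_le; apply/andP; split.
    apply: Fle => t; have /andP[us0 _] := u01 s; rewrite /v ge_max us0 /= lerBlDr -lerBlDl.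
    by rewrite (le_trans (ler_norm _))// metric_sym.
  apply: le_trans (vF (i s) s); rewrite /v mdistxx powR0 ?gt_eqF// subr0.
  by rewrite le_max lexx orbT.
Qed.

(** The positive and the negative parts are extended separately: in this way
    the extension vanishes off a disc.  This costs a factor 2. *)
Lemma holder_extension (u : S -> R) (a : R) :
  (forall s, `|u s| <= 1) -> (forall s t, `|u s - u t| <= mdist (i s) (i t) `^ kappa) ->
  (forall s, a < mdist point (i s) -> u s = 0) ->
  exists F : Z -> R, [/\ test kappa F,
    forall z, a + 1 < mdist point z -> F z = 0 & forall s, F (i s) = 2^-1 * u s].
Proof.
move=> u1 uh u0.
have part (w : S -> R) : (forall s, `|w s| <= 1) ->
    (forall s t, `|w s - w t| <= mdist (i s) (i t) `^ kappa) ->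
    (forall s, a < mdist point (i s) -> w s = 0) ->
    exists F : Z -> R, [/\ forall z, 0 <= F z <= 1, holder kappa 1 F,
      forall z, a + 1 < mdist point z -> F z = 0 & forall s, F (i s) = Num.max 0 (w s)].
  move=> w1 wh w0; apply: holder_extension_ge0 => [s|s t|s /w0 ->]; last by rewrite maxxx.
    by rewrite le_max lexx ge_max ler01 /= (le_trans (ler_norm _)).
  apply: le_trans (wh s t); move: (w s) (w t) => p q.
  rewrite ler_norml; case: (leP p q) => pq; [rewrite ler0_norm ?subr_le0//|rewrite gtr0_norm ?subr_gt0//];
    case: (leP 0 p) => ?; case: (leP 0 q) => ?; apply/andP; split; lra.
have [F [F01 Fh F0 FE]] := part u u1 uh u0.
have [||s as_|G [G01 Gh G0 GE]] := part (fun s => - u s).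
- by move=> s; rewrite normrN.
- by move=> s t; rewrite -opprD normrN.
- by rewrite u0 ?oppr0.
exists (fun z => 2^-1 * (F z - G z)); split.
- split=> [z|x y].
    have /andP[? ?] := F01 z; have /andP[? ?] := G01 z.
    by rewrite ler_norml; apply/andP; split; lra.
  have := Fh x y; have := Gh x y; rewrite !mul1r !ler_norml => /andP[? ?] /andP[? ?].
  by apply/andP; split; lra.
- by move=> z za; rewrite F0// G0// subrr mulr0.
- by move=> s; rewrite FE GE; congr (_ * _); case: (leP 0 (u s)) => ?; case: (leP 0 (- u s)) => ?; lra.
Qed.

End mcshane.

(** Passing to an ambient space [W] in which the images of [X] and [Y] are at
    most as far apart.  A test function on [W] restricts to a function on the
    images, which is Hoelder continuous for the larger distances of [Z] as well
    and therefore extends to [Z]; the extension costs 1 in the radius and a factor 2. *)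
Lemma near_transfer (R : realType) (kappa : R) (hk : 0 < kappa <= 1) (X Y : rmbcmSpace R)
    (Z W : rbcmType R) (f : X -> Z) (g : Y -> Z) (f' : X -> W) (g' : Y -> W) (a e : R) :
  rooted_isometry f -> rooted_isometry g -> rooted_isometry f' -> rooted_isometry g' ->
  (forall x y, mdist (f' x) (g' y) <= mdist (f x) (g y)) ->
  GHV_near kappa f g (a + 1) e -> GHV_near kappa f' g' a (2 * e).
Proof.
move=> fi gi f'i g'i le_d [fg gf fgphi]; have aa : a <= a + 1 by rewrite lerDl.
have [_ fd] := fi; have [_ gd] := gi; have [_ f'd] := f'i; have [_ g'd] := g'i.
have [e0|e0] := ltP e 0.
  have [|y] := fg point.
    have [//|no] := leP (mdist (point : X) point) (a + 1).
    have [_ _ /(_ (fun=> 0) (test0 _ _))] := And3 fg gf fgphi.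
    by move=> /(_ (fun=> fun=> erefl)) /(le_trans (normr_ge0 _)); rewrite leNgt e0.
  by move=> /(le_trans (mdist_ge0 _ _)); rewrite leNgt e0.
have e2 : e <= 2 * e by lra.
split=> [x xa|y ya|phi [phi1 phih] phi0].
- have [|y xy] := fg x; first exact: le_trans aa.
  by exists y; apply: le_trans (le_d _ _) (le_trans xy e2).
- have [|x xy] := gf y; first exact: le_trans aa.
  by exists x; apply: le_trans (le_d _ _) (le_trans xy e2).
pose i (s : X + Y) := match s with inl x => f x | inr y => g y end.
pose i' (s : X + Y) := match s with inl x => f' x | inr y => g' y end.
have ii' s t : mdist (i' s) (i' t) <= mdist (i s) (i t).
  case: s t => [x|y] [x'|y'] /=; rewrite ?f'd ?fd ?g'd ?gd//.
  by rewrite metric_sym (metric_sym (g _)).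
have hi s : mdist point (i s) = mdist point (i' s).
  by case: s => s /=; rewrite !rooted_isometry_height.
have /andP[k0 _] := hk.
have [||s|F [tF F0 FE]] := @holder_extension R kappa hk Z _ i (inl point) (phi \o i') a.
- by move=> s; exact: phi1.
- move=> s t; apply: le_trans (phih _ _) _; rewrite mul1r.
  by rewrite ge0_ler_powR ?nnegrE ?mdist_ge0 ?(ltW k0).
- by rewrite hi; exact: phi0.
have := fgphi F tF F0.
have -> : F \o f = (fun x => 2^-1 * (phi \o f') x) by apply/funext => x; exact: (FE (inl x)).
have -> : F \o g = (fun y => 2^-1 * (phi \o g') y) by apply/funext => y; exact: (FE (inr y)).
have bphi := test_bounded_borel hk (conj phi1 phih).
have bX := bounded_borel_comp f'i bphi; have bY := bounded_borel_comp g'i bphi.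
rewrite !disc_intZ//; try exact: rmbcm_locally_finite.
rewrite (disc_int_support (@rmbcm_locally_finite _ X) aa bX); last first.
  by move=> x xa; apply: phi0; rewrite (rooted_isometry_height f'i).
rewrite (disc_int_support (@rmbcm_locally_finite _ Y) aa bY); last first.
  by move=> y ya; apply: phi0; rewrite (rooted_isometry_height g'i).
by rewrite -mulrBr normrM ger0_norm// mulrC ler_pdivrMr// mulrC.
Qed.

(** * Spaces at distance zero *)

Section tent.
Variables (R : realType).
Implicit Types (Z : rbcmType R).

Definition dist_set Z (K : set Z) (z : Z) : R := inf [set mdist z k | k in K].

(** Lipschitz approximation of the indicator function of [K]. *)
Definition tent Z (K : set Z) (L : R) (z : Z) : R := clamp (1 - L * dist_set K z).

Section dist_set.
Variables (Z : rbcmType R) (K : set Z) (K0 : K !=set0).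

Lemma dist_set_has_inf z : has_inf [set mdist z k | k in K].
Proof.
split; first by have [k Kk] := K0; exists (mdist z k), k.
by exists 0 => _ [k _ <-]; exact: mdist_ge0.
Qed.

Lemma dist_set_le z k : K k -> dist_set K z <= mdist z k.
Proof. by move=> Kk; apply: ge_inf; [have [] := dist_set_has_inf z|exists k]. Qed.

Lemma le_dist_set z c : (forall k, K k -> c <= mdist z k) -> c <= dist_set K z.
Proof.
move=> cK; apply: lb_le_inf; first by have [] := dist_set_has_inf z.
by move=> _ [k Kk <-]; exact: cK.
Qed.

Lemma dist_set_ge0 z : 0 <= dist_set K z.
Proof. by apply: le_dist_set => k _; exact: mdist_ge0. Qed.

Lemma dist_set_lip x y : `|dist_set K x - dist_set K y| <= mdist x y.
Proof.
suff half u v : dist_set K u <= dist_set K v + mdist u v.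
  rewrite ler_norml; apply/andP; split; last by rewrite lerBlDl.
  by rewrite lerBrDl lerBlDr (metric_sym x y).
rewrite -lerBlDr; apply: le_dist_set => k Kk; rewrite lerBlDr.
by apply: le_trans (dist_set_le u Kk) _; rewrite addrC metric_triangle.
Qed.

Lemma dist_set_attained e z : 0 < e -> exists2 k, K k & mdist z k <= dist_set K z + e.
Proof.
by move=> e0; have [_ [k Kk <-] /ltW] := inf_adherent e0 (dist_set_has_inf z); exists k.
Qed.

Lemma tent1 L z : K z -> tent K L z = 1.
Proof.
move=> Kz; have -> : tent K L z = clamp 1; last by rewrite clamp1.
congr clamp; suff -> : dist_set K z = 0 by rewrite mulr0 subr0.
by apply/eqP; rewrite eq_le dist_set_ge0 andbT -[leRHS](mdistxx z) dist_set_le.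
Qed.

Lemma tent0 L z : 0 < L -> L^-1 <= dist_set K z -> tent K L z = 0.
Proof.
move=> L0; rewrite -[X in X <= _]mul1r ler_pdivrMr// mulrC => Ld; apply: clamp0.
by rewrite subr_le0.
Qed.

Lemma tent_lip L x y : 0 <= L -> `|tent K L x - tent K L y| <= L * mdist x y.
Proof.
move=> L0; apply: le_trans (clamp_lip _ _) _; rewrite ge_min; apply/orP; right.
rewrite opprB addrC addrA subrK -mulrBr normrM ger0_norm// ler_wpM2l//.
by rewrite distrC dist_set_lip.
Qed.

Lemma tent_holder kappa L : 0 < kappa <= 1 -> 1 <= L -> holder kappa L (tent K L).
Proof.
move=> hk L1; apply: clamp_holder => // x y; have L0 : 0 <= L by exact: le_trans L1.
rewrite opprB addrC addrA subrK -mulrBr normrM ger0_norm// ler_wpM2l//.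
by rewrite distrC dist_set_lip.
Qed.

Lemma tent_norm L z : `|tent K L z| <= 1. Proof. exact: clamp_norm. Qed.

Lemma tent_itv L z : 0 <= tent K L z <= 1. Proof. exact: clamp_itv. Qed.

End dist_set.

Lemma dist_set_isom (X Z : rbcmType R) (g : X -> Z) (K : set X) x : rooted_isometry g ->
  dist_set (g @` K) (g x) = dist_set K x.
Proof.
move=> [_ gd]; rewrite /dist_set; congr inf; apply/seteqP; split.
  by move=> _ [_ [k Kk <-] <-]; exists k => //; rewrite gd.
by move=> _ [k Kk <-]; exists (g k); [exists k|rewrite gd].
Qed.

Lemma tent_isom (X Z : rbcmType R) (g : X -> Z) (K : set X) L x : rooted_isometry g ->
  tent (g @` K) L (g x) = tent K L x.
Proof. by move=> gi; rewrite /tent dist_set_isom. Qed.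

Lemma compact_closed_rbcm Z (K : set Z) : compact K -> closed K.
Proof. by apply: compact_closed; exact: metric_hausdorff. Qed.

Lemma compact_in_disc Z (K : set Z) : compact K -> exists2 r, 0 <= r & forall z, K z -> mdist point z <= r.
Proof.
move=> cK; apply: contrapT => unb.
have far (n : nat) : exists z, K z /\ n%:R < mdist point z.
  apply: contrapT => no; apply: unb; exists n%:R => // z Kz; rewrite leNgt; apply/negP => nz.
  by apply: no; exists z.
have [u uP] := choice far; have [U [UU ooU]] := nat_ultrafilter.
move: cK; rewrite compact_ultra => /(_ _ (ultra_fmap u UU)) [|p [_ up]].
  suff : U [set n | K (u n)] by [].
  by apply: filter_all => n; have [] := uP n.
have Up : U [set n | mdist p (u n) < 1].
  have : nbhs p (ball p 1) by exact: nbhsx_ballx.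
  by move=> /up; rewrite ballEmdist.
have Uoo : U [set n | (Num.truncn (mdist point p + 1)).+1 <= n]%N by apply: ooU; exists (Num.truncn (mdist point p + 1)).+1.
have [n [/= pn]] := ultra_ex2 UU Up Uoo; rewrite -(ler_nat R) => ntr.
have [_ nu] := uP n; have := metric_triangle point p (u n).
by have := truncnS_gt (mdist point p + 1); move: ntr nu; move: (n%:R) (_.+1%:R) => N M; lra.
Qed.

Lemma bounded_borel_indic Z (A : set Z) : measurable (A : set (borel Z)) -> bounded_borel (\1_A : Z -> R).
Proof.
move=> mA; split; first exact: measurable_indic.
by exists 1 => z; rewrite indicE; case: (_ \in _); rewrite ?normr1 ?normr0.
Qed.

Lemma disc_int_indic Z (mu : {measure set (borel Z) -> \bar R}) (A : set Z) r :
  locally_finite mu -> measurable (A : set (borel Z)) -> A `<=` root_disc Z r ->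
  (disc_int mu r \1_A)%:E = mu A.
Proof.
move=> muf mA AD; rewrite /disc_int integral_indic//; last exact: measurable_root_disc.
rewrite setIidl// fineK// ge0_fin_numE//; apply: le_lt_trans (muf r).
by apply: le_measure => //; rewrite inE//; exact: measurable_root_disc.
Qed.

Lemma dist_set_continuous Z (K : set Z) : K !=set0 -> continuous (dist_set K).
Proof.
move=> K0 z; apply/cvgrPdist_le => e e0; apply/nbhs_ballP; exists e => //= y.
by rewrite ballEmdist /= => zy; apply: le_trans (dist_set_lip K0 _ _) (ltW zy).
Qed.

Lemma tent_bounded_borel Z (K : set Z) (k : nat) : K !=set0 -> bounded_borel (tent K k.+1%:R).
Proof.
move=> K0; have h1 : 0 < (1 : R) <= 1 by rewrite ltr01 lexx.
have L1 : 1 <= k.+1%:R :> R by rewrite ler1n.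
by apply: (holder_bounded_borel h1 _ (tent_holder K0 h1 L1) (tent_norm K _)); exact: le_trans L1.
Qed.

Lemma tent_support Z (K : set Z) (k : nat) r z : K !=set0 -> K `<=` root_disc Z r ->
  r + 1 < mdist point z -> tent K k.+1%:R z = 0.
Proof.
move=> K0 KD rz; apply: tent0 => //; apply: (@le_trans _ _ 1).
  by rewrite invf_le1// ler1n.
apply: le_dist_set => // y /KD; rewrite /root_disc /mdisc /= => yr.
have := metric_triangle point y z; rewrite (metric_sym y z); lra.
Qed.

(** The tents around a compact set decrease to its indicator function. *)
Lemma compact_mass_eq Z (mu nu : {measure set (borel Z) -> \bar R}) (K : set Z) r :
  locally_finite mu -> locally_finite nu -> compact K -> K !=set0 -> K `<=` root_disc Z r ->
  (forall k, disc_int mu (r + 1) (tent K k.+1%:R) = disc_int nu (r + 1) (tent K k.+1%:R)) ->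
  mu K = nu K.
Proof.
move=> muf nuf cK K0 KD munu.
have rr1 : r <= r + 1 by rewrite lerDl.
have mK : measurable (K : set (borel Z)) by apply: borel_closed; exact: compact_closed_rbcm.
pose Kn (k : nat) : set (borel Z) := [set z | dist_set K z <= k.+1%:R^-1] `&` root_disc Z (r + 1).
have mKn k : measurable (Kn k).
  apply: measurableI; last exact: measurable_root_disc.
  rewrite -[X in measurable X]setTI; have /(_ measurableT) := borel_continuous (dist_set_continuous K0).
  move=> /(_ [set x | x <= k.+1%:R^-1]); apply; apply: closed_measurable; exact: closed_le.
have capK : \bigcap_k Kn k = K.
  apply/seteqP; split => z; last first.
    move=> Kz k _; split; last exact: (root_disc_sub rr1 (KD _ Kz)).
    by rewrite /= (le_trans (dist_set_le K0 z Kz))// mdistxx invr_ge0.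
  move=> zKn; apply: (compact_closed_rbcm cK) => B /nbhs_ballP[e /= e0 eB].
  have e2 : 0 < e / 3 by rewrite divr_gt0.
  have /filter_ex[k /= ke] := natSinv_small e2; have [/= zk _] := zKn k I.
  have [y Ky zy] := dist_set_attained K0 z e2; exists y; split => //; apply: eB.
  by rewrite ballEmdist /=; move: ke zk; move: (k.+1%:R^-1) => d; lra.
suff half (m1 m2 : {measure set (borel Z) -> \bar R}) : locally_finite m1 -> locally_finite m2 ->
    (forall k, disc_int m1 (r + 1) (tent K k.+1%:R) = disc_int m2 (r + 1) (tent K k.+1%:R)) ->
    (m1 K <= m2 K)%E.
  by apply/eqP; rewrite eq_le !half.
move=> m1f m2f m12.
have cv : m2 \o Kn @ \oo --> m2 K.
  rewrite -capK; apply: nonincreasing_cvg_mu => //.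
  - apply: le_lt_trans (m2f (r + 1)); apply: le_measure; rewrite ?inE//; last exact: subIsetr.
    exact: measurable_root_disc.
  - by rewrite capK.
  - move=> m n mn; apply/subsetPset => z [/= zn zr]; split => //=.
    by apply: le_trans zn _; rewrite lef_pV2 ?posrE// ler_nat.
apply: (cvge_ge _ cv); apply: nearW => k /=.
have KD1 : K `<=` root_disc Z (r + 1) by move=> z /KD; exact: root_disc_sub.
rewrite -(disc_int_indic m1f mK KD1) -(disc_int_indic m2f (mKn k) (@subIsetr _ _ _)) lee_fin.
have bb := tent_bounded_borel k K0.
apply: (@le_trans _ _ (disc_int m1 (r + 1) (tent K k.+1%:R))).
  apply: le_disc_int => //; first exact: bounded_borel_indic.
  move=> z _; rewrite indicE; have [zK|_] := boolP (z \in K); last by have /andP[] := tent_itv K k.+1%:R z.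
  by rewrite tent1//; rewrite inE in zK.
rewrite m12; apply: le_disc_int => //; first exact: bounded_borel_indic.
move=> z zr; rewrite indicE; have [_|zK] := boolP (z \in Kn k); first by have /andP[] := tent_itv K k.+1%:R z.
rewrite tent0// leNgt; apply/negP => zk; move: zK; rewrite notin_setE; apply.
by split => //=; exact: ltW.
Qed.

(** The isometry sends [x] to the limit, along an ultrafilter, of points of [Y]
    that are closer and closer to [x] in the ambient spaces; the tents around a
    compact set of [Y] extend to the ambient spaces and show that it preserves
    the masses of compact sets. *)
Lemma near_equiv kappa (hk : 0 < kappa <= 1) (X Y : rmbcmSpace R) (Z : nat -> rbcmType R)
    (f : forall n, X -> Z n) (g : forall n, Y -> Z n) :
  (forall n, rooted_isometry (f n)) -> (forall n, rooted_isometry (g n)) ->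
  (forall n, GHV_near kappa (f n) (g n) n%:R n.+1%:R^-1) -> rmbcm_equiv X Y.
Proof.
move=> fi gi fgn; have [U [UU ooU]] := nat_ultrafilter.
have fd n x y : mdist (f n x) (f n y) = mdist x y by have [_] := fi n.
have gd n x y : mdist (g n x) (g n y) = mdist x y by have [_] := gi n.
have ev_ge (c : R) := nat_ge_near c.
pose rel (x : X) (y : Y) := forall e : R, 0 < e -> U [set n | mdist (f n x) (g n y) <= e].
have rel_d x x' y y' : rel x y -> rel x' y' -> mdist y y' = mdist x x'.
  move=> xy xy'; apply/eqP; rewrite -subr_eq0 -normr_le0; apply/ler_addgt0Pl => e e0.
  have e2 : 0 < e / 2 by rewrite divr_gt0.
  have [n [/= h1 h2]] := ultra_ex2 UU (xy _ e2) (xy' _ e2).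
  have := metric_triangle (f n x) (g n y) (f n x'); have := metric_triangle (g n y) (g n y') (f n x').
  have := metric_triangle (g n y) (f n x) (g n y'); have := metric_triangle (f n x) (f n x') (g n y').
  rewrite !fd !gd (metric_sym (g n y) (f n x)) (metric_sym (g n y') (f n x')) addr0 ler_norml.
  by move=> ? ? ? ?; apply/andP; split; lra.
have rel0 : rel point point.
  move=> e e0; apply: filter_all => n /=.
  by have [-> _] := fi n; have [-> _] := gi n; rewrite mdistxx ltW.
have relX x : exists y, rel x y.
  have pick_y n : exists y, mdist point x <= n%:R -> mdist (f n x) (g n y) <= n.+1%:R^-1.
    have [xn|xn] := pselect (mdist point x <= n%:R); last by exists point.
    by have [fgx _ _] := fgn n; have [y] := fgx x xn; exists y.
  have [u uP] := choice pick_y.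
  have ux (e : R) : 0 < e -> U [set n | mdist (f n x) (g n (u n)) <= e].
    move=> e0; apply: ooU; near=> n => /=; apply: le_trans (uP n _) _; near: n; first exact: ev_ge.
    exact: natSinv_small.
  have [||y uy] := @rbcm_ultra_cvg R Y (u @ U) (mdist point x + 1); first exact: ultra_fmap.
    suff : U [set n | mdist point (u n) <= mdist point x + 1] by [].
    apply: filterS (ux 1 ltr01) => n /= nx; have := metric_triangle point (f n x) (g n (u n)).
    by rewrite (rooted_isometry_height (fi n)) (rooted_isometry_height (gi n)); lra.
  exists y => e e0; have e2 : 0 < e / 2 by rewrite divr_gt0.
  have uy' : U [set n | mdist y (u n) <= e / 2] by exact: (uy _ e2).
  apply: filterS2 (ux _ e2) uy' => n /= h1 h2; have := metric_triangle (f n x) (g n (u n)) (g n y).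
  by rewrite gd (metric_sym (u n)); lra.
have relY y : exists x, rel x y.
  have pick_x n : exists x, mdist point y <= n%:R -> mdist (f n x) (g n y) <= n.+1%:R^-1.
    have [yn|yn] := pselect (mdist point y <= n%:R); last by exists point.
    by have [_ gfy _] := fgn n; have [x] := gfy y yn; exists x.
  have [u uP] := choice pick_x.
  have uy (e : R) : 0 < e -> U [set n | mdist (f n (u n)) (g n y) <= e].
    move=> e0; apply: ooU; near=> n => /=; apply: le_trans (uP n _) _; near: n; first exact: ev_ge.
    exact: natSinv_small.
  have [||x ux] := @rbcm_ultra_cvg R X (u @ U) (mdist point y + 1); first exact: ultra_fmap.
    suff : U [set n | mdist point (u n) <= mdist point y + 1] by [].
    apply: filterS (uy 1 ltr01) => n /= ny; have := metric_triangle point (g n y) (f n (u n)).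
    by rewrite (rooted_isometry_height (fi n)) (rooted_isometry_height (gi n)) (metric_sym (g n y)); lra.
  exists x => e e0; have e2 : 0 < e / 2 by rewrite divr_gt0.
  have ux' : U [set n | mdist x (u n) <= e / 2] by exact: (ux _ e2).
  apply: filterS2 (uy _ e2) ux' => n /= h1 h2; have := metric_triangle (f n x) (f n (u n)) (g n y).
  by rewrite fd; lra.
have [h hP] := choice relX.
have hi : rooted_isometry h.
  split=> [|x x']; last by apply: rel_d.
  by apply: mdist_positivity; rewrite (rel_d point point _ _ (hP _) rel0) mdistxx.
have hsurj y : exists x, h x = y.
  have [x xy] := relY y; exists x; apply: mdist_positivity.
  by rewrite (rel_d x x _ _ (hP _) xy) mdistxx.
have lX := @rmbcm_locally_finite _ X; have lY := @rmbcm_locally_finite _ Y.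
have lXh := isom_locally_finite hi lX.
(* on a disc, the convergence that defines h is uniform *)
have unif (r e : R) : 0 < e -> U [set n | forall x, mdist point x <= r -> mdist (f n x) (g n (h x)) <= e].
  move=> e0; have e3 : 0 < e / 3 by rewrite divr_gt0.
  have [N [w wP]] := @rbcm_net R X r _ e3.
  have : U [set n | forall i, (i < N)%N -> mdist (f n (w i)) (g n (h (w i))) <= e / 3].
    by apply: filter_fin => i _; exact: hP.
  apply: filterS => n /= nw x xr; have [i iN ix] := wP x xr; have := nw i iN.
  have := metric_triangle (f n x) (f n (w i)) (g n (h x)).
  have := metric_triangle (f n (w i)) (g n (h (w i))) (g n (h x)).
  by rewrite fd gd (metric_sym x); have [_ ->] := hi; lra.
have tents (K : set Y) r k : K !=set0 -> 0 <= r -> K `<=` root_disc Y r ->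
    disc_int (isom_measure (rmbcm_measure X) hi) (r + 1) (tent K k.+1%:R) =
    disc_int (rmbcm_measure Y) (r + 1) (tent K k.+1%:R).
  move=> K0 r0 KD; set L : R := k.+1%:R; have L1 : 1 <= L by rewrite ler1n.
  have L0 : 0 < L by apply: lt_le_trans L1.
  have bK := tent_bounded_borel k K0; rewrite -/L in bK.
  rewrite (isom_disc_int hi _ lX bK).
  apply/eqP; rewrite -subr_eq0 -normr_le0; apply/ler_addgt0Pl => e e0; rewrite addr0.
  pose M := disc_mass (rmbcm_measure X) (r + 1); have M0 : 0 <= M by exact: disc_mass_ge0.
  pose eta := e / 2 / (L * (M + 1)); have eta0 : 0 < eta.
    by rewrite !divr_gt0// mulr_gt0// ltr_wpDl.
  have [n [/= nunif [nr nL]]] := ultra_ex2 UU (unif (r + 1) _ eta0)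
    (ooU _ (filterI (ev_ge (r + 1)) (natSinv_small (divr_gt0 (divr_gt0 e0 (ltr0n R 2)) L0)))).
  pose H := tent (g n @` K) L.
  have gK0 : g n @` K !=set0 by have [y Ky] := K0; exists (g n y), y.
  have gKD : g n @` K `<=` root_disc (Z n) r.
    by move=> _ [y Ky <-]; rewrite /root_disc /mdisc /= (rooted_isometry_height (gi n)); exact: KD.
  have bH : bounded_borel H by exact: tent_bounded_borel.
  have H0 z : r + 1 < mdist point z -> H z = 0 by exact: tent_support.
  have tH := holder_test L1 (tent_norm _ _) (tent_holder gK0 hk L1).
  have [_ _ /(_ _ tH)] := fgn n; rewrite -/H.
  have bHf := bounded_borel_comp (fi n) bH; have bHg := bounded_borel_comp (gi n) bH.
  rewrite -[(fun z => L^-1 * H z) \o f n]/(fun x => L^-1 * (H \o f n) x).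
  rewrite -[(fun z => L^-1 * H z) \o g n]/(fun x => L^-1 * (H \o g n) x).
  rewrite (disc_intZ lX _ _ bHf) (disc_intZ lY _ _ bHg).
  rewrite (disc_int_support lX nr bHf); last by move=> x xr; apply: H0; rewrite (rooted_isometry_height (fi n)).
  rewrite (disc_int_support lY nr bHg); last by move=> x xr; apply: H0; rewrite (rooted_isometry_height (gi n)).
  have HgE : H \o g n = tent K L by apply/funext => y; exact: tent_isom.
  rewrite HgE -mulrBr normrM ger0_norm ?invr_ge0 ?(ltW L0)// mulrC ler_pdivrMr// => near_n.
  have /near_n I1 z : n%:R < mdist point z -> L^-1 * H z = 0.
    by move=> nz; rewrite H0 ?mulr0//; exact: le_lt_trans nz.
  have I2 : n.+1%:R^-1 * L <= e / 2 by rewrite -ler_pdivlMr.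
  have bKh := bounded_borel_comp hi bK.
  have I3 : `|disc_int (rmbcm_measure X) (r + 1) (tent K L \o h) -
              disc_int (rmbcm_measure X) (r + 1) (H \o f n)| <= e / 2.
    rewrite -disc_intB//.
    apply: (@le_trans _ _ ((L * eta) * M)).
      apply: disc_int_bound => // [|x xr].
        by apply: bounded_borelD => //; exact: bounded_borelN.
      rewrite /= -HgE /=; apply: le_trans (tent_lip gK0 _ _ (ltW L0)) _.
      by rewrite ler_wpM2l ?(ltW L0)// metric_sym nunif.
    have -> : L * eta * M = e / 2 * (M / (M + 1)).
      by rewrite /eta invfM (mulrCA _ L^-1) !mulrA mulfV ?gt_eqF// mul1r mulrAC.
    by apply: ler_piMr; [rewrite ltW// divr_gt0|rewrite ler_pdivrMr ?ltr_wpDl// mul1r lerDl].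
  rewrite (splitr e); apply: le_trans (ler_distD (disc_int (rmbcm_measure X) (r + 1) (H \o f n)) _ _) _.
  by apply: lerD => //; exact: le_trans I1 I2.
have compact_eq (K : set Y) : compact K -> rmbcm_measure X (h @^-1` K) = rmbcm_measure Y K.
  move=> cK; have [K0|K0] := pselect (K !=set0); last first.
    have -> : K = set0 by apply/seteqP; split => // y Ky; apply: K0; exists y.
    by rewrite preimage_set0 !measure0.
  have [r r0 rP] := compact_in_disc cK.
  rewrite -[LHS]/(isom_measure (rmbcm_measure X) hi K).
  by apply: (@compact_mass_eq Y _ _ K r) => // k; exact: tents.
exists h; split => //; first by move=> y _; have [x <-] := hsurj y; exists x.
have hc : continuous h.
  move=> x B /nbhs_ballP[e /= e0 eB]; apply/nbhs_ballP; exists e => //= x'.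
  by rewrite ballEmdist /= => xx'; apply: eB; rewrite ballEmdist /=; have [_ ->] := hi.
have hinj x x' : h x = h x' -> x = x'.
  by move=> hxx'; apply: mdist_positivity; have [_ <-] := hi; rewrite hxx' mdistxx.
move=> A mA; have mhA : measurable (h @^-1` A : set (borel X)).
  by rewrite -[X in measurable X]setTI; exact: isometry_measurable.
have [_ rX] := rmbcm_radon X; have [_ rY] := rmbcm_radon Y.
rewrite /rmbcm_pushforward /pushforward; apply/eqP; rewrite eq_le; apply/andP; split.
  rewrite rX//; apply: ge_ereal_sup => _ [K [cK KA] <-].
  have KE : h @^-1` (h @` K) = K.
    by apply/seteqP; split => x; [move=> [x' Kx' /hinj <-]|exists x].
  have chK : compact (h @` K).
    by apply: continuous_compact => //; exact: continuous_subspaceT.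
  rewrite -KE compact_eq//; apply: le_measure; rewrite ?inE//.
    by apply: borel_closed; exact: compact_closed_rbcm.
  by move=> _ [x Kx <-]; exact: KA.
rewrite rY//; apply: ge_ereal_sup => _ [K [cK KA] <-].
rewrite -compact_eq//; apply: le_measure; rewrite ?inE//.
  rewrite -[X in measurable X]setTI; apply: (isometry_measurable hi) => //.
  by apply: borel_closed; exact: compact_closed_rbcm.
by move=> x; exact: KA.
Unshelve. all: by end_near.
Qed.

(** Distance 0 gives nearness at every scale, in an ambient space that depends
    on the scale. *)
Lemma GHV0_equiv kappa (hk : 0 < kappa <= 1) (X Y : rmbcmSpace R) :
  GHV_dist kappa X Y = 0%E -> rmbcm_equiv X Y.
Proof.
move=> d0.
pose P := {Z : rbcmType R & ((X -> Z) * (Y -> Z))%type}.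
have /choice[p pP] : forall n : nat, exists p : P, [/\ rooted_isometry (projT2 p).1, rooted_isometry (projT2 p).2 &
    GHV_near kappa (projT2 p).1 (projT2 p).2 n%:R n.+1%:R^-1].
  move=> n; pose e : R := n.+1%:R^-1 / 2.
  have e01 : 0 < e <= 1.
    rewrite divr_gt0 ?invr_gt0//= ler_pdivrMr// mul1r.
    by apply: (@le_trans _ _ 1); rewrite ?ler1n// invf_le1// ler1n.
  have : (GHV_dist kappa X Y < (e * expR (- (n%:R + 1)) / 2)%:E)%E.
    by rewrite d0 lte_fin divr_gt0// mulr_gt0 ?expR_gt0//; case/andP: e01.
  move=> /GHV_lt[Z [f [g [fi gi dfg]]]]; exists (existT _ Z (f, g)); split => //=.
  have := dist_in_near hk fi gi (ler0n R n) e01 dfg.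
  by rewrite mulrC divrK// unitfE.
apply: (near_equiv hk (f := fun n => (projT2 (p n)).1) (g := fun n => (projT2 (p n)).2)) => n;
  by have [] := pP n.
Qed.

Lemma rmbcm_equiv_refl (X : rmbcmSpace R) : rmbcm_equiv X X.
Proof. by exists id; split. Qed.

Lemma equiv_GHV0 kappa (hk : 0 < kappa <= 1) (X Y : rmbcmSpace R) : rmbcm_equiv X Y -> GHV_dist kappa X Y = 0%E.
Proof.
move=> [h [hi hs hA]]; apply/eqP; rewrite eq_le GHV_ge0 andbT.
have idi : rooted_isometry (id : Y -> Y) by [].
apply: le_trans (GHV_dist_le kappa hi idi) _; rewrite (dist_inE kappa hi idi).
have H0 r : Hdisc h (id : Y -> Y) r = 0%E.
  rewrite /Hdisc (_ : range h = range (id : Y -> Y)) ?hausdorffxx//.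
  by apply/seteqP; split => y; [exists y|move=> _; have [x _ <-] := hs y I; exists x].
have lX := @rmbcm_locally_finite _ X; have lY := @rmbcm_locally_finite _ Y.
have B0 r : Bdisc kappa hi idi r = 0%E.
  apply/eqP; rewrite eq_le Bdisc_ge0 andbT.
  apply: (BLdisc_le hk (isom_locally_finite hi lX) (isom_locally_finite idi lY)) => phi tphi.
  rewrite /disc_int (_ : (\int[_]_(_ in _) _)%E = (\int[isom_measure (rmbcm_measure Y) idi]_(z in root_disc Y r) (phi z)%:E)%E).
    by rewrite subrr normr0.
  by apply: eq_measure_integral => A mA _; exact: hA.
have avg0 (delta : R -> \bar R) : (forall r, delta r = 0)%E -> exp_average delta = 0%E.
  move=> d0; rewrite /exp_average integral0_eq// => r _; rewrite d0.
  by rewrite (min_idPr _) ?mule0 ?lee01.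
by rewrite !avg0// maxxx.
Qed.

End tent.

(** * Regularity of locally finite Borel measures *)

Section regularity.
Variables (R : realType) (Z : rbcmType R) (nu : {measure set (borel Z) -> \bar R}).
Hypothesis nuT : (nu setT < +oo)%E.

Let nu_fin (A : set (borel Z)) : measurable A -> (nu A < +oo)%E.
Proof. by move=> mA; apply: le_lt_trans nuT; apply: le_measure; rewrite ?inE. Qed.

Definition regular (A : set (borel Z)) := forall e : R, 0 < e -> exists F G : set Z,
  [/\ closed F, open G, F `<=` A, A `<=` G & (nu (G `\` F) <= e%:E)%E].

Let vanish (B : nat -> set (borel Z)) (e : R) : (forall n, measurable (B n)) ->
  (forall n m, (n <= m)%N -> B m `<=` B n) -> (nu (\bigcap_n B n) <= (e / 2)%:E)%E -> 0 < e ->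
  exists n, (nu (B n) <= e%:E)%E.
Proof.
move=> mB decB capB e0.
have mcap : measurable (\bigcap_n B n) by exact: bigcapT_measurable.
have cv : nu \o B @ \oo --> nu (\bigcap_n B n).
  apply: nonincreasing_cvg_mu => //; first exact: nu_fin.
  by move=> n m nm; apply/subsetPset; exact: decB.
have nb : nbhs (nu (\bigcap_n B n)) [set x | (x < e%:E)%E].
  apply: open_nbhs_nbhs; split; first exact: open_ereal_lt_ereal.
  by apply: le_lt_trans capB _; rewrite lte_fin ltr_pdivrMr// ltr_pMr// ltr1n.
have /filter_ex[n /= /ltW] : \forall n \near \oo, (nu (B n) < e%:E)%E by exact: (cv _ nb).
by exists n.
Qed.

Let regularC A : regular A -> regular (~` A).
Proof.
move=> rA e e0; have [F [G [cF oG FA AG FG]]] := rA e e0.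
exists (~` G), (~` F); split.
- exact: open_closedC.
- exact: closed_openC.
- exact: subsetC.
- exact: subsetC.
- by rewrite (_ : _ `\` _ = G `\` F)// !setDE setCK setIC.
Qed.

Let regular_open (A : set Z) : open A -> regular A.
Proof.
move=> oA e e0; have [C0|C0] := pselect (~` A !=set0); last first.
  have AT : A = setT by apply/seteqP; split => // z _; apply: contrapT => nAz; apply: C0; exists z.
  exists setT, setT; rewrite AT; split=> //; first exact: openT.
  by rewrite setDv measure0 lee_fin ltW.
pose F (k : nat) := [set z | k.+1%:R^-1 <= dist_set (~` A) z].
have cF k : closed (F k).
  rewrite (_ : F k = dist_set (~` A) @^-1` [set x | k.+1%:R^-1 <= x])//.
  by apply: closed_comp; [move=> z _; exact: dist_set_continuous|exact: closed_ge].
have FA k : F k `<=` A.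
  move=> z Fz; apply: contrapT => nAz; move: Fz; rewrite /F /=.
  by move=> /le_trans/(_ (dist_set_le C0 z nAz)); rewrite mdistxx leNgt invr_gt0 ltr0n.
have [|n m nm z [Az nFz]|||k kP] := @vanish (fun k => A `\` F k) e.
- by move=> k; apply: measurableD; [exact: borel_open|exact: borel_closed].
- split => // Fz; apply: nFz; rewrite /F /=; apply: le_trans Fz.
  by rewrite lef_pV2 ?posrE// ler_nat.
- rewrite (_ : \bigcap_n _ = set0); first by rewrite measure0 lee_fin divr_ge0// ltW.
  apply/seteqP; split => // z zAF; have [Az _] := zAF 0%N I.
  move: oA; rewrite openE => /(_ z Az)/nbhs_ballP[d /= d0 dA].
  have /filter_ex[k /= kd] := natSinv_small d0; have [_] := zAF k I; apply.
  rewrite /F /=; apply: le_trans kd _; apply: le_dist_set => // y nAy.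
  by rewrite leNgt; apply/negP => zy; apply: nAy; apply: dA; rewrite ballEmdist.
- exact: e0.
by exists (F k), A; split => //; exact: FA.
Qed.

Let regular_bigcup (A : nat -> set (borel Z)) : (forall n, regular (A n)) -> regular (\bigcup_n A n).
Proof.
move=> rA e e0; have e2 : 0 < e / 2 by rewrite divr_gt0.
have en n : 0 < e / 2 / (2 ^ n.+1)%:R by rewrite divr_gt0// ltr0n expn_gt0.
have /choice[F /choice[G FGP]] : forall n, exists F G : set Z, [/\ closed F, open G, F `<=` A n, A n `<=` G &
  (nu (G `\` F) <= (e / 2 / (2 ^ n.+1)%:R)%:E)%E] by move=> n; exact: rA.
have mG n : measurable (G n : set (borel Z)) by have [] := FGP n => *; exact: borel_open.
have mF n : measurable (F n : set (borel Z)) by have [] := FGP n => *; exact: borel_closed.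
pose FN N := \bigcup_(i < N) F i.
have cFN N : closed (FN N).
  by apply: closed_bigcup => // i _; have [] := FGP i.
have mGF n : measurable (G n `\` F n : set (borel Z)) by exact: measurableD.
have [|n m nm z [Gz nFz]|||N NP] := @vanish (fun N => \bigcup_n G n `\` FN N) e.
- by move=> N; apply: measurableD; [exact: bigcupT_measurable|exact: borel_closed].
- split => // -[i /= iN Fiz]; apply: nFz; exists i => //=; exact: leq_trans nm.
- apply: (@le_trans _ _ (nu (\bigcup_n (G n `\` F n)))).
    apply: le_measure; rewrite ?inE.
    + apply: bigcapT_measurable => N; apply: measurableD; [exact: bigcupT_measurable|exact: borel_closed].
    + exact: bigcupT_measurable.
    move=> z zP; have [[n _ Gnz] _] := zP 0%N I; exists n => //; split => // Fnz.
    by have [_] := zP n.+1 I; apply; exists n => /=.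
  have mU : measurable (\bigcup_n (G n `\` F n) : set (borel Z)) by exact: bigcupT_measurable.
  apply: le_trans (measure_sigma_subadditive nu mGF mU (@subset_refl _ _)) _.
  apply: le_trans (epsilon_trick0 xpredT (ltW e2)).
  by apply: lee_nneseries => [n _|n _] //; have [] := FGP n.
- exact: e0.
exists (FN N), (\bigcup_n G n); split => //.
- by apply: bigcup_open => n _; have [] := FGP n.
- by move=> z [i _ Fiz]; exists i => //; have [_ _ FA _ _] := FGP i; exact: FA.
- by move=> z [i _ Aiz]; exists i => //; have [_ _ _ AG _] := FGP i; exact: AG.
Qed.

(** The regular sets form a sigma-algebra that contains the open sets. *)
Lemma finite_regular (A : set (borel Z)) : measurable A -> regular A.
Proof.
move=> mA; apply: (@smallest_sub _ (sigma_algebra setT) (@open Z) regular _ _ A mA); last exact: regular_open.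
split=> [|B rB|B rB]; last exact: regular_bigcup.
- by apply: regular_open; exact: open0.
- by rewrite setTD; exact: regularC.
Qed.

End regularity.

(** The inner approximation by closed sets becomes one by compact sets after
    restriction to a large disc. *)
Lemma locally_finite_radon (R : realType) (Z : rbcmType R) (mu : {measure set (borel Z) -> \bar R}) :
  locally_finite mu -> radon mu.
Proof.
move=> muf; split=> [K cK|A mA].
  have [r r0 rP] := compact_in_disc cK; apply: le_lt_trans (muf r).
  apply: le_measure; rewrite ?inE//; last exact: measurable_root_disc.
  by apply: borel_closed; exact: compact_closed_rbcm.
apply/eqP; rewrite eq_le; apply/andP; split; last first.
  apply: ge_ereal_sup => _ [K [cK KA] <-]; apply: le_measure; rewrite ?inE//.
  by apply: borel_closed; exact: compact_closed_rbcm.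
set S := ereal_sup _.
have mAn (n : nat) : measurable (A `&` root_disc Z n%:R) by apply: measurableI => //; exact: measurable_root_disc.
have cv : mu \o (fun n : nat => A `&` root_disc Z n%:R) @ \oo --> mu A.
  rewrite [X in _ --> mu X](_ : A = \bigcup_n (A `&` root_disc Z n%:R)); last first.
    apply/seteqP; split => [z Az|z [n _ []]//].
    by exists (Num.truncn (mdist (point : Z) z)).+1 => //; split => //; exact/ltW/truncnS_gt.
  apply: nondecreasing_cvg_mu => //; first exact: bigcupT_measurable.
  move=> n m nm; apply/subsetPset; apply: setIS; apply: root_disc_sub.
  by rewrite ler_nat.
apply: (cvge_le _ cv); apply: nearW => n /=; apply/lee_addgt0Pr => e e0.
pose nu := mrestr mu (measurable_root_disc Z n%:R).
have nuT : (nu setT < +oo)%E by rewrite /nu /mrestr setTI.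
have [F [G [cF oG FA AG FGe]]] := finite_regular nuT (mAn n) e0.
have cK : compact F.
  apply: boundedly_compact => //; exists point, n%:R => z Fz.
  by have [_] := FA z Fz.
have mF : measurable (F : set (borel Z)) by exact: borel_closed.
have mG : measurable (G : set (borel Z)) by exact: borel_open.
apply: (@le_trans _ _ (mu F + nu (G `\` F))%E); last first.
  apply: leeD => //; apply: ereal_sup_ubound; exists F => //; split => // z /FA[].
  by [].
apply: le_trans (_ : (mu (F `|` ((G `\` F) `&` root_disc Z n%:R)) <= _)%E); last first.
  apply: measureU2 => //; apply: measurableI; [exact: measurableD|exact: measurable_root_disc].
apply: le_measure; rewrite ?inE//.
  by apply: measurableU => //; apply: measurableI; [exact: measurableD|exact: measurable_root_disc].
move=> z Az; have [Fz|nFz] := pselect (F z); first by left.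
by right; split; [split => //; exact: AG|case: Az].
Qed.

(** * Vague limits along an ultrafilter *)

Section partition_integral.
Context d (T : measurableType d) (R : realType) (mu : {measure set T -> \bar R}).
Variables (D : set T) (mD : measurable D) (muD : (mu D < +oo)%E).

Lemma bounded_integrable (f : T -> R) (C : R) : measurable_fun D f -> (forall x, D x -> `|f x| <= C) ->
  mu.-integrable D (EFin \o f).
Proof.
move=> mf fC; apply: measurable_bounded_integrable => //.
exists C; split; first exact: num_real.
by move=> M CM x Dx; apply: le_trans (fC x Dx) (ltW CM).
Qed.

Lemma Rintegral_close (f g : T -> R) (C e : R) : measurable_fun D f -> measurable_fun D g ->
  (forall x, D x -> `|f x| <= C) -> (forall x, D x -> `|f x - g x| <= e) ->
  `|Rintegral mu D f - Rintegral mu D g| <= e * fine (mu D).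
Proof.
move=> mf mg fC fg.
have If := bounded_integrable mf fC.
have gC x : D x -> `|g x| <= C + e.
  move=> Dx; rewrite -(subrK (f x) (g x)) addrC (le_trans (ler_normD _ _))// lerD ?fC//.
  by rewrite distrC fg.
have Ig := bounded_integrable mg gC.
rewrite -RintegralB// ler_norml -mulNr -!Rintegral_cst//.
have ce (c : R) : mu.-integrable D (EFin \o (fun=> c)) by apply: (@bounded_integrable _ `|c|).
have Ifg : mu.-integrable D (EFin \o (fun x => f x - g x)).
  by apply: (@bounded_integrable _ e) => //; exact: measurable_funB.
by apply/andP; split; apply: le_Rintegral => // x Dx; have := fg x Dx; rewrite ler_norml => /andP[].
Qed.

Lemma Rintegral_partition (J : T -> nat) (g : nat -> R) (P : nat) :
  (forall j, measurable (D `&` [set x | J x = j])) -> (forall x, D x -> (J x < P)%N) ->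
  measurable_fun D (g \o J) /\
  Rintegral mu D (g \o J) = \sum_(j < P) g j * fine (mu (D `&` [set x | J x = j])).
Proof.
move=> mJ JP.
have mlt (Q : nat) : measurable (D `&` [set x | (J x < Q)%N]).
  rewrite (_ : _ `&` _ = \bigcup_(j in [set j | (j < Q)%N]) (D `&` [set x | J x = j])).
    by apply: bigcup_measurable => j _.
  by apply/seteqP; split => [x [Dx xQ]|x [j /= jQ [Dx /= xj]]]; [exists (J x)|rewrite xj].
have mg : measurable_fun D (g \o J).
  move=> _ B mB; rewrite (_ : _ `&` _ = \bigcup_(j in [set j | B (g j)]) (D `&` [set x | J x = j])).
    by apply: bigcup_measurable => j _.
  by apply/seteqP; split => [x [Dx xB]|x [j /= jB [Dx /= xj]]]; [exists (J x)|rewrite xj].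
split => //.
have Ig : mu.-integrable D (EFin \o (g \o J)).
  apply: (@bounded_integrable _ (\sum_(j < P) `|g j|)) => // x Dx.
  rewrite (bigD1 (Ordinal (JP x Dx)))//= lerDl sumr_ge0//.
have -> : D = D `&` [set x | (J x < P)%N].
  by apply/seteqP; split => [x Dx|x []//]; split => //; exact: JP.
have H : forall Q : nat, Rintegral mu (D `&` [set x | (J x < Q)%N]) (g \o J) =
    \sum_(j < Q) g j * fine (mu (D `&` [set x | J x = j])).
  elim=> [|Q IH].
    rewrite big_ord0 (_ : _ `&` _ = set0) ?Rintegral_set0//.
    by apply/seteqP; split => // x [].
  rewrite big_ord_recr /= -IH.
  have -> : D `&` [set x | (J x < Q.+1)%N] =
      (D `&` [set x | (J x < Q)%N]) `|` (D `&` [set x | J x = Q]).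
    apply/seteqP; split => [x [Dx /=]|x [[Dx /= xQ]|[Dx /= ->]]].
    - by rewrite ltnS leq_eqVlt => /orP[/eqP xQ|xQ]; [right|left].
    - by split => //=; rewrite ltnS ltnW.
    - by split => //=.
  rewrite Rintegral_setU//; last 2 first.
  - by apply: integrableS Ig => //; [exact: measurableU|move=> x [|] []].
  - rewrite disj_set2E; apply/eqP/seteqP; split => // x [[_ /= xQ] [_ /= E]].
    by rewrite E ltnn in xQ.
  congr (_ + _); rewrite -Rintegral_cst//; apply: eq_Rintegral => x; rewrite inE => -[_ /= <-].
  by [].
rewrite H; apply: eq_bigr => j _; congr (_ * fine (mu _)).
by apply/seteqP; split => [x [Dx xj]|x [[Dx _] xj]]; split => //; split => //; exact: JP.
Qed.

End partition_integral.

Lemma ulimZ (R : realType) (T : Type) (F : set_system T) (FU : UltraFilter F) (c : R) (x : T -> R) :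
  ubounded F x -> ulim F (fun t => c * x t) = c * ulim F x.
Proof.
move=> bx; have bcx : ubounded F (fun t => c * x t).
  move: bx => [M xM]; exists (`|c| * M); apply: filterS xM => t /= h.
  by rewrite normrM ler_wpM2l.
apply/eqP; rewrite -subr_eq0 -normr_le0; apply/ler_addgt0Pl => e e0; rewrite addr0.
have e2 : 0 < e / 2 by rewrite divr_gt0.
have ec : 0 < e / 2 / (`|c| + 1) by rewrite divr_gt0// ltr_wpDl.
have [t [/= h1 h2]] := ultra_ex2 FU (ulimP FU bcx e2) (ulimP FU bx ec).
rewrite (splitr e) distrC; apply: le_trans (ler_distD (c * x t) _ _) _; apply: lerD => //.
rewrite -mulrBr normrM distrC; apply: (@le_trans _ _ (`|c| * (e / 2 / (`|c| + 1)))).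
  by rewrite ler_wpM2l.
rewrite mulrCA; apply: ler_piMr; first exact: ltW.
by rewrite ler_pdivrMr ?ltr_wpDl// mul1r lerDl.
Qed.

Lemma ulim_sum (R : realType) (T : Type) (F : set_system T) (FU : UltraFilter F) (P : nat)
    (g : nat -> R) (x : nat -> T -> R) : (forall j, ubounded F (x j)) ->
  ubounded F (fun t => \sum_(j < P) g j * x j t) /\
  ulim F (fun t => \sum_(j < P) g j * x j t) = \sum_(j < P) g j * ulim F (x j).
Proof.
move=> bx; elim: P => [|P [IHb IH]].
  split; first by exists 0; apply: filter_all => t /=; rewrite big_ord0 normr0.
  by rewrite big_ord0; apply: ulim_cst => //; apply: filter_all => t /=; rewrite big_ord0.
have bgx : ubounded F (fun t => g P * x P t).
  move: (bx P) => [M xM]; exists (`|g P| * M); apply: filterS xM => t /= h.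
  by rewrite normrM ler_wpM2l.
have E : (fun t => \sum_(j < P.+1) g j * x j t) = (fun t => \sum_(j < P) g j * x j t + g P * x P t).
  by apply/funext => t; rewrite big_ord_recr.
rewrite E; split.
  move: IHb bgx => [M xM] [N xN]; exists (M + N); apply: filterS2 xM xN => t /= ? ?.
  by rewrite (le_trans (ler_normD _ _))// lerD.
by rewrite ulimD// IH ulimZ// [RHS]big_ord_recr.
Qed.

Lemma ulim_close (R : realType) (T : Type) (F : set_system T) (FU : UltraFilter F) (x y : T -> R) e :
  ubounded F x -> ubounded F y -> F [set t | `|x t - y t| <= e] -> `|ulim F x - ulim F y| <= e.
Proof.
move=> bx yb xy; apply/ler_addgt0Pl => d d0; have d2 : 0 < d / 2 by rewrite divr_gt0.
have [t [/= h1 h2 h3]] := ultra_ex3 FU (ulimP FU bx d2) (ulimP FU yb d2) xy.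
by move: h1 h2 h3; rewrite !ler_norml => /andP[? ?] /andP[? ?] /andP[? ?]; apply/andP; split; lra.
Qed.

Section vague_limit.
Variables (R : realType) (Z : rbcmType R) (U : set_system nat) (UU : UltraFilter U).
Variable nu : nat -> {measure set (borel Z) -> \bar R}.
Hypothesis nuf : forall n, locally_finite (nu n).
Hypothesis ooU : \oo `<=` U.
Hypothesis nub : forall r, exists M, U [set n | disc_mass (nu n) r <= M].

Let rad (z : Z) : R := mdist (point : Z) z.

Let net (m : nat) : exists nx : nat * (nat -> Z), forall z,
  rad z <= m%:R -> exists2 i, (i < nx.1)%N & mdist (nx.2 i) z <= m.+1%:R^-1.
Proof.
have [|n [x xP]] := @rbcm_net R Z m%:R m.+1%:R^-1; first by rewrite invr_gt0.
by exists (n, x).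
Qed.

Let nx := projT1 (choice net).

Let nxP m z : rad z <= m%:R -> exists2 i, (i < (nx m).1)%N & mdist ((nx m).2 i) z <= m.+1%:R^-1.
Proof. exact: (projT2 (choice net) m z). Qed.

(** The balls of the nets, in one sequence; they separate the points. *)
Let A (k : nat) : set Z := if unpickle k is Some (m, i) then
  [set z | mdist ((nx m).2 i) z <= m.+1%:R^-1] else set0.

Let mA k : measurable (A k : set (borel Z)).
Proof.
rewrite /A; case: (unpickle k) => [[m i]|]; last exact: measurable0.
by apply: borel_closed; exact: closed_mdisc.
Qed.

(** The integral part of the distance to the root, followed by the bits that
    tell which of the first [k] balls contain the point.  The whole word is read as
    one integer, so that the codes of length [k + 1] that extend [j] are [2 j] and
    [2 j + 1]. *)
Let code := fix code (k : nat) (z : Z) : nat :=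
  if k is k'.+1 then (`[< A k' z >] + (code k' z).*2)%N else Num.truncn (rad z).

Let code_half k z : (code k.+1 z)./2 = code k z.
Proof. by rewrite /= half_bit_double. Qed.

Let code_odd k z : odd (code k.+1 z) = `[< A k z >].
Proof. by rewrite /= oddD odd_double addbF; case: `[< _ >]. Qed.

Let code_lt_double k j z : (code k.+1 z < j.*2)%N = (code k z < j)%N.
Proof. by rewrite -ltn_half_double code_half. Qed.

Let code_lt_exp k j z : (code k z < 2 ^ k * j)%N = (code 0 z < j)%N.
Proof.
elim: k j => [|k IH] j; first by rewrite mul1n.
by rewrite expnS -mulnA mul2n code_lt_double IH.
Qed.

Let code0_le k z : (code 0 z <= code k z)%N.
Proof.
elim: k => [//|k IH]; apply: leq_trans IH _; rewrite -code_half.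
by rewrite -{2}[code k.+1 z]odd_double_half -addnn addnA leq_addl.
Qed.

Let code_prefix k l z w : code (l + k) z = code (l + k) w -> code k z = code k w.
Proof. by elim: l => [//|l IH] zw; apply: IH; rewrite -(code_half (l + k) z) -(code_half (l + k) w); congr half. Qed.

Let E k j : set (borel Z) := [set z | code k z = j].
Let H k j : set (borel Z) := [set z | (code k z < j)%N].

Let mE k j : measurable (E k j).
Proof.
elim: k j => [|k IH] j.
  rewrite (_ : E 0 j = root_disc Z j.+1%:R `&` [set z | j%:R <= rad z] `&` ~` [set z | j.+1%:R <= rad z]).
    have mge (c : R) : measurable ([set z | c <= rad z] : set (borel Z)).
      apply: borel_closed; apply: (@closed_comp _ _ rad [set x | c <= x]); last exact: closed_ge.
      by move=> z _; exact: mdist_continuous.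
    apply: measurableI; last by apply: measurableC.
    by apply: measurableI => //; exact: measurable_root_disc.
  apply/seteqP; split => z.
    rewrite /E /= => <-; have /andP[h1 h2] := truncn_itv (mdist_ge0 (point : Z) z).
    split; last by apply/negP; rewrite -ltNge.
    by split => //; exact: ltW.
  move=> [[_ /= h1] /= /negP]; rewrite -ltNge => h2.
  by apply: truncn_def; rewrite h1.
rewrite (_ : E k.+1 j = E k j./2 `&` (if odd j then A k else ~` A k)).
  by apply: measurableI => //; case: (odd j) => //; apply: measurableC.
apply/seteqP; split => z.
  rewrite /E /= => <-; rewrite half_bit_double; split => //.
  by rewrite oddD odd_double addbF; case: asboolP.
rewrite /E /= => -[-> zj]; rewrite -[RHS]odd_double_half; congr (nat_of_bool _ + _)%N.
by case: (odd j) zj => zj; apply/asboolP.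
Qed.

Let mH k j : measurable (H k j).
Proof.
rewrite (_ : H k j = \bigcup_(i in [set i | (i < j)%N]) E k i).
  by apply: bigcup_measurable => i _; exact: mE.
by apply/seteqP; split => z; [exists (code k z)|move=> [i /= ij]; rewrite /E /= => zi; rewrite /H /= zi].
Qed.

Let H_disc k j : H k j `<=` root_disc Z j%:R.
Proof.
move=> z zj; have : (code 0 z < j)%N by apply: leq_ltn_trans (code0_le k z) zj.
rewrite /= => zj0; apply: ltW; apply: lt_le_trans (truncnS_gt _) _.
by rewrite ler_nat.
Qed.

Let m n (B : set (borel Z)) : R := fine (nu n B).

Let fin_sub n (B : set (borel Z)) j : measurable B -> B `<=` root_disc Z j -> nu n B \is a fin_num.
Proof.
move=> mB Bj; rewrite ge0_fin_numE//; apply: le_lt_trans (nuf n j).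
by apply: le_measure; rewrite ?inE//; exact: measurable_root_disc.
Qed.

Let m_le n (B C : set (borel Z)) j : measurable B -> measurable C -> B `<=` C -> C `<=` root_disc Z j -> m n B <= m n C.
Proof.
move=> mB mC BC Cj; apply: fine_le; [exact: fin_sub (subset_trans BC Cj)|exact: fin_sub Cj|].
by apply: le_measure; rewrite ?inE.
Qed.

Let E_H k j : E k j `<=` H k j.+1.
Proof. by move=> z; rewrite /E /H /= => ->. Qed.

Let m_bounded B j : measurable B -> B `<=` root_disc Z j -> ubounded U (fun n => m n B).
Proof.
move=> mB Bj; have [M UM] := nub j; exists M; apply: filterS UM => n /= nM.
rewrite ger0_norm ?fine_ge0//; apply: le_trans nM.
by apply: (m_le _ mB _ Bj (@subset_refl _ _)); exact: measurable_root_disc.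
Qed.

(** The limit of the masses of the points with code less than [j]: the end points of
    the pieces into which the interval [I] is cut at level [k]. *)
Let F k j := ulim U (fun n => m n (H k j)).

Let F_bounded k j : ubounded U (fun n => m n (H k j)).
Proof. exact: m_bounded (@H_disc k j). Qed.

Let E_bounded k j : ubounded U (fun n => m n (E k j)).
Proof. exact: m_bounded (subset_trans (@E_H k j) (@H_disc k j.+1)). Qed.

Let F0 k : F k 0 = 0.
Proof.
apply: ulim_cst; apply: filter_all => n.
by rewrite /= /m (_ : H k 0 = set0) ?measure0//; apply/seteqP; split.
Qed.

Let F_mono k i j : (i <= j)%N -> F k i <= F k j.
Proof.
move=> ij; apply: ulim_le => //; apply: filter_all => n /=.
apply: (m_le _ (mH _ _) (mH _ _) _ (@H_disc k j)).
by move=> z /leq_trans; apply.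
Qed.

Let F_double k j : F k.+1 j.*2 = F k j.
Proof.
rewrite /F; congr ulim; apply/funext => n; congr (m n _).
by apply/seteqP; split => z; rewrite /H /= -[(_ + _)%N]/(code k.+1 z) code_lt_double.
Qed.

Let F_exp k j : F k (2 ^ k * j) = F 0 j.
Proof.
elim: k j => [|k IH] j; first by rewrite mul1n.
by rewrite expnS -mulnA mul2n F_double IH.
Qed.

Let F_succ k j : F k j.+1 = F k j + ulim U (fun n => m n (E k j)).
Proof.
rewrite /F -ulimD//; congr ulim; apply/funext => n.
rewrite /m -fineD; [|exact: fin_sub (@H_disc k j)|exact: fin_sub (subset_trans (@E_H k j) (@H_disc k j.+1))].
rewrite -measureU//; last first.
  by apply/seteqP; split => // z [zj]; rewrite /E /= => zE; rewrite /H /= zE ltnn in zj.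
congr (fine (nu n _)); apply/seteqP; split => z.
  by rewrite /H /= ltnS leq_eqVlt => /orP[/eqP zj|zj]; [right|left].
by move=> [|/E_H//]; rewrite /H /= => /ltnW; rewrite ltnS.
Qed.

Let F_ge0 k j : 0 <= F k j.
Proof. by rewrite -(F0 k) F_mono. Qed.

Let I : set R := [set t | 0 <= t /\ exists j, t < F 0 j].
(** The code of the piece that contains [t]. *)
Let J k t : nat := xget 0%N [set j | F k j <= t < F k j.+1].

Let J_uniq k i j t : F k i <= t < F k i.+1 -> F k j <= t < F k j.+1 -> i = j.
Proof.
move=> /andP[i1 i2] /andP[j1 j2]; apply/eqP; rewrite eqn_leq; apply/andP; split.
  by rewrite leqNgt; apply/negP => /(F_mono k) h; have := lt_le_trans j2 (le_trans h i1); rewrite ltxx.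
by rewrite leqNgt; apply/negP => /(F_mono k) h; have := lt_le_trans i2 (le_trans h j1); rewrite ltxx.
Qed.

Let JP k t : I t -> F k (J k t) <= t < F k (J k t).+1.
Proof.
move=> [t0 [j tj]]; rewrite /J; case: xgetP => // /(_ _) no; exfalso.
have ex : exists j, t < F k j by exists (2 ^ k * j)%N; rewrite F_exp.
have := ex_minnP ex; case=> -[|i] ti imin; first by rewrite F0 ltNge t0 in ti.
apply: (no i); rewrite /= ti andbT leNgt; apply/negP => /imin.
by rewrite ltnn.
Qed.

Let JE k j t : F k j <= t < F k j.+1 -> I t /\ J k t = j.
Proof.
move=> tj; have /andP[j1 j2] := tj.
have It : I t.
  split; first exact: le_trans (F_ge0 k j) j1.
  exists j.+1; apply: lt_le_trans j2 _; rewrite -(F_exp k); apply: F_mono.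
  by rewrite leq_pmull// expn_gt0.
by split => //; exact: J_uniq (JP k It) tj.
Qed.

Let J_half k t : I t -> (J k.+1 t)./2 = J k t.
Proof.
move=> It; apply: (@J_uniq k _ _ t) (JP k It); have /andP[h1 h2] := JP k.+1 It.
rewrite -!(F_double k); apply/andP; split.
  apply: le_trans h1; apply: F_mono.
  by rewrite -[leqRHS]odd_double_half leq_addl.
apply: lt_le_trans h2 _; apply: F_mono.
by rewrite -ltn_half_double ltnS.
Qed.

Let rep k j : Z := xget point (E k j).
Let Tk k t := rep k (J k t).

(** The default value in [rep] does not occur: a nonempty piece has positive
    length, which is a limit of masses of the cell, hence the cell is nonempty. *)
Let code_Tk k t : I t -> code k (Tk k t) = J k t.
Proof.
move=> It; rewrite /Tk /rep; case: xgetP => [z _ //|no]; exfalso.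
have /andP[h1 h2] := JP k It; have := le_lt_trans h1 h2; rewrite F_succ ltrDl.
rewrite (_ : ulim U _ = 0) ?ltxx//; apply: ulim_cst.
apply: filter_all => n.
rewrite /= /m (_ : E k (J k t) = set0) ?measure0//.
by apply/seteqP; split => // z zE; exact: (no z).
Qed.

Let code_Tk_add k l t : I t -> code k (Tk (l + k) t) = J k t.
Proof.
move=> It; have : code (l + k) (Tk (l + k) t) = J (l + k) t by exact: code_Tk.
move: (Tk _ _) => z; elim: l => [//|l IH]; rewrite addSn => zl.
by apply: IH; rewrite -code_half zl J_half.
Qed.

(** Points of a disc whose codes agree far enough lie in a common small ball. *)
Let separate (N : nat) e : 0 < e -> exists K, forall x y, rad x <= N%:R -> rad y <= N%:R ->
  code K x = code K y -> mdist x y <= e.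
Proof.
move=> e0; have e2 : 0 < e / 2 by rewrite divr_gt0.
have [M0 _ M0P] := natSinv_small e2; pose M := maxn N M0.
have Me : M.+1%:R^-1 <= e / 2 by apply: (M0P M); rewrite /= leq_maxr.
have NM : N%:R <= M%:R :> R by rewrite ler_nat leq_maxl.
pose K := (\max_(i < (nx M).1) pickle (M, i : nat)).+1.
exists K => x y xN yN xy; have [i iM ix] := nxP (le_trans xN NM).
pose k := pickle (M, i); have kK : (k < K)%N by rewrite ltnS (leq_bigmax (Ordinal iM)).
have xyk : code k.+1 x = code k.+1 y by apply: (@code_prefix _ (K - k.+1)); rewrite subnK.
have Ax : A k x by rewrite /A /k pickleK.
have : A k y.
  by apply/asboolP; rewrite -code_odd -xyk code_odd; apply/asboolP.
rewrite /A /k pickleK /= => iy; have := metric_triangle x ((nx M).2 i) y.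
by rewrite (metric_sym x (_.2 i)); move: ix iy Me => /=; move: (M.+1%:R^-1) => d; lra.
Qed.

Let Tk_rad k t : I t -> rad (Tk k t) <= (J 0 t).+1%:R.
Proof.
move=> It; have := @code_Tk_add 0 k t It; rewrite addn0 /= => <-.
exact/ltW/truncnS_gt.
Qed.

Let T_ex t : exists z, I t -> forall e : R, 0 < e -> U [set k | mdist z (Tk k t) <= e].
Proof.
have [It|nIt] := pselect (I t); last by exists point.
have [||z Fz] := @rbcm_ultra_cvg R Z (Tk^~ t @ U) (J 0 t).+1%:R; first exact: ultra_fmap.
  suff : U [set k | rad (Tk k t) <= (J 0 t).+1%:R] by [].
  by apply: filter_all => k; exact: Tk_rad.
by exists z => _ e e0; exact: (Fz _ e0).
Qed.

Let T t : Z := if pselect (I t) is left _ then sval (cid (T_ex t)) else point.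

Let T_Tk (N : nat) e : 0 < e -> exists K,
  (forall x y, rad x <= N%:R -> rad y <= N%:R -> code K x = code K y -> mdist x y <= e) /\
  forall t, I t -> (J 0 t < N)%N -> mdist (T t) (Tk K t) <= e.
Proof.
move=> e0; have [K KP] := separate N e0; exists K; split => // t It JN.
have UT e' : 0 < e' -> U [set k | mdist (T t) (Tk k t) <= e'].
  by rewrite /T; case: pselect => // p; case: cid => z /= /(_ It); exact.
have JN' : (J 0 t).+1%:R <= N%:R :> R by rewrite ler_nat.
apply/ler_addgt0Pl => d d0.
have UK : U [set l | (K <= l)%N] by apply: ooU; exists K.
have [l [/= h1 h2]] := ultra_ex2 UU (UT _ d0) UK.
have := metric_triangle (T t) (Tk l t) (Tk K t).
have : mdist (Tk l t) (Tk K t) <= e.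
  apply: KP; [exact: le_trans (Tk_rad l It) JN'|exact: le_trans (Tk_rad K It) JN'|].
  by rewrite code_Tk// -(subnK h2) code_Tk_add.
by lra.
Qed.

Local Notation leb := (@lebesgue_measure R).
Local Notation RR := (measurableTypeR R).

Let J_cell k j : [set t | I t /\ J k t = j] = [set` `[F k j, F k j.+1[].
Proof.
apply/seteqP; split => t; rewrite /= in_itv /=; first by move=> [/(JP k) + <-].
exact: JE.
Qed.

Let mJ k (S : set nat) : measurable ([set t | I t /\ S (J k t)] : set RR).
Proof.
rewrite (_ : [set _ | _] = \bigcup_(j in S) [set t | I t /\ J k t = j]).
  by apply: bigcup_measurable => j _; rewrite J_cell; exact: measurable_itv.
by apply/seteqP; split => [t [It St]|t [j Sj [It tj]]]; [exists (J k t)|rewrite /= tj].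
Qed.

Let mI : measurable (I : set RR).
Proof.
have := mJ 0 setT; congr measurable; apply/seteqP; split => t //=.
by case.
Qed.

Let I_lt t N : I t -> (J 0 t < N)%N = (t < F 0 N).
Proof.
move=> It; have /andP[h1 h2] := JP 0 It; apply/idP/idP => h.
  by apply: lt_le_trans h2 (F_mono 0 h).
by rewrite ltnNge; apply/negP => /(F_mono 0) NJ; have := lt_le_trans h (le_trans NJ h1); rewrite ltxx.
Qed.

(** An open set is reached by [T] at [t] exactly when one of the approximations
    [Tk] of [T], which take countably many values, is far from its complement
    compared with the error. *)
Let mT : measurable_fun [set: RR] (T : RR -> borel Z).
Proof.
have T_nI t : ~ I t -> T t = point by rewrite /T; case: pselect.
apply: (@measurability _ _ RR (borel Z) setT T (@open Z)); first by [].
move=> _ [V oO <-]; rewrite setTI.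
have -> : T @^-1` V = (I `&` T @^-1` V) `|` (~` I `&` [set t | V point]).
  apply/seteqP; split => t.
    by move=> Ot; have [It|nIt] := pselect (I t); [left|right; split => //=; rewrite -(T_nI t)].
  by move=> [[]//|[nIt /= Op]]; rewrite /= T_nI.
apply: measurableU; last first.
  apply: measurableI; first by apply: measurableC.
  have [Op|nOp] := pselect (V point).
    by rewrite (_ : [set _ | _] = setT)//; apply/seteqP; split.
  by rewrite (_ : [set _ | _] = set0)//; apply/seteqP; split.
have [C0|C0] := pselect (~` V !=set0); last first.
  rewrite (_ : _ `&` _ = I)//; apply/seteqP; split => [t []//|t It]; split => //.
  by apply: contrapT => nO; apply: C0; exists (T t).
pose K N i := projT1 (cid (@T_Tk N i.+1%:R^-1 (ltac:(by rewrite invr_gt0)))).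
have KP N i t : I t -> (J 0 t < N)%N -> mdist (T t) (Tk (K N i) t) <= i.+1%:R^-1.
  by rewrite /K; case: cid => k [_ kP] /=; exact: kP.
rewrite (_ : _ `&` _ = \bigcup_N \bigcup_i ([set t | I t /\ [set j | (j < N)%N] (J 0 t)] `&`
   [set t | I t /\ [set j | i.+1%:R^-1 < dist_set (~` V) (rep (K N i) j)] (J (K N i) t)])).
  apply: bigcupT_measurable => N; apply: bigcupT_measurable => i.
  exact: measurableI.
apply/seteqP; split => t.
  move=> [It OT]; have [] : exists2 d, 0 < d & forall y, (~` V) y -> d <= mdist (T t) y.
    move: oO; rewrite openE => /(_ _ OT)/nbhs_ballP[d /= d0 dO]; exists d => // y nOy.
    by rewrite leNgt; apply/negP => h; apply: nOy; apply: dO; rewrite ballEmdist.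
  move=> d d0 dP; have d3 : 0 < d / 3 by rewrite divr_gt0.
  have /filter_ex[i /= id] := natSinv_small d3.
  exists (J 0 t).+1 => //; exists i => //; split; first by split => /=.
  split => //=; apply: (@lt_le_trans _ _ (d / 2)).
    by move: id; move: (i.+1%:R^-1) => e; lra.
  apply: le_dist_set => // y nOy; have := dP y nOy; have := KP _ i t It (ltnSn _).
  have := metric_triangle (T t) (Tk (K (J 0 t).+1 i) t) y; rewrite -/(Tk _ t).
  by move: id; move: (i.+1%:R^-1) => e; lra.
move=> [N _ [i _ [[It JN] [_ /= far]]]]; split => //=.
apply: contrapT => nO; have := KP N i t It JN; rewrite leNgt metric_sym => /negP; apply.
by apply: lt_le_trans far _; exact: dist_set_le.
Qed.

Let lim_measure : {measure set (borel Z) -> \bar R}.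
Proof.
unshelve refine (pushforward (mrestr leb mI) (T : RR -> borel Z) : {measure set (borel Z) -> \bar R}).
exact: mT.
Defined.

Let P0 (r : R) : nat := (Num.truncn (r + 1)).+1.

Let T_disc r t : I t -> rad (T t) <= r -> t < F 0 (P0 r).
Proof.
move=> It tr; rewrite -I_lt//.
have [K [_ KP]] := @T_Tk (J 0 t).+1 1 ltr01.
have := KP t It (ltnSn _) => TK.
have := @code_Tk_add 0 K t It; rewrite addn0 => <-; rewrite ltnS.
have : code 0 (Tk K t) = J 0 t by have := @code_Tk_add 0 K t It; rewrite addn0.
move=> _; apply: le_truncn; have := metric_triangle point (T t) (Tk K t).
by move: tr; rewrite /rad; lra.
Qed.

Let I_S N : `[0, F 0 N[%classic `<=` I.
Proof. by move=> t; rewrite /= in_itv /= => /andP[t0 tN]; split => //; exists N. Qed.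

Let lim_locally_finite : locally_finite lim_measure.
Proof.
move=> r; rewrite /= /pushforward /mrestr.
apply: (@le_lt_trans _ _ (leb (`[0, F 0 (P0 r)[%classic : set RR))).
  apply: le_measure; rewrite ?inE//.
    apply: measurableI => //; rewrite -[X in measurable X]setTI; apply: mT => //.
    exact: measurable_root_disc.
  by move=> t [tr It]; rewrite /= in_itv /= (T_disc It tr) andbT; case: It.
by rewrite lebesgue_measure_itv /=; case: ifP => _; rewrite -?EFinB ltry.
Qed.

Let code_P0 r z : rad z <= r -> (code 0 z < P0 r)%N.
Proof. by move=> zr; rewrite /= ltnS; apply: le_truncn; rewrite (le_trans zr)// lerDl. Qed.

Let lim_int r (f : Z -> R) (C : R) : continuous f -> (forall z, `|f z| <= C) -> (forall z, r < rad z -> f z = 0) ->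
  disc_int lim_measure r f = Rintegral leb `[0, F 0 (P0 r)[ (f \o T).
Proof.
move=> fc fC f0.
have bf : bounded_borel f by split; [exact: borel_continuous|exists C].
have mfT : measurable_fun [set: RR] (f \o T) by have [mf _] := bf; exact: (measurableT_comp mf mT).
have mD : measurable (T @^-1` root_disc Z r : set RR).
  by rewrite -[X in measurable X]setTI; apply: mT => //; exact: measurable_root_disc.
rewrite /disc_int /Rintegral; congr fine.
have mfin : (mrestr leb mI (T @^-1` root_disc Z r) < +oo)%E by exact: lim_locally_finite.
have IfT : (mrestr leb mI).-integrable (T @^-1` root_disc Z r) (EFin \o (f \o T)).
  have := @bounded_integrable _ _ R (mrestr leb mI) _ mD mfin (f \o T) C (measurable_funTS mfT) (fun t _ => fC (T t)).
  by [].
have mEf : measurable_fun [set: borel Z] (EFin \o (f : borel Z -> R)) by apply/measurable_EFinP; have [] := bf.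
have EQ := integral_pushforward mT mEf IfT (measurable_root_disc Z r).
rewrite [LHS]EQ.
have mCI : measurable (~` I : set RR) by exact: measurableC.
have CI0 : mrestr leb mI (~` I) = 0%E by rewrite /mrestr setICl measure0.
have mfE : measurable_fun (T @^-1` root_disc Z r) (EFin \o (f \o T)).
  by apply/measurable_EFinP; exact: measurable_funTS.
rewrite (@negligible_integral _ _ _ (mrestr leb mI) (T @^-1` root_disc Z r) (~` I)) //.
rewrite setDE setCK.
have -> : (\int[mrestr leb mI]_(x in T @^-1` root_disc Z r `&` I) ((EFin \o f) \o T) x =
   \int[leb]_(x in T @^-1` root_disc Z r `&` I) ((EFin \o f) \o T) x)%E.
  by apply: eq_measure_integral => B mB BI; rewrite /= /mrestr setIidl// => t /BI[].
rewrite [LHS]integral_mkcond [RHS]integral_mkcond; apply: eq_integral => t _.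
rewrite /patch; case: ifPn => [/set_mem[tr It]|tn].
  by rewrite mem_set//= in_itv /= (T_disc It tr) andbT; case: It.
case: ifPn => // /set_mem tS; have It := I_S tS.
rewrite /= f0// ltNge; apply/negP => tr; move: tn; rewrite notin_setE; apply.
by split.
Qed.

(** Points are encoded by sequences of integers.  The limits of the masses of the
    cells of points with a common initial code cut an interval into pieces, and the limit
    measure is the image of the Lebesgue measure under the map [T] that sends a
    piece to a point close to the cell.  A uniformly continuous function is
    almost constant on cells, so that its integrals are determined, up to a small
    error, by the masses of the cells. *)
Lemma vague_limit : exists mu : {measure set (borel Z) -> \bar R}, locally_finite mu /\
  forall (r C : R) (f : Z -> R), continuous f -> (forall z, `|f z| <= C) ->
    (forall z, r < mdist point z -> f z = 0) ->
    (forall eta : R, 0 < eta -> exists2 e, 0 < e & forall x y, mdist x y <= e -> `|f x - f y| <= eta) ->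
    disc_int mu r f = ulim U (fun n => disc_int (nu n) r f).
Proof.
exists lim_measure; split; first exact: lim_locally_finite.
move=> r C f fc fC f0 fu.
have bf : bounded_borel f by split; [exact: borel_continuous|exists C].
have C0 : 0 <= C by apply: le_trans (normr_ge0 _) (fC point).
pose N := P0 r; pose S := (`[0, F 0 N[%classic : set RR).
have [M UM] := nub N%:R.
have bint : ubounded U (fun n => disc_int (nu n) r f).
  have [M' UM'] := nub r; exists (C * M'); apply: filterS UM' => n /= nM.
  by apply: le_trans (disc_int_bound (nuf n) bf (fun z _ => fC z)) _; rewrite ler_wpM2l.
apply/eqP; rewrite -subr_eq0 -normr_le0; apply/ler_addgt0Pl => e e0; rewrite addr0.
pose B := F 0 N + `|M| + 1; have B0 : 0 < B by rewrite /B ltr_wpDl// addr_ge0.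
have eta0 : 0 < e / B by rewrite divr_gt0.
have [eps eps0 epsP] := fu _ eta0.
have [K [KP KT]] := T_Tk N eps0.
pose Q := (2 ^ K * N)%N; pose g j := f (rep K j).
have SI t : S t -> I t by exact: I_S.
have SN t : S t -> (J 0 t < N)%N.
  by move=> St; rewrite I_lt; [move: St; rewrite /S /= in_itv /= => /andP[]|exact: SI].
have F0N := F_ge0 0 N.
have mS : measurable S by exact: measurable_itv.
have lebS : leb S = (F 0 N)%:E.
  rewrite /S lebesgue_measure_itv /= lte_fin; case: ltgtP F0N => // [_ _|<- _//].
  by rewrite -EFinB subr0.
have lebSfin : (leb S < +oo)%E by rewrite lebS ltry.
have rep_code k z : code k (rep k (code k z)) = code k z.
  by rewrite /rep; case: xgetP => [w _ //|/(_ z)]; case.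
have JQ t : S t -> (J K t < Q)%N.
  move=> St; have It := SI t St; rewrite /Q -(code_Tk K It) code_lt_exp.
  by have := @code_Tk_add 0 K t It; rewrite addn0 => ->; exact: SN.
have mcell j : measurable (S `&` [set t | J K t = j]).
  rewrite (_ : _ `&` _ = S `&` [set t | I t /\ J K t = j]).
    by apply: measurableI => //; exact: (mJ K [set j]).
  by apply/seteqP; split => t [St]; [split => //; split => //; exact: SI|move=> [_ tj]; split].
have [mgJ intgJ] := Rintegral_partition mS lebSfin g mcell JQ.
have cell_leb j : (j < Q)%N -> fine (leb (S `&` [set t | J K t = j])) = ulim U (fun n => m n (E K j)).
  move=> jQ; rewrite (_ : _ `&` _ = [set` `[F K j, F K j.+1[]); last first.
    rewrite -J_cell; apply/seteqP; split => t [h1 h2]; split => //; first exact: SI.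
    rewrite /S /= in_itv /=; have [-> _] := h1; rewrite -I_lt//=.
    by rewrite -(@code_Tk_add 0 K t h1) addn0 -(code_lt_exp K) code_Tk// h2.
  have FF := F_mono K (leqnSn j).
  rewrite lebesgue_measure_itv /= lte_fin; have E1 := F_succ K j.
  case: ltgtP FF => // [_ _|EE _]; first by rewrite -EFinB /= E1 addrC addKr.
  by move: E1; rewrite -EE /= -[LHS]addr0 => /addrI.
have close_lim : `|Rintegral leb S (f \o T) - \sum_(j < Q) g j * ulim U (fun n => m n (E K j))| <= e / B * F 0 N.
  have -> : \sum_(j < Q) g j * ulim U (fun n => m n (E K j)) = Rintegral leb S (g \o J K).
    by rewrite intgJ; apply: eq_bigr => j _; rewrite cell_leb.
  rewrite -[F 0 N]/(fine (F 0 N)%:E) -lebS.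
  apply: (@Rintegral_close _ _ _ _ _ mS lebSfin _ _ C) => //.
  - by have [mf _] := bf; apply: measurable_funTS; exact: (measurableT_comp mf mT).
  - by move=> t _; exact: fC.
  move=> t St; apply: epsP; exact: (KT _ (SI t St) (SN t St)).
have HN_fin n : (nu n (H 0 N) < +oo)%E by rewrite -ge0_fin_numE//; exact: fin_sub (@H_disc 0 N).
have close_n n : `|disc_int (nu n) r f - \sum_(j < Q) g j * m n (E K j)| <= e / B * m n (H 0 N).
  have codeQ z : H 0 N z -> (code K z < Q)%N by move=> zN; rewrite /Q code_lt_exp.
  have mEc j : measurable (H 0 N `&` [set z | code K z = j]) by apply: measurableI => //; exact: mE.
  have [mgc intgc] := Rintegral_partition (mH 0 N) (HN_fin n) g mEc codeQ.
  have -> : \sum_(j < Q) g j * m n (E K j) = Rintegral (nu n) (H 0 N) (g \o code K).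
    rewrite intgc; apply: eq_bigr => j _; congr (_ * fine (nu n _)).
    apply/seteqP; split => [z zj|z [_ zj]//]; split => //.
    by rewrite /H /= -[Num.truncn _]/(code 0 z) -(code_lt_exp K) zj.
  have -> : disc_int (nu n) r f = Rintegral (nu n) (H 0 N) f.
    rewrite /disc_int /Rintegral; congr fine; rewrite [LHS]integral_mkcond [RHS]integral_mkcond.
    apply: eq_integral => z _; rewrite /patch; case: ifPn => [/set_mem zr|zr].
      by rewrite mem_set//; exact: code_P0.
    case: ifPn => // _; rewrite f0// ltNge; apply/negP => zr'; move: zr; rewrite notin_setE; apply.
    exact: zr'.
  apply: (@Rintegral_close _ _ _ _ _ (mH 0 N) (HN_fin n) _ _ C) => //.
  - by apply: measurable_funTS; have [] := bf.
  move=> z zN; apply: epsP; have zN' := @H_disc 0 N z zN.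
  apply: KP => //.
  have : H 0 N (rep K (code K z)) by rewrite /H /= -[Num.truncn _]/(code 0 _) -(code_lt_exp K) rep_code code_lt_exp.
  exact: H_disc.
have [bsum Esum] := ulim_sum UU Q g (E_bounded K).
have close_ulim : `|ulim U (fun n => disc_int (nu n) r f) - \sum_(j < Q) g j * ulim U (fun n => m n (E K j))| <= e / B * `|M|.
  rewrite -Esum; apply: ulim_close => //; apply: filterS UM => n /= nM.
  apply: le_trans (close_n n) _; rewrite ler_wpM2l ?(ltW eta0)//.
  apply: le_trans (ler_norm _); apply: le_trans nM.
  exact: (m_le n (mH 0 N) (measurable_root_disc Z _) (@H_disc 0 N) (@subset_refl _ _)).
rewrite (lim_int fc fC f0) -/N -/S.
apply: le_trans (ler_distD (\sum_(j < Q) g j * ulim U (fun n => m n (E K j))) _ _) _.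
rewrite [X in _ + X <= _]distrC; apply: le_trans (lerD close_lim close_ulim) _.
rewrite -mulrDr mulrAC ler_pdivrMr// ler_wpM2l ?(ltW e0)//.
by rewrite /B lerDl.
Qed.

End vague_limit.

(** * A common ambient space for a sequence of spaces *)

(** The tolerances [2^-n] of a chain; the sum of the [hpow k] over [k >= n] is [2 * hpow n]. *)
Definition hpow (R : realType) (n : nat) : R := 2^-1 ^+ n.

Lemma hpow_gt0 (R : realType) n : 0 < hpow R n.
Proof. by rewrite exprn_gt0. Qed.

Lemma hpowS (R : realType) n : hpow R n = 2 * hpow R n - 2 * hpow R n.+1.
Proof. by rewrite /hpow exprS; move: (2^-1 ^+ n) => x; lra. Qed.

Lemma hpow_small (R : realType) (e : R) : 0 < e -> \forall n \near \oo, hpow R n <= e.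
Proof.
move=> e0; have [N _ NP] := natSinv_small e0; exists N => // n /NP /=; apply: le_trans.
rewrite /hpow exprVn lef_pV2 ?posrE ?exprn_gt0//.
by rewrite -natrX ler_nat ltn_expl.
Qed.

Lemma hpow_le (R : realType) m n : (m <= n)%N -> hpow R n <= hpow R m.
Proof. by move=> mn; apply: ler_wiXn2l => //; rewrite invf_le1// ler1n. Qed.

(** Points that are matched from each level to the next are followed through
    several levels.  The total displacement is at most [w n], the sum of the
    tolerances, so that the walk does not leave the disc in which the matching is
    available. *)
Section walk.
Variables (R : realType) (T : Type) (d : T -> T -> R) (h : T -> R) (P : nat -> T -> Prop).
Hypotheses (dxx : forall x, d x x = 0) (dsym : forall x y, d x y = d y x)
  (dtri : forall y x z, d x z <= d x y + d y z) (hd : forall x y, h x <= h y + d x y).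
Hypothesis up : forall n t, P n t -> h t <= n%:R -> exists2 t', P n.+1 t' & d t t' <= hpow R n.
Hypothesis down : forall n t, P n.+1 t -> h t <= n%:R -> exists2 t', P n t' & d t t' <= hpow R n.
Let w n := 2 * hpow R n.

Lemma walk_up n l t : P n t -> h t + w n <= n%:R ->
  exists2 t', P (l + n)%N t' & d t t' <= w n - w (l + n)%N.
Proof.
move=> Pt tn; elim: l => [|l [t' Pt' tt']]; first by exists t => //; rewrite dxx subrr.
have wl := hpow_gt0 R (l + n); have [|t'' Pt'' t't''] := up Pt'.
  have : n%:R <= (l + n)%:R :> R by rewrite ler_nat leq_addl.
  have := hd t' t; rewrite dsym; move: tt' tn wl; rewrite /w; move: (n%:R) ((l + n)%:R) => a b; lra.
exists t'' => //; have := dtri t' t t''; move: tt' t't''; rewrite addSn /w.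
by have := hpowS R (l + n); lra.
Qed.

Lemma walk_down n l t : P (l + n)%N t -> h t + w n <= n%:R ->
  exists2 t', P n t' & d t t' <= w n - w (l + n)%N.
Proof.
suff H : forall t, P (l + n)%N t -> h t + (w n - w (l + n)%N) <= n%:R ->
    exists2 t', P n t' & d t t' <= w n - w (l + n)%N.
  move=> Pt tn; apply: H => //; apply: le_trans tn; rewrite lerD2l gerBl.
  by rewrite mulr_ge0// ltW// hpow_gt0.
elim: l => [|l IH] {}t; first by move=> Pt _; exists t => //; rewrite dxx subrr.
rewrite addSn => Pt tn; have E := hpowS R (l + n).
have wn : w (l + n).+1 <= w n by rewrite ler_wpM2l// hpow_le// leqW// leq_addl.
have nl : n%:R <= (l + n)%:R :> R by rewrite ler_nat leq_addl.
have [|t' Pt' tt'] := down Pt.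
  by move: tn wn nl; move: (n%:R) ((l + n)%:R) => a b; lra.
have [|t'' Pt'' t't''] := IH t' Pt'.
  have := hd t' t; rewrite dsym; move: tn tt'; rewrite /w; move: (n%:R) => a; lra.
exists t'' => //; have := dtri t' t t''; move: tt' t't''; rewrite /w; lra.
Qed.

End walk.

Section ambient_chain.
Variables (R : realType) (X : nat -> rbcmType R) (Z : nat -> rbcmType R)
  (f : forall n, X n -> Z n) (g : forall n, X n.+1 -> Z n).
Arguments f : clear implicits.
Arguments g : clear implicits.
Hypotheses (fi : forall n, rooted_isometry (f n)) (gi : forall n, rooted_isometry (g n)).

Let stage n := {W : rbcmType R & {i : X n -> W | rooted_isometry i}}.

Let next n (s : stage n) (s' : stage n.+1) (e : projT1 s -> projT1 s') :=
  rooted_isometry e /\ forall x y,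
    mdist (e (sval (projT2 s) x)) (sval (projT2 s') y) <= mdist (f n x) (g n y).

Let next_ex n (s : stage n) : exists s' : stage n.+1, exists e : projT1 s -> projT1 s', next e.
Proof.
case: s => W [i ii]; have [i0 id_] := ii; have [f0 fd] := fi n; have [g0 gd] := gi n.
have [|||k l|W' [e [i' [ei i'i ei']]]] := @rbcm_glue R W (X n.+1) (X n * X n.+1)%type
  (fun k => i k.1) snd (fun k => mdist (f n k.1) (g n k.2)) (point, point) (fun k => mdist_ge0 _ _).
- by rewrite /= i0.
- by [].
- by rewrite /= f0 g0 mdistxx.
- rewrite id_ -(fd k.1) -(gd k.2).
  have := metric_triangle (f n k.1) (g n k.2) (f n l.1).
  have := metric_triangle (g n k.2) (g n l.2) (f n l.1).
  have := metric_triangle (g n k.2) (f n k.1) (g n l.2).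
  have := metric_triangle (f n k.1) (f n l.1) (g n l.2).
  rewrite (metric_sym (g n l.2)) (metric_sym (g n k.2) (f n k.1)) ler_norml => ? ? ? ?.
  by apply/andP; split; lra.
exists (existT _ W' (exist _ i' i'i)), e; split => //= x y.
exact: (ei' (x, y)).
Qed.

Let stages := fix stages (n : nat) : stage n :=
  if n is n'.+1 then projT1 (cid (next_ex (stages n'))) else existT _ (X 0) (exist _ id (conj erefl (fun _ _ => erefl))).

Let W n := projT1 (stages n).
Let inj n : X n -> W n := sval (projT2 (stages n)).
Let e n : W n -> W n.+1 := projT1 (cid (projT2 (cid (next_ex (stages n))))).

Arguments inj : clear implicits.
Arguments e : clear implicits.

Let inj_i n : rooted_isometry (inj n). Proof. exact: (svalP (projT2 (stages n))). Qed.
Let eP n : next (e n). Proof. exact: (projT2 (cid (projT2 (cid (next_ex (stages n)))))). Qed.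

Let T := {n : nat & X n}.

Let lift := fix lift (N : nat) (t : T) : W N := match N return W N with
  | 0 => match tag t =P 0%N with ReflectT E => inj 0 (ecast n (X n) E (tagged t)) | _ => point end
  | N'.+1 => match tag t =P N'.+1 with ReflectT E => inj N'.+1 (ecast n (X n) E (tagged t)) | _ => e N' (lift N' t) end
  end.

Let lift_diag n x : lift n (existT _ n x) = inj n x.
Proof.
by case: n x => [|n] x /=; case: eqP => // E; rewrite (eq_axiomK E).
Qed.

Let liftS N t : (tag t <= N)%N -> lift N.+1 t = e N (lift N t).
Proof. by move=> tN /=; case: eqP => // E; rewrite E ltnn in tN. Qed.

Let d (s t : T) : R := mdist (lift (maxn (tag s) (tag t)) s) (lift (maxn (tag s) (tag t)) t).

Let dE N s t : (tag s <= N)%N -> (tag t <= N)%N -> mdist (lift N s) (lift N t) = d s t.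
Proof.
move=> sN tN; have MN : (maxn (tag s) (tag t) <= N)%N by rewrite geq_max sN.
rewrite -(subnK MN) /d; set M := maxn _ _; elim: (N - M)%N => [//|k IH].
have kM : (M <= k + M)%N by rewrite leq_addl.
have [[_ ed] _] := eP (k + M).
rewrite addSn !liftS ?ed//.
  exact: leq_trans (leq_maxr _ _) kM.
exact: leq_trans (leq_maxl _ _) kM.
Qed.

Let d_same n x y : d (existT _ n x) (existT _ n y) = mdist x y.
Proof. by rewrite -(@dE n)//= !lift_diag; have [_ ->] := inj_i n. Qed.

Let d_next n x y : d (existT _ n x) (existT _ n.+1 y) <= mdist (f n x) (g n y).
Proof.
by rewrite -(@dE n.+1)// ?leqnSn// liftS// !lift_diag; have [_] := eP n; exact.
Qed.

Let dxx s : d s s = 0. Proof. exact: mdistxx. Qed.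

Let dsym s t : d s t = d t s.
Proof. by rewrite /d maxnC metric_sym. Qed.

Let dtri t s r : d s r <= d s t + d t r.
Proof.
pose N := maxn (tag s) (maxn (tag t) (tag r)).
have sN : (tag s <= N)%N by rewrite leq_maxl.
have tN : (tag t <= N)%N by rewrite /N maxnCA leq_maxl.
have rN : (tag r <= N)%N by rewrite /N maxnA leq_maxr.
by rewrite -!(@dE N)// metric_triangle.
Qed.

Let lift_root N n : (n <= N)%N -> lift N (existT _ n (point : X n)) = point.
Proof.
move=> nN; rewrite -(subnK nN); elim: (N - n)%N => [|k IH].
  by rewrite lift_diag; have [-> _] := inj_i n.
by rewrite addSn liftS/= ?leq_addl// IH; have [[-> _] _] := eP (k + n).
Qed.

Let t0 : T := existT _ 0%N (point : X 0).

Let d_height n x : d t0 (existT _ n x) = mdist point x.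
Proof.
rewrite -(@dE n)//= lift_root// lift_diag; have [i0 id_] := inj_i n.
by rewrite -i0 id_.
Qed.

Hypothesis near_up : forall n (x : X n), mdist point x <= n%:R -> exists y, mdist (f n x) (g n y) <= hpow R n.
Hypothesis near_down : forall n (y : X n.+1), mdist point y <= n%:R -> exists x, mdist (f n x) (g n y) <= hpow R n.

(** Each stage glues the next space to the previous stage; the distance between
    any two points is computed in a sufficiently late stage.  The discs of
    the union are totally bounded: by [walk_down] the points of high level are
    close to those of one fixed level. *)
Lemma ambient_chain : exists (A : rbcmType R) (i : forall n, X n -> A),
  (forall n, rooted_isometry (i n)) /\
  (forall n x y, mdist (i n x) (i n.+1 y) <= mdist (f n x) (g n y)).
Proof.
have [r eps eps0|A [i [i0 id_ _]]] := @rbcm_completion R T d t0 dxx dsym dtri; last first.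
  exists A, (fun n x => i (existT _ n x)); split => [n|n x y]; last by rewrite id_ d_next.
  split=> [|x y]; last by rewrite id_ d_same.
  by apply: mdist_positivity; rewrite -i0 id_ dsym d_height mdistxx.
have eps4 : 0 < eps / 4 by rewrite divr_gt0.
have /filter_ex[n0 [/= n0e n0r]] : \forall n \near \oo, hpow R n <= eps / 4 /\ r + 2 <= n%:R.
  by apply: filterI; [exact: hpow_small|exact: nat_ge_near].
have level n r' e' : 0 < e' -> has_net d [set t | exists2 x : X n, mdist point x <= r' & t = existT _ n x] e'.
  move=> e'0; have [k [x xP]] := @rbcm_net R (X n) r' e' e'0; exists k, (fun j => existT _ n (x j)).
  by move=> _ [y yr ->]; have [j jk xy] := xP y yr; exists j => //; rewrite d_same.
have low : has_net d [set t | exists2 n, (n < n0)%N & exists2 x : X n, mdist point x <= r & t = existT _ n x] eps.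
  by apply: has_net_bigcup => // n _; exact: level.
have high : has_net d [set t | (n0 <= tag t)%N /\ d t0 t <= r] eps.
  have [k [x xP]] := level n0 (r + 2) (eps / 2) (divr_gt0 eps0 (ltr0n _ 2)).
  exists k, x => t [nt tr].
  pose P n (t : T) := exists x : X n, t = existT _ n x.
  have hd u v : d t0 u <= d t0 v + d u v by rewrite (dsym u v).
  have wup n t' : P n t' -> d t0 t' <= n%:R -> exists2 t'', P n.+1 t'' & d t' t'' <= hpow R n.
    move=> [y ->]; rewrite d_height => /near_up[z yz]; exists (existT _ n.+1 z); first by exists z.
    exact: le_trans (d_next _ _) yz.
  have wdown n t' : P n.+1 t' -> d t0 t' <= n%:R -> exists2 t'', P n t'' & d t' t'' <= hpow R n.
    move=> [y ->]; rewrite d_height => /near_down[z yz]; exists (existT _ n z); first by exists z.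
    by rewrite dsym; exact: le_trans (d_next _ _) yz.
  have h1 : hpow R n0 <= 1 := hpow_le R (leq0n n0).
  have Pt : P ((tag t - n0) + n0)%N t by rewrite subnK//; case: t {nt tr} => n y; exists y.
  have [|_ [y ->] ty] := @walk_down R T d (d t0) P dxx dsym dtri hd wdown n0 (tag t - n0) t Pt.
    by move: n0r tr h1; move: (n0%:R) => a; lra.
  have hpos := hpow_gt0 R (tag t - n0 + n0).
  have ty2 : d t (existT _ n0 y) <= eps / 2 by lra.
  have [|j jk xy] := xP (existT _ n0 y).
    exists y => //; rewrite -d_height; have := hd (existT _ n0 y) t; rewrite (dsym (existT _ n0 y) t); lra.
  exists j => //; have := dtri (existT _ n0 y) (x j) t; rewrite (dsym (existT _ n0 y) t); lra.
apply: has_net_sub (lexx eps) (has_netU low high) => -[n x] /= xr.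
have [nn0|nn0] := leqP n0 n; first by right.
by left; exists n => //; exists x => //; rewrite -d_height.
Qed.

End ambient_chain.

(** * The limit of a sequence of spaces *)

Section limit_space.
Variables (R : realType) (kappa : R) (hk : 0 < kappa <= 1) (X : nat -> rmbcmSpace R)
  (A : rbcmType R) (i : forall n, X n -> A).
Arguments i : clear implicits.
Hypotheses (ii : forall n, rooted_isometry (i n))
  (inear : forall n, GHV_near kappa (i n) (i n.+1) n%:R (hpow R n)).

Let lX n := @rmbcm_locally_finite R (X n).
Let nu n : {measure set (borel A) -> \bar R} := isom_measure (rmbcm_measure (X n)) (ii n).
Let lnu n : locally_finite (nu n). Proof. exact: isom_locally_finite. Qed.
Let w n := 2 * hpow R n.
Let w_gt0 n : 0 < w n. Proof. by rewrite mulr_gt0// hpow_gt0. Qed.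
Let rad (z : A) : R := mdist (point : A) z.
Let P n (z : A) := exists x, z = i n x.

Let rad_d x y : rad x <= rad y + mdist x y.
Proof. by rewrite (metric_sym x y) metric_triangle. Qed.

Let P_up n z : P n z -> rad z <= n%:R -> exists2 z', P n.+1 z' & mdist z z' <= hpow R n.
Proof.
move=> [x ->]; rewrite /rad (rooted_isometry_height (ii n)).
by have [h _ _] := inear n => /h[y xy]; exists (i n.+1 y) => //; exists y.
Qed.

Let P_down n z : P n.+1 z -> rad z <= n%:R -> exists2 z', P n z' & mdist z z' <= hpow R n.
Proof.
move=> [y ->]; rewrite /rad (rooted_isometry_height (ii n.+1)).
have [_ h _] := inear n => /h[x xy]; exists (i n x); first by exists x.
by rewrite metric_sym.
Qed.

Let upP n l z : P n z -> rad z + w n <= n%:R -> exists2 z', P (l + n)%N z' & mdist z z' <= w n.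
Proof.
move=> Pz zn; have [z' Pz' zz'] := walk_up (@mdistxx _ _) (@metric_sym _ _)
  (fun y x z => @metric_triangle _ _ x y z) rad_d P_up l Pz zn.
by exists z' => //; apply: le_trans zz' _; rewrite gerBl (ltW (w_gt0 _)).
Qed.

Let downP n l z : P (l + n)%N z -> rad z + w n <= n%:R -> exists2 z', P n z' & mdist z z' <= w n.
Proof.
move=> Pz zn; have [z' Pz' zz'] := walk_down (@mdistxx _ _) (@metric_sym _ _)
  (fun y x z => @metric_triangle _ _ x y z) rad_d P_down Pz zn.
by exists z' => //; apply: le_trans zz' _; rewrite gerBl (ltW (w_gt0 _)).
Qed.

Let test_step phi a n : test kappa phi -> (forall z, a < rad z -> phi z = 0) -> a <= n%:R ->
  `|disc_int (nu n) a phi - disc_int (nu n.+1) a phi| <= hpow R n.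
Proof.
move=> tphi phi0 an; have [_ _ h] := inear n; have bphi := test_bounded_borel hk tphi.
rewrite -(disc_int_support (lnu n) an bphi phi0) -(disc_int_support (lnu n.+1) an bphi phi0).
rewrite (isom_disc_int (ii n) _ (lX n) bphi) (isom_disc_int (ii n.+1) _ (lX n.+1) bphi).
by apply: h => // z nz; apply: phi0; exact: le_lt_trans nz.
Qed.

(** The integrals of a test function along the chain form a Cauchy sequence with a
    rate that does not depend on the function. *)
Let test_walk phi a n l : test kappa phi -> (forall z, a < rad z -> phi z = 0) -> a <= n%:R ->
  `|disc_int (nu n) a phi - disc_int (nu (l + n)%N) a phi| <= w n.
Proof.
move=> tphi phi0 an.
suff : `|disc_int (nu n) a phi - disc_int (nu (l + n)%N) a phi| <= w n - w (l + n)%N.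
  by move/le_trans; apply; rewrite gerBl (ltW (w_gt0 _)).
elim: l => [|l IH]; first by rewrite !subrr normr0.
apply: le_trans (ler_distD (disc_int (nu (l + n)%N) a phi) _ _) _.
have : a <= (l + n)%:R by apply: le_trans an _; rewrite ler_nat leq_addl.
move=> /(test_step tphi phi0); have := hpowS R (l + n); move: IH; rewrite addSn /w; lra.
Qed.

Let chi (r : R) (z : A) : R := clamp (r + 1 - rad z).

Let chi_test r : test kappa (chi r).
Proof.
split => [z|]; first exact: clamp_norm.
apply: clamp_holder => // x y; rewrite mul1r.
have := rad_d x y; have := rad_d y x; rewrite (metric_sym y x) ler_norml => ? ?.
by apply/andP; split; lra.
Qed.

Let chi0 r z : r + 1 < rad z -> chi r z = 0.
Proof. by move=> rz; apply: clamp0; lra. Qed.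

(** Integrals of a cutoff bound the masses of discs. *)
Let nu_bounded (U : set_system nat) : UltraFilter U -> \oo `<=` U -> forall r, exists M, U [set n | disc_mass (nu n) r <= M].
Proof.
move=> UU ooU r; have [n0 /= n0r] : exists n0 : nat, r + 1 <= n0%:R.
  by have /filter_ex := nat_ge_near (r + 1).
exists (disc_int (nu n0) (r + 1) (chi r) + w n0); apply: ooU; exists n0 => // n /= n0n.
have := test_walk (n - n0) (chi_test r) (@chi0 r) n0r; rewrite subnK// ler_norml => /andP[h _].
have bchi := test_bounded_borel hk (chi_test r).
suff : disc_mass (nu n) r <= disc_int (nu n) (r + 1) (chi r) by lra.
have rr1 : r <= r + 1 by rewrite lerDl.
rewrite (disc_int_split (lnu n) rr1 bchi) -[leLHS]addr0 lerD//; last first.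
  by apply: Rintegral_ge0 => z _; have /andP[] := clamp_itv (r + 1 - rad z).
rewrite -[leLHS]mul1r -disc_int_cst; apply: le_disc_int => //; first exact: bounded_borel_cst.
by move=> z zr; rewrite /chi clamp1//; rewrite /rad; lra.
Qed.

Let unif_cont phi : test kappa phi -> forall eta : R, 0 < eta ->
  exists2 e, 0 < e & forall x y : A, mdist x y <= e -> `|phi x - phi y| <= eta.
Proof.
move=> [_ ph] eta eta0; have /andP[k0 _] := hk.
exists (eta `^ kappa^-1) => [|x y xy]; first exact: powR_gt0.
apply: le_trans (ph x y) _; rewrite mul1r.
have -> : eta = (eta `^ kappa^-1) `^ kappa by rewrite -powRrM mulVf ?gt_eqF// powRr1// ltW.
by rewrite ge0_ler_powR ?nnegrE ?mdist_ge0 ?powR_ge0 ?(ltW k0).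
Qed.

Let ambient_limit : exists (U : set_system nat) (mu : {measure set (borel A) -> \bar R}),
  [/\ UltraFilter U, \oo `<=` U, locally_finite mu &
    forall phi a, test kappa phi -> (forall z, a < rad z -> phi z = 0) ->
      disc_int mu a phi = ulim U (fun n => disc_int (nu n) a phi)].
Proof.
have [U [UU ooU]] := nat_ultrafilter.
have [mu [lmu muP]] := vague_limit UU lnu ooU (nu_bounded UU ooU).
exists U, mu; split => // phi a tphi phi0; have [phi1 ph] := tphi.
apply: (muP a 1 phi) => //; last exact: unif_cont.
exact: (holder_continuous hk _ ph).
Qed.

Section with_limit.
Variables (U : set_system nat) (mu : {measure set (borel A) -> \bar R}).
Hypotheses (UU : UltraFilter U) (ooU : \oo `<=` U) (lmu : locally_finite mu)
  (muP : forall phi a, test kappa phi -> (forall z, a < rad z -> phi z = 0) ->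
      disc_int mu a phi = ulim U (fun n => disc_int (nu n) a phi)).

(** The limit along the ultrafilter of the images of the spaces. *)
Let S : set A := [set z | forall e : R, 0 < e -> U [set n | exists x, mdist z (i n x) <= e]].

Let S0 : S point.
Proof.
move=> e e0; apply: filter_all => n.
by exists point; have [-> _] := ii n; rewrite mdistxx ltW.
Qed.

Let cS : closed S.
Proof.
move=> z cz e e0; have e2 : 0 < e / 2 by rewrite divr_gt0.
have [y [Sy /=]] := cz (ball z (e / 2)) (nbhsx_ballx _ _ e2).
rewrite ballEmdist /= => zy; apply: filterS (Sy _ e2) => n [x yx]; exists x.
by have := metric_triangle z y (i n x); lra.
Qed.

Let mS : measurable (S : set (borel A)). Proof. exact: borel_closed. Qed.

Let disc_int_bounded phi a : test kappa phi -> ubounded U (fun n => disc_int (nu n) a phi).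
Proof.
move=> tphi; have bphi := test_bounded_borel hk tphi; have [phi1 _] := tphi.
have [M UM] := nu_bounded UU ooU a; exists M; apply: filterS UM => n /= nM.
by apply: le_trans (disc_int_bound (lnu n) bphi (fun z _ => phi1 z)) _; rewrite mul1r.
Qed.

Let test_lim phi a n : test kappa phi -> (forall z, a < rad z -> phi z = 0) -> a <= n%:R ->
  `|disc_int mu a phi - disc_int (nu n) a phi| <= w n.
Proof.
move=> tphi phi0 an; rewrite muP//.
have -> : disc_int (nu n) a phi = ulim U (fun _ => disc_int (nu n) a phi).
  by apply/esym/ulim_cst; apply: filter_all.
apply: ulim_close => //; first exact: disc_int_bounded.
  by exists `|disc_int (nu n) a phi|; apply: filter_all => m /=.
apply: ooU; exists n => // m /= nm.
by rewrite distrC -(subnK nm) test_walk.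
Qed.

(** A compact set that does not meet [S] has, along the ultrafilter, a positive
    distance to the images of the spaces; a narrow tent around it is then not charged by
    their measures. *)
Let mu_S : mu (~` S) = 0%E.
Proof.
have mCS : measurable (~` S : set (borel A)) by exact: measurableC.
have [_ ->//] := locally_finite_radon lmu.
apply/eqP; rewrite eq_le; apply/andP; split; last first.
  by apply: ereal_sup_ubound; exists set0; rewrite ?measure0//; split => //; exact: compact0.
apply: ge_ereal_sup => _ [K [cK KS] <-].
have [K0|K0] := pselect (K !=set0); last first.
  by rewrite (_ : K = set0) ?measure0//; apply/seteqP; split => // z Kz; apply: K0; exists z.
pose D n := inf [set dist_set K (i n x) | x in [set: X n]].
have hD n : has_inf [set dist_set K (i n x) | x in [set: X n]].
  by split; [exists (dist_set K (i n point)), point|exists 0 => _ [x _ <-]; exact: dist_set_ge0].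
have [k Uk] : exists k : nat, U [set n | k.+1%:R^-1 <= D n].
  apply: contrapT => no.
  have small (e : R) : 0 < e -> U [set n | D n <= e].
    move=> e0; have /filter_ex[k /= ke] := natSinv_small e0.
    have [Uk|Uk] := in_ultra_setVsetC [set n | k.+1%:R^-1 <= D n] UU; first by exfalso; apply: no; exists k.
    apply: filterS Uk => n /= /negP; rewrite -ltNge => /ltW Dk; exact: le_trans Dk ke.
  have pick_z n : exists zx : A * X n, K zx.1 /\ mdist zx.1 (i n zx.2) <= D n + n.+1%:R^-1.
    have n2 : 0 < n.+1%:R^-1 / 2 :> R by rewrite divr_gt0// invr_gt0.
    have [_ [x _ <-] xD] := inf_adherent n2 (hD n).
    have [z Kz xz] := dist_set_attained K0 (i n x) n2.
    exists (z, x) => /=; split => //; rewrite metric_sym; move: xD xz; rewrite -/(D n).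
    by move: (n.+1%:R^-1) => c; lra.
  pose u n := (projT1 (cid (pick_z n))).1; pose v n := (projT1 (cid (pick_z n))).2.
  have uK n : K (u n) by have [] := projT2 (cid (pick_z n)).
  have uv n : mdist (u n) (i n (v n)) <= D n + n.+1%:R^-1 by have [] := projT2 (cid (pick_z n)).
  move: cK; rewrite compact_ultra => /(_ _ (ultra_fmap u UU)) [|z [Kz uz]].
    suff : U [set n | K (u n)] by [].
    exact: filter_all.
  apply: (KS z Kz) => e e0; have e3 : 0 < e / 3 by rewrite divr_gt0.
  have Uz : U [set n | mdist z (u n) < e / 3].
    by have /uz := nbhsx_ballx z _ e3; rewrite ballEmdist.
  have Un : U [set n | n.+1%:R^-1 <= e / 3 :> R] by apply: ooU; exact: natSinv_small.
  apply: filterS2 Uz (filterI Un (small _ e3)) => n /= zu [nk De]; exists (v n).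
  have := metric_triangle z (u n) (i n (v n)); have := uv n.
  by move: nk; move: (n.+1%:R^-1) => c; lra.
have [r r0 rP] := compact_in_disc cK.
have KD : K `<=` root_disc A r by exact: rP.
have L1 : 1 <= k.+1%:R :> R by rewrite ler1n.
have tb := holder_test L1 (tent_norm K _) (tent_holder K0 hk L1).
have tb0 z : r + 1 < rad z -> k.+1%:R^-1 * tent K k.+1%:R z = 0.
  by move=> rz; rewrite (tent_support k K0 KD rz) mulr0.
have bb := tent_bounded_borel k K0.
have int0 : disc_int mu (r + 1) (tent K k.+1%:R) = 0.
  have := muP tb tb0; rewrite disc_intZ//.
  have -> : ulim U (fun n => disc_int (nu n) (r + 1) (fun z => k.+1%:R^-1 * tent K k.+1%:R z)) = 0.
    apply: ulim_cst => //; apply: filterS Uk => n /= kD.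
    rewrite (disc_intZ (lnu n) _ _ bb) (isom_disc_int (ii n) _ (lX n) bb).
    have -> : tent K k.+1%:R \o i n = (fun=> 0).
      apply/funext => x; apply: tent0 => //; apply: le_trans kD _.
      by apply: ge_inf; [have [] := hD n|exists x].
    by rewrite disc_int_cst mul0r mulr0.
  by move=> /eqP; rewrite mulf_eq0 invr_eq0 pnatr_eq0 /= => /eqP.
have mK : measurable (K : set (borel A)) by apply: borel_closed; exact: compact_closed_rbcm.
have KD1 : K `<=` root_disc A (r + 1) by move=> z /KD; apply: root_disc_sub; rewrite lerDl.
rewrite -(disc_int_indic lmu mK KD1) lee_fin -int0; apply: le_disc_int => //.
  exact: bounded_borel_indic.
move=> z _; rewrite indicE; have [zK|_] := boolP (z \in K); last by have /andP[] := tent_itv K k.+1%:R z.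
by rewrite tent1//; rewrite inE in zK.
Qed.

(** The limit space is the closed subspace [S], with the limit measure
    restricted to it.  The measure is transported by a Borel retraction [q] onto
    [S], which is harmless since the complement of [S] is negligible. *)
Lemma limit_space_aux : exists L : rmbcmSpace R, exists j : L -> A,
  rooted_isometry j /\ \forall n \near \oo, forall a, a + 4 <= n%:R -> GHV_near kappa j (i n) a (w n + w n).
Proof.
have [L0 [j [ji jS]]] := rbcm_closed_subspace cS S0; have [j0 jd] := ji.
have jinj x y : j x = j y -> x = y by move=> jxy; apply: mdist_positivity; rewrite -jd jxy mdistxx.
have /choice[p pP] : forall z, exists x : L0, S z -> j x = z.
  move=> z; have [Sz|nSz] := pselect (S z); last by exists point.
  by move: Sz; rewrite -jS => -[x _ <-]; exists x.
pose q z : L0 := if pselect (S z) then p z else point.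
have qS z : S z -> j (q z) = z by rewrite /q; case: pselect => // Sz _; exact: pP.
have qnS z : ~ S z -> q z = point by rewrite /q; case: pselect.
have Sj x : S (j x) by rewrite -jS; exists x.
have jC (C : set L0) : closed C -> closed (j @` C).
  move=> cC z cz; have Sz : S z.
    by apply: cS => B /cz[_ [[x Cx <-] Bx]]; exists (j x).
  exists (q z); last exact: qS.
  apply: cC => B /nbhs_ballP[e /= e0 eB]; have [_ [[x Cx <-]]] := cz _ (nbhsx_ballx z _ e0).
  rewrite ballEmdist /= => zx; exists x; split => //; apply: eB.
  by rewrite ballEmdist /= -jd qS.
have mq : measurable_fun [set: borel A] (q : borel A -> borel L0).
  apply: (@measurability _ _ (borel A) (borel L0) setT q (@open L0)); first by [].
  move=> _ [V oV <-]; rewrite setTI.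
  have -> : q @^-1` V = (S `\` j @` (~` V)) `|` (~` S `&` [set z | V point]).
    apply/seteqP; split => z.
      move=> Vz; have [Sz|nSz] := pselect (S z); last by right; split => //=; rewrite -(qnS z).
      left; split => // -[x nVx jx]; apply: nVx; suff -> : x = q z by [].
      by apply: jinj; rewrite qS.
    move=> [[Sz nz]|[nSz /= Vp]]; last by rewrite /= qnS.
    by apply: contrapT => nV; apply: nz; exists (q z) => //; exact: qS.
  apply: measurableU.
    by apply: measurableD => //; apply: borel_closed; apply: jC; exact: open_closedC.
  apply: measurableI; first exact: measurableC.
  have [Vp|nVp] := pselect (V point).
    by rewrite (_ : [set _ | _] = setT)//; apply/seteqP; split.
  by rewrite (_ : [set _ | _] = set0)//; apply/seteqP; split.
have [muL muLE] : exists m : {measure set (borel L0) -> \bar R}, forall B, m B = mu (q @^-1` B).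
  unshelve eexists (pushforward mu (q : borel A -> borel L0) : {measure set (borel L0) -> \bar R}).
    exact: mq.
  by [].
have null (B C : set (borel A)) : measurable B -> measurable C -> B `&` S = C `&` S -> mu B = mu C.
  move=> mB mC BC.
  have split_S (D : set (borel A)) : measurable D -> mu D = mu (D `&` S).
    move=> mD; rewrite -[in LHS](setIT D) -(setUv S) setIUr measureU//.
    - rewrite [X in (_ + X)%E](_ : _ = 0%E) ?adde0//; apply/eqP; rewrite eq_le measure_ge0 andbT -mu_S.
      by apply: le_measure; rewrite ?inE; [apply: measurableI => //; exact: measurableC|exact: measurableC|exact: subIsetr].
    - exact: measurableI.
    - by apply: measurableI => //; exact: measurableC.
    - by apply/seteqP; split => // z [[_ Sz] [_]].
  by rewrite (split_S B)// (split_S C)// BC.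
have lL : locally_finite muL.
  move=> r; rewrite muLE (null _ (root_disc A r)); first exact: lmu.
  - by rewrite -[X in measurable X]setTI; apply: mq => //; exact: measurable_root_disc.
  - exact: measurable_root_disc.
  have E z : S z -> mdist point (q z) = mdist point z.
    by move=> Sz; rewrite -[in RHS](qS z Sz) (rooted_isometry_height ji).
  by apply/seteqP; split => z [zr Sz]; split => //; move: zr; rewrite /root_disc /mdisc /= E.
pose L := RMBCMSpace (locally_finite_radon lL).
exists L, j; split => //; apply: filterS (hpow_small (ltr01 : 0 < (1 : R))) => n h1 a an.
have w2 : w n <= 2 by rewrite /w; lra.
split => [x xa|y ya|phi tphi phi0].
- have [m [nm [y xy]]] : exists m, (n <= m)%N /\ exists y, mdist (j x) (i m y) <= w n.
    have Un : U [set m | (n <= m)%N] by apply: ooU; exists n.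
    by have [m [h2 h3]] := ultra_ex2 UU (Sj x _ (w_gt0 n)) Un; exists m.
  have [||z' [y' ->] yy'] := @downP n (m - n) (i m y).
  + by rewrite subnK//; exists y.
  + have := rad_d (i m y) (j x); rewrite (metric_sym (i m y)) {2}/rad (rooted_isometry_height ji).
    by move: an xa; move: (n%:R) => N /=; lra.
  by exists y'; have := metric_triangle (j x) (i m y) (i n y'); lra.
- have Py : P n (i n y) by exists y.
  have yn : rad (i n y) + w n <= n%:R.
    by rewrite /rad (rooted_isometry_height (ii n)); move: an ya; move: (n%:R) => N /=; lra.
  have uE m : exists x : X m, (n <= m)%N -> mdist (i n y) (i m x) <= w n.
    have [nm|mn] := leqP n m; last by exists point.
    by have [_ [x ->] yx] := upP (m - n) Py yn; move: x yx; rewrite subnK// => x yx; exists x.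
  pose u m : A := i m (projT1 (cid (uE m))).
  have yu m : (n <= m)%N -> mdist (i n y) (u m) <= w n := projT2 (cid (uE m)).
  have Un : U [set m | (n <= m)%N] by apply: ooU; exists n.
  have [||z uz] := @rbcm_ultra_cvg R A (u @ U) n%:R; first exact: ultra_fmap.
    suff : U [set m | rad (u m) <= n%:R] by [].
    apply: filterS Un => m /= nm; have := rad_d (u m) (i n y); rewrite (metric_sym (u m)).
    by have := yu m nm; move: yn; move: (n%:R) => N; lra.
  have uz' e : 0 < e -> U [set m | mdist z (u m) <= e] by move=> /uz.
  have Sz : S z.
    by move=> e /uz'; apply: filterS => m zu; exists (projT1 (cid (uE m))).
  exists (q z); rewrite qS//; have [m [/= nm zu]] := ultra_ex2 UU Un (uz' _ (w_gt0 n)).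
  by have := yu m nm; have := metric_triangle z (u m) (i n y); rewrite (metric_sym (u m)); lra.
have bphi := test_bounded_borel hk tphi.
have an' : a <= n%:R by move: an; move: (n%:R) => N; lra.
have -> : disc_int (rmbcm_measure L) a (phi \o j) = disc_int mu a phi.
  rewrite -(isom_disc_int ji _ lL bphi) /disc_int; congr fine.
  apply: eq_measure_integral => B mB _; rewrite /= /pushforward muLE; apply: null => //.
    rewrite -[X in measurable X]setTI; apply: mq => //.
    by rewrite -[X in measurable X]setTI; exact: isometry_measurable.
  by apply/seteqP; split => z [zB Sz]; split => //; move: zB; rewrite /= qS.
rewrite -(isom_disc_int (ii n) _ (lX n) bphi).
by apply: le_trans (test_lim tphi phi0 an') _; rewrite lerDl ltW.
Qed.

End with_limit.

Lemma limit_space : exists L : rmbcmSpace R, forall e, 0 < e -> \forall n \near \oo, (GHV_dist kappa L (X n) < e%:E)%E.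
Proof.
have [U [mu [UU ooU lmu muP]]] := ambient_limit.
have [L [j [ji jn]]] := limit_space_aux UU ooU lmu muP.
exists L => e e0; have [N _ NP] := near_dist_in hk L e0.
have N4 : 0 < N.+1%:R^-1 / 4 :> R by rewrite divr_gt0// invr_gt0.
near=> n; apply: le_lt_trans (GHV_dist_le kappa ji (ii n)) _; apply: NP => //.
have wn : w n + w n <= N.+1%:R^-1.
  have : hpow R n <= N.+1%:R^-1 / 4 by near: n; exact: hpow_small.
  by rewrite /w; move: (N.+1%:R^-1) => c; lra.
apply: (near_le _ wn); clear wn; near: n.
apply: filterS2 jn (nat_ge_near (N%:R + 4)) => m jnn Nm; exact: (jnn _ Nm).
Unshelve. all: by end_near.
Qed.

End limit_space.

(** * Completeness *)

Section complete.
Variables (R : realType) (kappa : R) (hk : 0 < kappa <= 1).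

Lemma chain_limit (X : nat -> rmbcmSpace R) :
  (forall n, exists (Z : rbcmType R) (f : X n -> Z) (g : X n.+1 -> Z),
     [/\ rooted_isometry f, rooted_isometry g & GHV_near kappa f g (n%:R + 1) (hpow R n / 2)]) ->
  exists L : rmbcmSpace R, forall e, 0 < e -> \forall n \near \oo, (GHV_dist kappa L (X n) < e%:E)%E.
Proof.
move=> XP.
pose S n := {Z : rbcmType R & ((X n -> Z) * (X n.+1 -> Z))%type}.
have sP n : exists s : S n, [/\ rooted_isometry (projT2 s).1, rooted_isometry (projT2 s).2 &
    GHV_near kappa (projT2 s).1 (projT2 s).2 (n%:R + 1) (hpow R n / 2)].
  by have [Z [f [g h]]] := XP n; exists (existT _ Z (f, g)).
pose s n := projT1 (cid (sP n)).
pose f n : X n -> projT1 (s n) := (projT2 (s n)).1.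
pose g n : X n.+1 -> projT1 (s n) := (projT2 (s n)).2.
have fi n : rooted_isometry (f n) by have [] := projT2 (cid (sP n)).
have gi n : rooted_isometry (g n) by have [] := projT2 (cid (sP n)).
have fg n : GHV_near kappa (f n) (g n) (n%:R + 1) (hpow R n / 2) by have [] := projT2 (cid (sP n)).
have half n : hpow R n / 2 <= hpow R n by have := hpow_gt0 R n; lra.
have n1 (n : nat) : n%:R <= n%:R + 1 :> R by rewrite lerDl.
have [||A [i [ii ile]]] := @ambient_chain R X (fun n => projT1 (s n)) f g fi gi.
- move=> n x xn; have [h _ _] := fg n; have [|y xy] := h x; first exact: le_trans (n1 n).
  by exists y; exact: le_trans (half n).
- move=> n y yn; have [_ h _] := fg n; have [|x xy] := h y; first exact: le_trans (n1 n).
  by exists x; exact: le_trans (half n).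
apply: (limit_space hk ii) => n.
have := near_transfer hk (fi n) (gi n) (ii n) (ii n.+1) (ile n) (fg n).
by rewrite mulrC divrK// unitfE.
Qed.

(** It suffices that a subsequence converges; one with rapidly decreasing
    distances consists of spaces that are near with summable tolerances. *)
Lemma GHV_complete (u : nat -> rmbcmSpace R) :
  (forall e : R, 0 < e -> exists N : nat, forall m n : nat, (N <= m)%N -> (N <= n)%N ->
     (GHV_dist kappa (u m) (u n) < e%:E)%E) ->
  exists L : rmbcmSpace R, forall e, 0 < e -> \forall n \near \oo, (GHV_dist kappa L (u n) < e%:E)%E.
Proof.
move=> uC.
pose c (k : nat) : R := hpow R k / 4.
have c01 k : 0 < c k <= 1.
  have h1 : hpow R k <= 1 := hpow_le R (leq0n k).
  by rewrite divr_gt0 ?hpow_gt0//= /c; lra.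
pose eta k : R := c k * expR (- ((k%:R + 1) + 1)) / 2.
have eta0 k : 0 < eta k by rewrite divr_gt0// mulr_gt0 ?expR_gt0//; case/andP: (c01 k).
have /choice[N NP] : forall k, exists N : nat, forall m n : nat, (N <= m)%N -> (N <= n)%N ->
    (GHV_dist kappa (u m) (u n) < (eta k)%:E)%E by move=> k; exact: uC.
pose v (k : nat) := ((\sum_(j < k.+1) N j) + k)%N.
have vN k : (N k <= v k)%N by rewrite /v big_ord_recr /= -addnA addnCA leq_addr.
have vS k : (v k <= v k.+1)%N.
  by rewrite /v [in leqRHS]big_ord_recr /= addnS ltnW// ltnS -addnA leq_add2l leq_addl.
have kv k : (k <= v k)%N by rewrite /v leq_addl.
have [k|L LP] := @chain_limit (u \o v).
  have := NP k (v k) (v k.+1) (vN k) (leq_trans (vN k) (vS k)).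
  move=> /GHV_lt[Z [f [g [fi gi dfg]]]]; exists Z, f, g; split => //.
  have k1 : 0 <= k%:R + 1 :> R by rewrite addr_ge0.
  have := dist_in_near hk fi gi k1 (c01 k) dfg; rewrite /c.
  by move/near_le; apply; move: (hpow R k) => h; lra.
exists L => e e0; have e2 : 0 < e / 2 by rewrite divr_gt0.
have [M MP] := uC _ e2; exists M => // n /= Mn.
have [k [/= Lk Mk]] := filter_ex (filterI (LP _ e2) (nbhs_infty_ge M)).
apply: le_lt_trans (GHV_triangle hk L (u (v k)) (u n)) _.
by rewrite (splitr e) EFinD lteD// MP// (leq_trans Mk).
Qed.

End complete.

(** * Separability *)

Section separable.
Variables (R : realType) (kappa : R) (hk : 0 < kappa <= 1).

Local Notation code_type := (nat * seq (seq int) * seq int)%type.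

(** The masses are multiplied by the number [n] of cells as well: then the errors of all
    cells together are at most [1 / (q + 1)]. *)
Definition has_code (k q : nat) (v : code_type) (X : rmbcmSpace R) :=
  exists (n : nat) (x : nat -> X) (J : X -> nat),
  let cell j := root_disc X k%:R `&` [set y | J y = j] in
  [/\ (0 < n)%N, x 0%N = point, forall j, measurable (cell j : set (borel X)),
      forall y, mdist point y <= k%:R -> (J y < n)%N /\ mdist (x (J y)) y <= q.+1%:R^-1 &
      v = (n, mkseq (fun i => mkseq (fun j => Num.floor (q.+1%:R * mdist (x i) (x j))) n) n,
              mkseq (fun i => Num.floor ((q.+1 * n)%:R * fine (rmbcm_measure X (cell i)))) n)].

(** Each point is assigned to the first ball of a net that contains it. *)
Lemma has_code_ex (k q : nat) (X : rmbcmSpace R) : exists v, has_code k q v X.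
Proof.
have c0 : 0 < q.+1%:R^-1 :> R by rewrite invr_gt0.
have [n [x xP]] := @rbcm_net R X k%:R _ c0.
pose x' (i : nat) := if i is i'.+1 then x i' else point.
pose B i : set X := [set y | mdist (x' i) y <= q.+1%:R^-1].
pose J y := find (fun i => `[< B i y >]) (iota 0 n.+1).
have mB i : measurable (B i : set (borel X)) by apply: borel_closed; exact: closed_mdisc.
have Jlt (y : X) : mdist point y <= k%:R -> (J y < n.+1)%N.
  move=> yk; rewrite -[X in (_ < X)%N](size_iota 0 n.+1) -has_find; apply/hasP.
  by have [i il ix] := xP y yk; exists i.+1; [rewrite mem_iota add0n ltnS|apply/asboolP].
eexists; exists n.+1, x', J; split => //; last first.
  move=> y yk; split; first exact: Jlt.
  have h : has (fun i => `[< B i y >]) (iota 0 n.+1) by rewrite has_find size_iota Jlt.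
  have := nth_find 0%N h; rewrite -/(J y) nth_iota ?Jlt// add0n.
  by move/asboolP.
move=> j; rewrite (_ : _ `&` _ = root_disc X k%:R `&` (B j `&` ~` (\bigcup_(i in [set i | (i < j)%N]) B i))).
  apply: measurableI; first exact: measurable_root_disc.
  apply: measurableI => //; apply: measurableC; apply: bigcup_measurable => i _; exact: mB.
apply/seteqP; split => y [yk].
  move=> /= yj; split => //; have h : has (fun i => `[< B i y >]) (iota 0 n.+1) by rewrite has_find size_iota Jlt.
  split.
    have := nth_find 0%N h; rewrite -/(J y) nth_iota ?Jlt// add0n yj.
    by move/asboolP.
  move=> [i /= ij Biy]; have := @before_find _ 0%N (fun i => `[< B i y >]) (iota 0 n.+1) i.
  rewrite -/(J y) yj ij nth_iota ?add0n; last by apply: ltn_trans ij _; rewrite -yj Jlt.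
  by move=> /(_ isT)/asboolP.
move=> [Bj noB]; split => //=; have Jn := Jlt y yk.
have h : has (fun i => `[< B i y >]) (iota 0 n.+1) by rewrite has_find size_iota.
have BJ : B (J y) y by have := nth_find 0%N h; rewrite -/(J y) nth_iota ?Jlt// add0n => /asboolP.
apply/eqP; rewrite eqn_leq; apply/andP; split; rewrite leqNgt; apply/negP => jJ.
  have := @before_find _ 0%N (fun i => `[< B i y >]) (iota 0 n.+1) j.
  by rewrite -/(J y) jJ nth_iota ?add0n; [move=> /(_ isT)/asboolP|exact: ltn_trans jJ Jn].
by apply: noB; exists (J y).
Qed.

Lemma floor_close (a b : R) : Num.floor a = Num.floor b -> `|a - b| <= 1.
Proof.
move=> ab; have /andP[a1 a2] := floor_itv a; have /andP[b1 b2] := floor_itv b.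
rewrite ab in a1 a2; rewrite intrD in a2; rewrite intrD in b2.
by move: a1 a2 b1 b2; move: ((Num.floor b)%:~R) => c; rewrite ler_norml => *; apply/andP; split; lra.
Qed.

(** The nets are almost isometric, so that the spaces can be glued along them; the
    masses of corresponding cells are almost equal. *)
Lemma code_near (N k q : nat) (v : code_type) (X Y : rmbcmSpace R) (e : R) : (N <= k)%N ->
  q.+1%:R^-1 `^ kappa * (3 * disc_mass (rmbcm_measure X) k%:R + 2) <= e ->
  has_code k q v X -> has_code k q v Y ->
  exists (Z : rbcmType R) (f : X -> Z) (g : Y -> Z),
    [/\ rooted_isometry f, rooted_isometry g & GHV_near kappa f g N%:R e].
Proof.
move=> Nk qe [n [x [J [n0 x0 mJ JP vE]]]] [n' [y [J' [_ y0 mJ' JP' vE']]]].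
have [nn' dE mE] : [/\ n = n',
    forall i j, (i < n)%N -> (j < n)%N -> Num.floor (q.+1%:R * mdist (x i) (x j)) = Num.floor (q.+1%:R * mdist (y i) (y j)) &
    forall i, (i < n)%N -> Num.floor ((q.+1 * n)%:R * fine (rmbcm_measure X (root_disc X k%:R `&` [set z | J z = i]))) =
      Num.floor ((q.+1 * n')%:R * fine (rmbcm_measure Y (root_disc Y k%:R `&` [set z | J' z = i])))].
  move: vE'; rewrite vE => -[nn' E1 E2]; split=> // [i j il jl|i il].
    have := congr1 (fun s => nth 0 (nth [::] s i) j) E1; rewrite !nth_mkseq -?nn'//.
  by have := congr1 (fun s => nth 0 s i) E2; rewrite !nth_mkseq -?nn'.
subst n'; set c : R := q.+1%:R^-1.
have q0 : 0 < q.+1%:R :> R by rewrite ltr0n.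
have c0 : 0 < c by rewrite invr_gt0.
have c1 : c <= 1 by rewrite invf_le1// ler1n.
have /andP[k0 k1] := hk.
have ck : c <= c `^ kappa by apply: ger1_powR => //; rewrite c0.
have d_close i j : (i < n)%N -> (j < n)%N -> `|mdist (x i) (x j) - mdist (y i) (y j)| <= c.
  move=> il jl; have := floor_close (dE i j il jl).
  rewrite -mulrBr normrM gtr0_norm// => h.
  by rewrite /c -[leRHS]mulr1 ler_pdivlMl.
pose m i := fine (rmbcm_measure X (root_disc X k%:R `&` [set z | J z = i])).
pose m' i := fine (rmbcm_measure Y (root_disc Y k%:R `&` [set z | J' z = i])).
have m_close i : (i < n)%N -> `|m i - m' i| <= c / n%:R.
  move=> il; have := floor_close (mE i il); rewrite -mulrBr normrM gtr0_norm ?ltr0n ?muln_gt0//.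
  move=> h; rewrite /c -invfM -natrM -[leRHS]mul1r ler_pdivlMr ?ltr0n ?muln_gt0//.
  by rewrite mulrC.
pose delta (i : 'I_n) : R := if val i == 0%N then 0 else c.
have [i||||i j|Z [f [g [fi gi fg]]]] := @rbcm_glue R X Y 'I_n (fun i => x i) (fun i => y i) delta (Ordinal n0).
- by rewrite /delta; case: ifP => // _; exact: ltW.
- exact: x0.
- exact: y0.
- by [].
- rewrite /delta; case: ifPn => [/eqP i0|_]; case: ifPn => [/eqP j0|_].
  + by rewrite i0 j0 !mdistxx subrr normr0 addr0.
  + by rewrite add0r d_close.
  + by rewrite addr0 d_close.
  + by apply: le_trans (d_close _ _ (ltn_ord i) (ltn_ord j)) _; rewrite lerDl ltW.
have {}fg i : (i < n)%N -> mdist (f (x i)) (g (y i)) <= c.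
  move=> il; apply: le_trans (fg (Ordinal il)) _; rewrite /delta; case: ifP => // _; exact: ltW.
exists Z, f, g; split => //.
have [_ fd] := fi; have [_ gd] := gi.
have lX := @rmbcm_locally_finite _ X; have lY := @rmbcm_locally_finite _ Y.
set MX := disc_mass (rmbcm_measure X) k%:R; have MX0 : 0 <= MX by exact: disc_mass_ge0.
set MY := disc_mass (rmbcm_measure Y) k%:R.
have NkR : N%:R <= k%:R :> R by rewrite ler_nat.
have c2e : c + c <= e.
  apply: le_trans qe; rewrite -/c -/MX.
  have : c `^ kappa * 2 <= c `^ kappa * (3 * MX + 2) by rewrite ler_wpM2l ?powR_ge0// lerDr mulr_ge0.
  by apply: le_trans; lra.
have mX := measurable_root_disc X k%:R; have mY := measurable_root_disc Y k%:R.
have partX (h : nat -> R) := Rintegral_partition mX (lX _) h mJ (fun z zk => (JP z zk).1).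
have partY (h : nat -> R) := Rintegral_partition mY (lY _) h mJ' (fun z zk => (JP' z zk).1).
have sumX : \sum_(i < n) m i = MX.
  have [_] := partX (fun=> 1); rewrite Rintegral_cst// mul1r -/(disc_mass _ _) -/MX => ->.
  by apply: eq_bigr => i _; rewrite mul1r.
have sumY : \sum_(i < n) m' i = MY.
  have [_] := partY (fun=> 1); rewrite Rintegral_cst// mul1r -/(disc_mass _ _) -/MY => ->.
  by apply: eq_bigr => i _; rewrite mul1r.
have sum_close : \sum_(i < n) `|m i - m' i| <= c.
  apply: (@le_trans _ _ (\sum_(i < n) (c / n%:R))).
    by apply: ler_sum => i _; exact: m_close.
  by rewrite sumr_const card_ord -(mulr_natr (c / n%:R)) divfK// pnatr_eq0 -lt0n.
have MYX : MY <= MX + c.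
  rewrite -sumX -sumY -lerBlDl -sumrB; apply: le_trans sum_close.
  by apply: ler_sum => i _; rewrite distrC ler_norm.
split=> [z zN|z zN|phi tphi phi0].
- have [Jn Jz] := JP z (le_trans zN NkR); exists (y (J z)).
  have := metric_triangle (f z) (f (x (J z))) (g (y (J z))).
  rewrite fd (metric_sym z); have := fg _ Jn; move: Jz c2e; rewrite -/c; lra.
- have [Jn Jz] := JP' z (le_trans zN NkR); exists (x (J' z)).
  have := metric_triangle (f (x (J' z))) (g (y (J' z))) (g z).
  rewrite gd; have := fg _ Jn; move: Jz c2e; rewrite -/c; lra.
have [phi1 ph] := tphi; have bphi := test_bounded_borel hk tphi.
have bX := bounded_borel_comp fi bphi; have bY := bounded_borel_comp gi bphi.
rewrite -(disc_int_support lX NkR bX); last first.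
  by move=> z zN; apply: phi0; rewrite (rooted_isometry_height fi).
rewrite -(disc_int_support lY NkR bY); last first.
  by move=> z zN; apply: phi0; rewrite (rooted_isometry_height gi).
pose t := c `^ kappa; have t0 : 0 <= t by exact: powR_ge0.
have phc z z' : mdist z z' <= c -> `|phi z - phi z'| <= t.
  move=> zz'; apply: le_trans (ph z z') _; rewrite mul1r.
  by rewrite ge0_ler_powR ?nnegrE ?mdist_ge0 ?(ltW k0) ?(ltW c0).
have [mgX EX] := partX (fun i => phi (f (x i))).
have [mgY EY] := partY (fun i => phi (g (y i))).
have IX : `|disc_int (rmbcm_measure X) k%:R (phi \o f) - \sum_(i < n) phi (f (x i)) * m i| <= t * MX.
  rewrite -EX disc_intE; apply: (@Rintegral_close _ _ _ _ _ mX (lX _) _ _ 1) => //.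
  - by have [mf _] := bX; exact: measurable_funTS.
  - by move=> z _; exact: phi1.
  by move=> z zk; apply: phc; rewrite fd metric_sym; have [] := JP z zk.
have IY : `|disc_int (rmbcm_measure Y) k%:R (phi \o g) - \sum_(i < n) phi (g (y i)) * m' i| <= t * MY.
  rewrite -EY disc_intE; apply: (@Rintegral_close _ _ _ _ _ mY (lY _) _ _ 1) => //.
  - by have [mf _] := bY; exact: measurable_funTS.
  - by move=> z _; exact: phi1.
  by move=> z zk; apply: phc; rewrite gd metric_sym; have [] := JP' z zk.
have ISum : `|\sum_(i < n) phi (f (x i)) * m i - \sum_(i < n) phi (g (y i)) * m' i| <= t * MX + c.
  rewrite -sumrB; apply: le_trans (ler_norm_sum _ _ _) _.
  apply: (@le_trans _ _ (\sum_(i < n) (t * m i + `|m i - m' i|))).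
    apply: ler_sum => i _.
    have m0 : 0 <= m i by rewrite fine_ge0.
    rewrite (_ : _ - _ = (phi (f (x i)) - phi (g (y i))) * m i + phi (g (y i)) * (m i - m' i)); last first.
      by rewrite mulrBl mulrBr addrA subrK.
    apply: le_trans (ler_normD _ _) _; rewrite !normrM (ger0_norm m0); apply: lerD.
      by rewrite ler_wpM2r// phc// fg.
    by rewrite ler_piMl.
  by rewrite big_split /= -mulr_sumr sumX lerD2l.
have tMY : t * MY <= t * MX + t * c by rewrite -mulrDr ler_wpM2l.
have tc : t * c <= t by rewrite ler_piMr.
apply: le_trans qe; rewrite -/c -/t -/MX.
have -> : t * (3 * MX + 2) = t * MX + t * MX + t * MX + t + t.
  by rewrite mulrDr mulrCA; move: (t * MX) => p; lra.
have ct : c <= t by exact: ck.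
by move: IX IY ISum; rewrite !ler_norml => /andP[? ?] /andP[? ?] /andP[? ?]; apply/andP; split; lra.
Qed.

(** One space is chosen in [M] for each of the countably many codes. *)
Lemma GHV_separable (M : set (rmbcmSpace R)) : separable_on M (GHV_dist kappa).
Proof.
pose C (w : nat * nat * code_type) := [set X | M X /\ has_code w.1.1 w.1.2 w.2 X].
pose S w : set (rmbcmSpace R) := if pselect (C w !=set0) is left h then [set sval (cid h)] else set0.
exists (\bigcup_w S w); split.
- by move=> X [w _]; rewrite /S; case: pselect => // h ->; case: cid => Y [].
- apply: bigcup_countable; first exact: countableP.
  move=> w _; rewrite /S; case: pselect => h; [exact: countable1|exact: countable0].
move=> X MX e e0; have [N _ NP] := near_dist_in hk X e0.
pose m := 3 * disc_mass (rmbcm_measure X) N%:R + 2.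
have m0 : 0 < m by rewrite /m ltr_wpDl// mulr_ge0// disc_mass_ge0//; exact: rmbcm_locally_finite.
have /andP[k0 _] := hk.
have t0 : 0 < (N.+1%:R^-1 / m) `^ kappa^-1 by rewrite powR_gt0// divr_gt0// invr_gt0.
have /filter_ex[q /= qt] := natSinv_small t0.
have qm : q.+1%:R^-1 `^ kappa * m <= N.+1%:R^-1.
  rewrite -ler_pdivlMr//.
  have -> : N.+1%:R^-1 / m = ((N.+1%:R^-1 / m) `^ kappa^-1) `^ kappa.
    by rewrite -powRrM mulVf ?gt_eqF// powRr1// ltW// divr_gt0// invr_gt0.
  by rewrite ge0_ler_powR ?nnegrE ?(ltW k0) ?(ltW t0) ?invr_ge0.
have [v Xv] := has_code_ex N q X.
have CX : C (N, q, v) !=set0 by exists X.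
have [Y SY] : exists Y, S (N, q, v) Y.
  by rewrite /S; case: pselect => // h; exists (sval (cid h)).
have Yv : has_code N q v Y.
  by move: SY; rewrite /S; case: pselect => // h ->; case: cid => Y' [].
exists Y; first by exists (N, q, v).
have [Z [f [g [fi gi nfg]]]] := code_near (leqnn N) qm Xv Yv.
by apply: le_lt_trans (GHV_dist_le kappa fi gi) _; exact: NP.
Qed.

End separable.

Theorem theorem2p32 (R : realType) (kappa : R) (hkappa : 0 < kappa <= 1)
    (M : set (rmbcmSpace R)) (hM : rmbcm_transversal M) :
  [/\ metric_on M (GHV_dist kappa), complete_on M (GHV_dist kappa)
    & separable_on M (GHV_dist kappa)].
Proof.
split; last exact: GHV_separable.
  split=> [X Y _ _|X Y MX MY|X Y _ _|X Y W _ _ _].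
  - by rewrite GHV_ge0//= (le_lt_trans (GHV_le1 hkappa X Y))// ltry.
  - split=> [/(GHV0_equiv hkappa) XY|->]; last exact/(equiv_GHV0 hkappa)/rmbcm_equiv_refl.
    have [V [_ Vuniq]] := hM X.
    rewrite -(Vuniq X); last by split => //; exact: rmbcm_equiv_refl.
    by rewrite -(Vuniq Y).
  - exact: GHV_sym.
  - exact: GHV_triangle.
move=> u Mu uC; have [L LP] := GHV_complete hkappa uC.
have [Y [[MY LY] _]] := hM L; exists Y => //.
have YL : GHV_dist kappa Y L = 0%E by rewrite GHV_sym// (equiv_GHV0 hkappa LY).
apply/(@fine_cvgP _ _ _ _ _ 0); split.
  apply: nearW => n; rewrite ge0_fin_numE ?GHV_ge0//.
  by rewrite (le_lt_trans (GHV_le1 hkappa _ _))// ltry.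
apply/cvgrPdist_le => e e0; near=> n.
have : (GHV_dist kappa (u n) Y <= e%:E)%E.
  rewrite GHV_sym//; apply: le_trans (GHV_triangle hkappa Y L (u n)) _.
  by rewrite YL add0e ltW//; near: n; exact: LP.
have d0 := GHV_ge0 kappa (u n) Y.
rewrite /= sub0r normrN ger0_norm ?fine_ge0// => de.
rewrite -lee_fin fineK// ge0_fin_numE//.
by rewrite (le_lt_trans (GHV_le1 hkappa _ _))// ltry.
Unshelve. all: by end_near.
Qed.
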